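(* Let $\pi_1$ be a probability density on $\mathbb{R}$ with $D[\log\pi_1]$ Lipschitz, and suppose that the one-dimensional generator $G_1f=D^2[f]+D[\log\pi_1]\,D[f]$ has a spectral gap $\lambda^\star>0$. Let $c_i>0$ for $1\le i\le k$, and let $Q\in\mathbb{R}^{k\times k}$ satisfy $Q'=Q^{-1}$. Let $$\pi(x)=\prod_{i=1}^kc_i\,\pi_1(c_i\,e_i'Qx),\qquad x\in\mathbb{R}^k,$$ where $e_i$ are the standard basis vectors, so that $X\sim\pi$ if and only if the variables $c_ie_i'QX$, $1\le i\le k$, are i.i.d. with density $\pi_1$. Then $$\Sigma:=\mathrm{Var}_{X\sim\pi}(\nabla\log\pi(X))=\sigma^2\,Q'\,\mathrm{diag}(c_i^2)\,Q,\qquad\sigma^2=\mathbb{E}_{X_1\sim\pi_1}\big[(D\log\pi_1(X_1))^2\big],$$ and, among symmetric positive definite $\Lambda$ of the form $Q'DQ$ with $D$ diagonal, the spectral gap of $G^\Lambda$ is maximised by $\Lambda=\Sigma^{-1}$. The convergence to stationarity is $\frac{\mathrm{Tr}(\Sigma)}{k\,\lambda_1(\Sigma)}$ times faster when using the optimal shaping as opposed to spherical shaping $\Lambda=I$, i.e. the ratio of the spectral gap of $G^{\Sigma^{-1}}$ to the spectral gap of $G^{I}$ equals $\frac{\mathrm{Tr}(\Sigma)}{k\,\lambda_1(\Sigma)}$, where $\lambda_1(\Sigma)$ is the minimal eigenvalue of $\Sigma$.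
   Context: For symmetric positive definite $\Lambda\in\mathbb{R}^{k\times k}$, $G^\Lambda$ is the generator (of a reversible diffusion with stationary density $\pi$, regarded in $L^2(\pi)$) $$G^{\Lambda}f=k\Big(\frac{\Lambda}{\Lambda:\Sigma}:\nabla^2f+[\nabla\log\pi]'\frac{\Lambda}{\Lambda:\Sigma}\nabla f\Big),\qquad A:B=\sum_{i,j}A_{ji}B_{ij}.$$ The spectral gap of such a generator $G$ with stationary density $\pi$ is the largest $\rho>0$ such that for all $f$ in the domain $\mathcal{D}(G)$, $$\mathrm{Var}_{X\sim\pi}f(X)\le-\frac1\rho\,\mathbb{E}_{X\sim\pi}\big(f(X)\,[Gf](X)\big);$$ $G$ has a spectral gap if such $\rho>0$ exists. The spectral gap of $G_1$ is defined in the same way, with $\pi_1$ in place of $\pi$. The speed of convergence to stationarity is measured by the spectral gap. The Lipschitz assumption is understood to include that $\log\pi_1$ is finite and differentiable on $\mathbb{R}$. *)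

(* Defs.v *)
From HB Require Import structures.
From mathcomp Require Import all_boot all_order all_algebra.
From mathcomp Require Import all_classical all_reals all_analysis.

Set Implicit Arguments.
Unset Strict Implicit.
Unset Printing Implicit Defensive.

Import Order.TTheory GRing.Theory Num.Theory.
Import numFieldTopology.Exports numFieldNormedType.Exports.

Local Open Scope classical_set_scope.
Local Open Scope ring_scope.

(* R^k carries the sigma-algebra generated by the coordinates, i.e. the Borel
   one, in the same way as the library does for tuples. *)
Definition cV_display : measure_display -> measure_display.
Proof. exact. Qed.

Section measurable_cV.
Context {R : realType} (k : nat).

Definition cV_coord (i : 'I_k) (v : 'cV[R]_k) : R := v i 0.

Let cV_set0 : g_sigma_preimage cV_coord set0.
Proof. exact: sigma_algebra0. Qed.

Let cV_setC A : g_sigma_preimage cV_coord A -> g_sigma_preimage cV_coord (~` A).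
Proof. exact: sigma_algebraC. Qed.

Let cV_bigcup (F : _^nat) : (forall i, g_sigma_preimage cV_coord (F i)) ->
  g_sigma_preimage cV_coord (\bigcup_i (F i)).
Proof. exact: sigma_algebra_bigcup. Qed.

HB.instance Definition _ := @isMeasurable.Build (cV_display default_measure_display)
  'cV[R]_k (g_sigma_preimage cV_coord) cV_set0 cV_setC cV_bigcup.

End measurable_cV.

Section lebesgue_cV.
Context {R : realType}.

Lemma measurable_cV_coord k (i : 'I_k) :
  measurable_fun [set: 'cV[R]_k] (cV_coord i).
Proof.
move=> _ Y mY; rewrite setTI; apply: sub_sigma_algebra => /=.
rewrite -bigcup_seq/=; exists i => /=; first by rewrite mem_index_enum.
by exists Y => //; rewrite setTI.
Qed.

Lemma measurable_fun_cVP d (T : measurableType d) k (f : T -> 'cV[R]_k) :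
  (forall i, measurable_fun [set: T] (fun t => f t i 0)) ->
  measurable_fun [set: T] f.
Proof.
move=> mf _ A; rewrite setTI; move: A.
suff : @measurable _ 'cV[R]_k `<=` [set A | measurable (f @^-1` A)] by [].
apply: smallest_sub.
  split.
  - exact: measurable0.
  - move=> A /= mA; rewrite setTD -preimage_setC; exact: measurableC.
  - by move=> F mF /=; rewrite preimage_bigcup; exact: bigcupT_measurable.
move=> A; rewrite -bigcup_seq => -[i _ [B mB <-]] /=.
rewrite setTI; have := mf i measurableT B mB.
by rewrite setTI.
Qed.

Definition cV_cons k (p : R * 'cV[R]_k) : 'cV[R]_(k.+1) :=
  \col_i (if unlift ord0 i is Some j then p.2 j 0 else p.1).

Definition cV_uncons k (v : 'cV[R]_(k.+1)) : R * 'cV[R]_k :=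
  (v ord0 0, \col_j v (lift ord0 j) 0).

Lemma cV_consK k : cancel (@cV_cons k) (@cV_uncons k).
Proof.
case=> x v; rewrite /cV_uncons mxE unlift_none; congr pair.
by apply/colP => j; rewrite !mxE liftK.
Qed.

Lemma measurable_cV_cons k : measurable_fun setT (@cV_cons k).
Proof.
apply: measurable_fun_cVP => i; rewrite /cV_cons.
case: (unliftP ord0 i) => [j ->|->].
- rewrite (_ : (fun _ => _) = cV_coord j \o snd); last first.
    by apply/funext => p /=; rewrite mxE liftK.
  by apply: measurableT_comp; [exact: measurable_cV_coord|exact: measurable_snd].
- rewrite (_ : (fun _ => _) = fst); first exact: measurable_fst.
  by apply/funext => p /=; rewrite mxE unlift_none.
Qed.

Lemma measurable_cV_uncons k : measurable_fun setT (@cV_uncons k).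
Proof.
apply/measurable_fun_pair; first exact: (@measurable_cV_coord k.+1 ord0).
apply: measurable_fun_cVP => i.
rewrite (_ : (fun _ => _) = cV_coord (lift ord0 i)); last first.
  by apply/funext => p /=; rewrite mxE.
exact: measurable_cV_coord.
Qed.

Lemma sigma_finite_prod d1 d2 (T1 : measurableType d1) (T2 : measurableType d2)
    (m1 : {sigma_finite_measure set T1 -> \bar R})
    (m2 : {sigma_finite_measure set T2 -> \bar R}) :
  sigma_finite setT (m1 \x m2)%E.
Proof.
have /sigma_finiteP[F [TF ndF Foo]] := sigma_finiteT m1.
have /sigma_finiteP[G [TG ndG Goo]] := sigma_finiteT m2.
exists (fun n => F n `*` G n).
  rewrite -setXTT TF TG predeqE => -[x y]; split; last first.
    by move=> [n _ []/= ? ?]; split; exists n.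
  move=> [/= [n _ Fnx] [j _ Gjy]]; exists (maxn n j) => //; split.
  - by move: x Fnx; exact/subsetPset/ndF/leq_maxl.
  - by move: y Gjy; exact/subsetPset/ndG/leq_maxr.
move=> n; have [? ?] := Foo n; have [? ?] := Goo n.
split; first exact: measurableX.
by rewrite product_measure1E// lte_mul_pinfty// ge0_fin_numE.
Qed.

Section step.
Context (k : nat) (m : {sigma_finite_measure set 'cV[R]_k -> \bar R}).

Definition lebesgue_cV_step : set 'cV[R]_(k.+1) -> \bar R :=
  pushforward (@lebesgue_measure R \x m)%E (@cV_cons k).

Let mcons A : measurable A -> measurable (@cV_cons k @^-1` A).
Proof. by rewrite -[X in _ -> measurable X]setTI; exact: measurable_cV_cons. Qed.

Let step0 : lebesgue_cV_step set0 = 0%E.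
Proof. by rewrite /lebesgue_cV_step /pushforward preimage_set0 measure0. Qed.

Let step_ge0 A : (0 <= lebesgue_cV_step A)%E.
Proof. by rewrite /lebesgue_cV_step /pushforward measure_ge0. Qed.

Let step_sigma_additive : semi_sigma_additive lebesgue_cV_step.
Proof.
move=> F mF tF mUF; rewrite /lebesgue_cV_step /pushforward preimage_bigcup.
apply: measure_semi_sigma_additive.
- by move=> n; exact: mcons.
- apply/trivIsetP => /= i j _ _ ij; rewrite -preimage_setI.
  by move/trivIsetP : tF => /(_ _ _ _ _ ij) ->//; rewrite preimage_set0.
- by rewrite -preimage_bigcup; exact: mcons.
Qed.

HB.instance Definition _ := isMeasure.Build _ _ _
  lebesgue_cV_step step0 step_ge0 step_sigma_additive.

Let lebesgue_cV_step_sigma_finite : sigma_finite setT lebesgue_cV_step.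
Proof.
have [F UF mF] : sigma_finite setT (@lebesgue_measure R \x m)%E.
  exact: sigma_finite_prod.
exists (fun i => @cV_uncons k @^-1` F i).
  by rewrite -preimage_bigcup -UF preimage_setT.
move=> i; have [mFi Fi] := mF i; split.
  by rewrite -[X in measurable X]setTI; exact: measurable_cV_uncons.
rewrite /lebesgue_cV_step /pushforward -comp_preimage.
by rewrite (_ : _ \o _ = id) //; apply/funext => p /=; rewrite cV_consK.
Qed.

HB.instance Definition _ := @Measure_isSigmaFinite.Build _ _ _
  lebesgue_cV_step lebesgue_cV_step_sigma_finite.

End step.

(* Lebesgue measure on R^k: the k-fold product of the one on R *)
Fixpoint lebesgue_cV (k : nat) : {sigma_finite_measure set 'cV[R]_k -> \bar R} :=
  match k with
  | 0 => (\d_(0 : 'cV[R]_0))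
  | k'.+1 => lebesgue_cV_step (lebesgue_cV k')
  end.

End lebesgue_cV.

Section probability_notions.
Context {R : realType}.
Local Open Scope ereal_scope.

Definition has_density d (T : measurableType d) (mu : {measure set T -> \bar R})
    (P : set T -> \bar R) (p : T -> R) :=
  forall A, measurable A -> P A = \int[mu]_(x in A) (p x)%:E.

Definition mutually_independent d (T : measurableType d) (P : probability T R)
    (k : nat) (Y : 'I_k -> T -> R) :=
  forall (J : {set 'I_k}) (B : 'I_k -> set R), (forall i, measurable (B i)) ->
    P (\bigcap_(i in [set` J]) (Y i @^-1` B i)) =
    \prod_(i in J) P (Y i @^-1` B i).

Definition iid_with_density d (T : measurableType d) (P : probability T R)
    (k : nat) (Y : 'I_k -> T -> R) (p : R -> R) :=
  [/\ forall i, measurable_fun [set: T] (Y i),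
      forall i, has_density (@lebesgue_measure R) (fun A => P (Y i @^-1` A)) p
    & mutually_independent P Y].

Definition covariance_mx d (T : measurableType d) (P : probability T R)
    (k : nat) (s : T -> 'cV[R]_k) : 'M[R]_k :=
  \matrix_(i, j) fine (covariance P (fun x => s x i 0%R) (fun x => s x j 0%R)).

End probability_notions.

Section linear_algebra.
Context {R : realType} (k : nat).

Definition spd (A : 'M[R]_k) :=
  A^T = A /\ forall v : 'cV[R]_k, v != 0 -> 0 < (v^T *m A *m v) 0 0.

(* A : B *)
Definition mxdot (A B : 'M[R]_k) : R := \sum_i \sum_j A j i * B i j.

Definition min_eigenvalue (A : 'M[R]_k) (l : R) :=
  eigenvalue A l /\ forall a, eigenvalue A a -> l <= a.

End linear_algebra.

Section calculus.
Context {R : realType}.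

Definition C2 (V : normedModType R) (f : V -> R) :=
  [/\ forall x, differentiable f x,
      forall v x, differentiable ('D_v f) x
    & forall v w, continuous ('D_w ('D_v f))].

Definition C2_compact (V : normedModType R) : set (V -> R) :=
  [set f | C2 f /\ compact (closure [set x | f x != 0])].

Definition grad k (f : 'cV[R]_k -> R) (x : 'cV[R]_k) : 'cV[R]_k :=
  \col_i 'D_(delta_mx i 0) f x.

Definition hessian k (f : 'cV[R]_k -> R) (x : 'cV[R]_k) : 'M[R]_k :=
  \matrix_(i, j) 'D_(delta_mx i 0) ('D_(delta_mx j 0) f) x.

End calculus.

Section generators.
Context {R : realType}.

(* A generator is given by its graph: [G f g] means that f is in the domain
   of G and that Gf = g in L^2(P). *)

(* The generator in L^2(P) of the diffusion whose differential expression is L: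
   the closure in L^2(P) of L acting on twice continuously differentiable,
   compactly supported functions. For a globally Lipschitz drift and a constant
   diffusion matrix these functions form a core of the generator of the
   semigroup on L^2(P). *)
Definition L2_generator d (T : measurableType d) (P : probability T R)
    (test : set (T -> R)) (L : (T -> R) -> (T -> R)) (f g : T -> R) :=
  [/\ f \in Lfun P 2%:E, g \in Lfun P 2%:E &
      exists2 phi : nat -> (T -> R), forall n, test (phi n) &
        ('N[P]_2%:E[(fun x => (phi n x - f x)%:E)] @[n --> \oo] --> 0)%E /\
        ('N[P]_2%:E[(fun x => (L (phi n) x - g x)%:E)] @[n --> \oo] --> 0)%E].

Definition poincare d (T : measurableType d) (P : probability T R)
    (G : (T -> R) -> (T -> R) -> Prop) (rho : R) :=
  forall f g, G f g -> ('V_P[f] <= (- rho^-1)%:E * 'E_P[f \* g])%E.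

Definition spectral_gap d (T : measurableType d) (P : probability T R)
    (G : (T -> R) -> (T -> R) -> Prop) (rho : R) :=
  [/\ 0 < rho, poincare P G rho & forall r, 0 < r -> poincare P G r -> r <= rho].

Definition score1 (p : R -> R) : R -> R := derive1 (fun x => ln (p x)).

Definition diff_op1 (p : R -> R) (f : R -> R) (x : R) : R :=
  derive1n 2 f x + score1 p x * derive1 f x.

Definition generator1 (P : probability (measurableTypeR R) R) (p : R -> R) :=
  L2_generator P (@C2_compact R R) (diff_op1 p).

Definition score k (p : 'cV[R]_k -> R) : 'cV[R]_k -> 'cV[R]_k :=
  grad (fun x => ln (p x)).

Definition diff_op k (p : 'cV[R]_k -> R) (Sigma Lambda : 'M[R]_k)
    (f : 'cV[R]_k -> R) (x : 'cV[R]_k) : R :=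
  let A := (mxdot Lambda Sigma)^-1 *: Lambda in
  k%:R * (mxdot A (hessian f x) + ((score p x)^T *m A *m grad f x) 0 0).

Definition generator k (P : probability 'cV[R]_k R) (p : 'cV[R]_k -> R)
    (Lambda : 'M[R]_k) :=
  L2_generator P (@C2_compact R 'cV[R]_k)
    (diff_op p (covariance_mx P (score p)) Lambda).

Definition product_density k (pi1 : R -> R) (c : 'I_k -> R) (Q : 'M[R]_k)
    (x : 'cV[R]_k) : R :=
  \prod_i (c i * pi1 (c i * (Q *m x) i 0)).

End generators.

(* Main.v *)
Require Import Defs.
From HB Require Import structures.
From mathcomp Require Import all_boot all_order all_algebra.
From mathcomp Require Import all_classical all_reals all_analysis.
From mathcomp Require Import measurable_realfun ring lra.

(* In the coordinates [y_l = c_l (Q x)_l] the density is the product of the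
   densities [pi1 y_l] and, for [Lambda = Q^T diag(D) Q], the generator is
   [\sum_l w_l G_1^(l)] with [G_1^(l)] the one-dimensional generator acting on
   [y_l] and [w_l = k D_l c_l^2 / (sigma2 \sum_m D_m c_m^2)]. By tensorization
   (Efron-Stein) its spectral gap is at least [lambda* min_l w_l], and equality
   follows by testing on functions of the single coordinate with the smallest
   weight, cut off in the other coordinates. As the [w_l] sum to a constant, the
   gap is largest when they are all equal, i.e. when [D_l] is proportional to
   [c_l^-2].

   The score has Gaussian exponential moments because it is Lipschitz:
   [pi1 (x + h) >= pi1 x * exp (h * s x - K * h^2)], and [pi1] integrates to 1;
   hence it is square integrable, and it is centered by letting [h] tend to 0. *)

Set Implicit Arguments.
Unset Strict Implicit.
Unset Printing Implicit Defensive.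

Import Order.TTheory GRing.Theory Num.Theory.
Import numFieldTopology.Exports numFieldNormedType.Exports.

Local Open Scope classical_set_scope.
Local Open Scope ring_scope.

(** * Lebesgue measure on R^k and product measures *)

(** The generators are closures from twice continuously differentiable, compactly supported
    functions, and both sides of the Poincare inequality are continuous for the graph norm; so every
    inequality is checked on such functions only. These functions and their images under the
    operators are bounded, which lets Fubini and tensorization be carried out among bounded
    measurable functions. A function of a single coordinate is not compactly supported on R^k: this
    forces the cutoffs, whose energy is of order 1/n because each derivative of [bump (t / n)] gains
    a factor 1/n and the score is integrable. The measure with density [pi] is not obtained by
    normalising [pi] but as the law of [S^-1 y], where [S = diag(c) Q] and [y] has independent
    coordinates of law [P1]; that its density is [pi] rests on the scaling of Lebesgue measure on R
    and on its invariance under [Q], derived from translation invariance alone. With equal weights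
    the gap is [lambda_star / sigma2]; for the identity the least weight sits at the smallest [c i],
    which also carries the smallest eigenvalue of Sigma. *)

Section density.
Context d (T : measurableType d) (R : realType).
Variables (mu nu : {measure set T -> \bar R}) (p : T -> R).
Hypotheses (mp : measurable_fun setT p) (p0 : forall x, 0 <= p x).
Hypothesis nup : has_density mu nu p.
Local Open Scope ereal_scope.
Import HBNNSimple.

Let nnsfun_density (h : {nnsfun T >-> R}) :
  \int[nu]_x (h x)%:E = \int[mu]_x ((h x)%:E * (p x)%:E).
Proof.
rewrite integralT_nnsfun sintegralE.
under [RHS]eq_integral => x _.
  rewrite fimfunE -fsumEFin// ge0_mule_fsuml; last first.
    by move=> r; exact: nnfun_muleindic_ge0.
  over.
rewrite ge0_integral_fsum//; last 2 first.
- move=> r; apply: emeasurable_funM; last exact/measurable_EFinP.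
  by apply/measurable_EFinP/measurable_funM.
- move=> r x _; apply: mule_ge0; last by rewrite lee_fin.
  exact: nnfun_muleindic_ge0.
apply: eq_fsbigr => r /[1!inE] -[t _ <-].
rewrite nup//; under [RHS]eq_integral => x _ do rewrite EFinM -muleA.
rewrite ge0_integralZl//; first last.
- by rewrite lee_fin.
- by move=> x _; rewrite mule_ge0 ?lee_fin.
- by apply: emeasurable_funM; exact/measurable_EFinP.
congr (_ * _); rewrite integral_mkcond; apply: eq_integral => x _.
by rewrite epatch_indic muleC.
Qed.

(** Both sides are continuous along increasing simple approximations, for which the identity is
    [has_density] on each level set. *)
Lemma ge0_integral_density (f : T -> \bar R) : measurable_fun setT f ->
  (forall x, 0 <= f x) -> \int[nu]_x f x = \int[mu]_x (f x * (p x)%:E).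
Proof.
move=> mf f0; pose h := nnsfun_approx measurableT mf.
have hf x : (h n x)%:E @[n --> \oo] --> f x by exact: cvg_nnsfun_approx.
have ndh x : {homo (fun n => (h n x)%:E) : a b / (a <= b)%N >-> a <= b}.
  by move=> a b ab; rewrite lee_fin; exact/lefP/nd_nnsfun_approx.
transitivity (limn (fun n => \int[nu]_x (h n x)%:E)).
  under eq_integral => x _ do rewrite -(cvg_lim _ (hf x))//.
  apply: monotone_convergence => // [n|n x _]; first exact/measurable_EFinP.
  by rewrite lee_fin.
under eq_fun do rewrite nnsfun_density.
rewrite -monotone_convergence//.
- apply: eq_integral => x _; apply: cvg_lim => //.
  by apply: cvgeZr.
- move=> n; apply: emeasurable_funM; exact/measurable_EFinP.
- by move=> n x _; rewrite mule_ge0 ?lee_fin.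
- by move=> x _ a b ab; rewrite lee_wpmul2r ?lee_fin ?p0//; exact/ndh.
Qed.

End density.

Section boxes.
Context {R : realType}.

Definition box k (B : 'I_k -> set R) : set 'cV[R]_k :=
  [set v | forall i, B i (v i 0)].

Lemma measurable_box k (B : 'I_k -> set R) :
  (forall i, measurable (B i)) -> measurable (box B).
Proof.
move=> mB; rewrite (_ : box B = \bigcap_i (cV_coord i @^-1` B i)).
  apply: fin_bigcap_measurable => // i _; rewrite -[X in measurable X]setTI.
  exact: measurable_cV_coord.
by apply/seteqP; split => v /= vB i; [move=> _; exact: vB|exact: (vB i I)].
Qed.

Lemma cV_cons_box k (B : 'I_k.+1 -> set R) :
  @cV_cons R k @^-1` box B = B ord0 `*` box (fun i => B (lift ord0 i)).
Proof.
apply/seteqP; split => -[x v] /=.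
  move=> vB; split => [|i] /=; first by have := vB ord0; rewrite mxE unlift_none.
  by have := vB (lift ord0 i); rewrite mxE liftK.
move=> [xB vB] i; rewrite mxE; case: unliftP => [j ->|->//]; exact: vB.
Qed.

(** Boxes are stable under intersection and generate the coordinate sigma-algebra, so they determine
    a finite measure. *)
Lemma box_probability_unique k (m1 m2 : probability 'cV[R]_k R) :
  (forall B : 'I_k -> set R, (forall i, measurable (B i)) ->
    m1 (box B) = m2 (box B)) ->
  forall A, measurable A -> m1 A = m2 A.
Proof.
move=> m12; pose G : set (set 'cV[R]_k) :=
  [set box B | B in [set B | forall i, measurable (B i)]].
apply: (measure_unique G (fun=> setT)).
- apply/seteqP; split.
  + apply: smallest_sub; first exact: smallest_sigma_algebra.
    move=> A; rewrite -bigcup_seq => -[i _ [B mB <-]] /=.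
    apply: sub_sigma_algebra.
    (* A preimage under one coordinate is the box whose other sides are the whole line. *)
    exists (fun j => if j == i then B else setT); first by move=> j /=; case: eqP.
    apply/seteqP; split => v /=; first by move=> /(_ i); rewrite eqxx.
    by move=> [_ vB] j; case: eqP => // ->.
  + apply: smallest_sub; first exact: sigma_algebra_measurable.
    by move=> _ [B mB <-]; exact: measurable_box.
- move=> _ _ [B mB <-] [C mC <-]; exists (fun i => B i `&` C i).
    by move=> i; exact: measurableI.
  apply/seteqP; split => v /=; first by move=> vBC; split => i; have [] := vBC i.
  by move=> [vB vC] i; split; [exact: vB|exact: vC].
- move=> _; exists (fun=> setT); first by [].
  by apply/seteqP; split.
- by rewrite bigcup_const//; exists 0%N.
- by move=> _ [B mB <-]; exact: m12.
- by move=> _; rewrite (le_lt_trans (probability_le1 _ _))// ltry.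
Qed.

End boxes.

Section cV_measurability.
Context {R : realType}.

Let measurable_cV_consR k : measurable_fun
  [set: (measurableTypeR R * 'cV[R]_k)%type] (@cV_cons R k).
Proof. exact: measurable_cV_cons. Qed.

Definition cV_cons_mfun k :
    {mfun (measurableTypeR R * 'cV[R]_k)%type >-> 'cV[R]_k.+1} :=
  HB.pack (@cV_cons R k) (isMeasurableFun.Build _ _ _ _ _ (@measurable_cV_consR k)).

Lemma measurable_mulmx k (A : 'M[R]_k) :
  measurable_fun setT (mulmx A : 'cV[R]_k -> 'cV[R]_k).
Proof.
apply: measurable_fun_cVP => i.
rewrite (_ : (fun v => _) = fun v => \sum_j A i j * cV_coord j v); last first.
  by apply/funext => v; rewrite mxE.
apply: measurable_sum => j; apply: measurable_funM => //.
exact: measurable_cV_coord.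
Qed.

Definition mulmx_mfun k (A : 'M[R]_k) : {mfun 'cV[R]_k >-> 'cV[R]_k} :=
  HB.pack (mulmx A : 'cV[R]_k -> 'cV[R]_k)
    (isMeasurableFun.Build _ _ _ _ _ (measurable_mulmx A)).

Lemma measurable_addcV d (T : measurableType d) k (f g : T -> 'cV[R]_k) :
  measurable_fun setT f -> measurable_fun setT g ->
  measurable_fun setT (fun x => f x + g x).
Proof.
move=> mf mg; apply: measurable_fun_cVP => i.
under eq_fun do rewrite mxE.
by apply: measurable_funD;
  apply: (measurableT_comp (measurable_cV_coord i)).
Qed.

End cV_measurability.

Section cV_prob.
Context {R : realType} (P1 : probability (measurableTypeR R) R).

(** The recursion is that of [lebesgue_cV], so that densities can be compared by induction on the
    dimension. *)
Fixpoint cV_prob (k : nat) : probability 'cV[R]_k R :=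
  match k with
  | 0 => (\d_(0 : 'cV[R]_0))
  | k'.+1 => distribution (P1 \x cV_prob k')%E (@cV_cons_mfun R k')
  end.

Local Open Scope ereal_scope.

Lemma cV_prob_box k (B : 'I_k -> set R) : (forall i, measurable (B i)) ->
  cV_prob k (box B) = \prod_i P1 (B i).
Proof.
elim: k B => [|k IH] B mB.
  rewrite big_ord0 /= diracE (_ : _ \in _ = true)//.
  by apply/mem_set; case.
rewrite big_ord_recl -IH//= /distribution /pushforward cV_cons_box.
by apply: product_measure1E; [exact: mB|apply: measurable_box => i; exact: mB].
Qed.

Lemma ge0_integral_cV_prob k (f : 'cV[R]_k.+1 -> \bar R) :
  measurable_fun setT f -> (forall x, 0 <= f x) ->
  \int[cV_prob k.+1]_v f v =
  \int[P1]_x \int[cV_prob k]_v f (cV_cons (x, v)).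
Proof.
move=> mf f0; rewrite ge0_integral_distribution// fubini_tonelli1//; last by move=> x; exact: f0.
by apply: (measurableT_comp mf); exact: measurable_cV_cons.
Qed.

End cV_prob.


Section lebesgue_cV_theory.
Context {R : realType}.
Local Notation mu := (@lebesgue_measure R).
Local Open Scope ereal_scope.

Lemma ge0_integral_lebesgue_cV k (f : 'cV[R]_k.+1 -> \bar R) :
  measurable_fun setT f -> (forall x, 0 <= f x) ->
  \int[lebesgue_cV k.+1]_v f v = \int[mu]_x \int[lebesgue_cV k]_v f (cV_cons (x, v)).
Proof.
move=> mf f0; have H := @ge0_integral_pushforward _ _ _ _ _ (@cV_cons_mfun R k)
  (measurable_funPT _) (mu \x lebesgue_cV k)%E _ f measurableT mf (fun x _ => f0 x).
rewrite preimage_setT in H.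
etransitivity; first exact: H.
rewrite fubini_tonelli1//; last by move=> x; exact: f0.
by apply: (measurableT_comp mf); exact: measurable_cV_cons.
Qed.

Lemma lebesgue_cV_box k (B : 'I_k -> set R) : (forall i, measurable (B i)) ->
  lebesgue_cV k (box B) = \prod_i mu (B i).
Proof.
elim: k B => [|k IH] B mB.
  rewrite big_ord0 /= diracE (_ : _ \in _ = true)//.
  by apply/mem_set; case.
rewrite big_ord_recl -IH//= /lebesgue_cV_step /pushforward cV_cons_box.
by apply: product_measure1E; [exact: mB|apply: measurable_box => i; exact: mB].
Qed.

Let measurable_addr (a : R) : measurable_fun setT (fun x : R => (x + a)%R).
Proof. exact: measurable_funD. Qed.

(** The image of Lebesgue measure under the translation agrees with it on half-open intervals, hence
    everywhere by uniqueness. *)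
Lemma ge0_integral_lebesgue_addr (a : R) (f : R -> \bar R) :
  measurable_fun setT f -> (forall x, 0 <= f x) ->
  \int[mu]_x f (x + a)%R = \int[mu]_x f x.
Proof.
move=> mf f0.
pose phi : measurableTypeR R -> measurableTypeR R := fun x => (x + a)%R.
have mphi : measurable_fun [set: measurableTypeR R] phi by exact: measurable_addr.
have H := @ge0_integral_pushforward _ _ _ _ _ _ mphi mu setT f measurableT mf (fun x _ => f0 x).
rewrite preimage_setT in H; rewrite -H.
apply: eq_measure_integral => A mA _; apply/esym.
pose phi_ := isMeasurableFun.Build _ _ _ _ _ mphi.
pose Phi : {mfun _ >-> _} := HB.pack phi phi_.
have := @lebesgue_measure_unique R (pushforward mu Phi); apply => //= _ [[u v]] _ <-.
rewrite /pushforward (_ : _ @^-1` _ = `](u - a)%R, (v - a)%R]%classic).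
  rewrite !lebesgue_measure_itv/= !lte_fin ltrD2r; case: ifPn => // _.
  by rewrite -!EFinB; congr _%:E; ring.
by apply/seteqP; split => x /=; rewrite /phi !in_itv/= ltrBlDr lerBrDr.
Qed.

Let measurable_mull (c : R) : measurable_fun setT (fun x : R => (c * x)%R).
Proof. exact: measurable_funM. Qed.

(** As for translations: [c] times the image measure under multiplication by [c] has the right value
    on half-open intervals. *)
Lemma ge0_integral_lebesgue_mull (c : R) (f : R -> \bar R) : (0 < c)%R ->
  measurable_fun setT f -> (forall x, 0 <= f x) ->
  \int[mu]_x f x = \int[mu]_x (f (c * x)%R * c%:E).
Proof.
move=> c0 mf f0.
pose phi : measurableTypeR R -> measurableTypeR R := fun x => (c * x)%R.
have mphi : measurable_fun [set: measurableTypeR R] phi by exact: measurable_mull.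
rewrite ge0_integralZr//; last 2 first.
  by apply: (measurableT_comp mf); exact: measurable_mull.
  by rewrite lee_fin ltW.
have H := @ge0_integral_pushforward _ _ _ _ _ _ mphi mu setT f measurableT mf (fun x _ => f0 x).
rewrite preimage_setT in H; rewrite -H muleC.
pose phi_ := isMeasurableFun.Build _ _ _ _ _ mphi.
pose Phi : {mfun _ >-> _} := HB.pack phi phi_.
have cc : (0 <= c)%R by exact: ltW.
rewrite -(ge0_integral_mscale (pushforward mu Phi) measurableT (NngNum cc))//.
apply: eq_measure_integral => A mA _.
have := @lebesgue_measure_unique R (mscale (NngNum cc) (pushforward mu Phi)).
apply => //= _ [[u v]] _ <-.
rewrite /mscale /= /pushforward (_ : _ @^-1` _ = `](c^-1 * u)%R, (c^-1 * v)%R]%classic).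
  rewrite !lebesgue_measure_itv/= !lte_fin ltr_pM2l ?invr_gt0//.
  case: ifPn; rewrite ?mule0// -!EFinM => _; congr _%:E.
  by rewrite -mulrBr mulrA divff ?mul1r// gt_eqF.
by apply/seteqP; split => x /=; rewrite /phi !in_itv/= ltr_pdivrMl// ler_pdivlMl.
Qed.

End lebesgue_cV_theory.

Section scaled_density.
Context {R : realType} (P1 : probability (measurableTypeR R) R) (p : R -> R).
Hypotheses (mp : measurable_fun setT p) (p0 : forall x, 0 <= p x).
Hypothesis P1p : has_density (@lebesgue_measure R) P1 p.
Local Notation mu := (@lebesgue_measure R).

Definition scale k (c : 'I_k -> R) (z : 'cV[R]_k) : 'cV[R]_k :=
  \col_i (c i * z i 0).

Lemma measurable_scale k (c : 'I_k -> R) : measurable_fun setT (scale c).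
Proof.
apply: measurable_fun_cVP => i; under eq_fun do rewrite mxE.
by apply: measurable_funM => //; exact: measurable_cV_coord.
Qed.

(** The density of [z] when [scale c z] has independent coordinates of density [p]. *)
Definition weight k (c : 'I_k -> R) (z : 'cV[R]_k) : R :=
  \prod_i (c i * p (c i * z i 0)).

Lemma measurable_weight k (c : 'I_k -> R) : measurable_fun setT (weight c).
Proof.
apply: measurable_prod => i _; apply: measurable_funM => //.
apply: (measurableT_comp mp); apply: measurable_funM => //.
exact: measurable_cV_coord.
Qed.

Lemma weight_ge0 k (c : 'I_k -> R) : (forall i, 0 < c i) ->
  forall z, 0 <= weight c z.
Proof.
by move=> c0 z; apply: prodr_ge0 => i _; rewrite mulr_ge0// ltW.
Qed.

Local Open Scope ereal_scope.

(** Each induction step splits off one coordinate, replaces [P1] by its density and rescales that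
    coordinate by [c ord0], which produces one factor of [weight]. *)
Lemma ge0_integral_cV_prob_density k (c : 'I_k -> R) (f : 'cV[R]_k -> \bar R) :
  (forall i, (0 < c i)%R) -> measurable_fun setT f -> (forall x, 0 <= f x) ->
  \int[cV_prob P1 k]_v f v =
  \int[lebesgue_cV k]_z (f (scale c z) * (weight c z)%:E).
Proof.
elim: k c f => [|k IH] c f c0 mf f0.
  have mw : measurable_fun setT (fun z => f (scale c z) * (weight c z)%:E).
    apply: emeasurable_funM; first exact: (measurableT_comp mf (measurable_scale c)).
    by apply/measurable_EFinP; exact: measurable_weight.
  rewrite /= !integral_dirac// !diracT !mul1e /weight big_ord0 mule1.
  by congr f; apply/colP => -[].
have mcons x : measurable_fun setT (fun v => @cV_cons R k (x, v)).
  by apply: (measurableT_comp (@measurable_cV_cons R k)); exact: measurable_pair1.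
pose c' i := c (lift ord0 i).
have c'0 i : (0 < c' i)%R by exact: c0.
rewrite ge0_integral_cV_prob//.
have -> : \int[P1]_x \int[cV_prob P1 k]_v f (cV_cons (x, v)) =
    \int[P1]_x \int[lebesgue_cV k]_z
      (f (cV_cons (x, scale c' z)) * (weight c' z)%:E).
  apply: eq_integral => x _; rewrite (IH c')//.
  by exact: (measurableT_comp mf (mcons x)).
(* Tonelli for [F] supplies the measurability in [x] of the inner integral, required both for
   passing to the density and for rescaling. *)
pose F (xz : measurableTypeR R * 'cV[R]_k) :=
  f (cV_cons (xz.1, scale c' xz.2)) * (weight c' xz.2)%:E.
have mF : measurable_fun setT F.
  apply: emeasurable_funM.
    apply: (measurableT_comp mf); apply: (measurableT_comp (@measurable_cV_cons R k)).
    apply/measurable_fun_pair; first exact: measurable_fst.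
    by apply: (measurableT_comp (measurable_scale c')); exact: measurable_snd.
  apply/measurable_EFinP/(measurableT_comp (measurable_weight c')).
  exact: measurable_snd.
have F0 xz : 0 <= F xz by rewrite mule_ge0// lee_fin weight_ge0.
have mG := @measurable_fun_fubini_tonelli_F _ _ _ _ _ (lebesgue_cV k) F mF F0.
rewrite (@ge0_integral_density _ _ _ mu P1 p)//; last first.
  by move=> x; apply: integral_ge0 => z _; exact: (F0 (x, z)).
rewrite (ge0_integral_lebesgue_mull (c0 ord0)); last 2 first.
- apply: emeasurable_funM; first exact: mG.
  exact/measurable_EFinP.
- move=> x; rewrite mule_ge0 ?lee_fin//.
  by apply: integral_ge0 => z _; exact: (F0 (x, z)).
rewrite ge0_integral_lebesgue_cV; last 2 first.
- apply: emeasurable_funM; first exact: (measurableT_comp mf (measurable_scale c)).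
  by apply/measurable_EFinP; exact: measurable_weight.
- by move=> x; rewrite mule_ge0// lee_fin weight_ge0.
apply: eq_integral => x _; rewrite -muleA -ge0_integralZr//; last 3 first.
- exact: (measurableT_comp mF (measurable_pair1 _)).
- by move=> z _; exact: (F0 (_, z)).
- by rewrite mule_ge0 ?lee_fin// ltW.
apply: eq_integral => z _; rewrite -muleA; congr (f _ * _).
  by apply/colP => i; rewrite !mxE; case: unliftP => [j ->|->] //; rewrite !mxE.
rewrite -!EFinM; congr _%:E; rewrite /weight big_ord_recl !mxE unlift_none.
rewrite mulrC [(_ * c ord0)%R]mulrC; congr (_ * _)%R.
by apply: eq_bigr => i _; rewrite !mxE liftK.
Qed.

End scaled_density.

(** * Invariance of Lebesgue measure on R^k under translations and rotations *)

Section rotation.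
Context {R : realType}.
Local Notation mu := (@lebesgue_measure R).
Local Open Scope ereal_scope.

Lemma ge0_integral_lebesgue_cV_addr k (a : 'cV[R]_k) (f : 'cV[R]_k -> \bar R) :
  measurable_fun setT f -> (forall x, 0 <= f x) ->
  \int[lebesgue_cV k]_y f (y + a)%R = \int[lebesgue_cV k]_y f y.
Proof.
elim: k a f => [|k IH] a f mf f0.
  by apply: eq_integral => v _; congr f; apply/colP => -[].
have mcons x : measurable_fun setT (fun v => @cV_cons R k (x, v)).
  by apply: (measurableT_comp (@measurable_cV_cons R k)); exact: measurable_pair1.
have mfa : measurable_fun setT (fun y : 'cV[R]_k.+1 => f (y + a)%R).
  by apply: (measurableT_comp mf); exact: measurable_addcV.
rewrite (ge0_integral_lebesgue_cV mfa); last by move=> y; exact: f0.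
rewrite (ge0_integral_lebesgue_cV mf f0).
have consD x v : (cV_cons (x, v) + a = cV_cons (x + a ord0 0, v + (cV_uncons a).2))%R.
  apply/colP => i; rewrite !mxE; case: unliftP => [j ->|->] //.
  by rewrite /= !mxE.
under eq_integral do under eq_integral do rewrite consD.
under eq_integral => x _.
  rewrite (IH _ (fun v => f (cV_cons (_, v))))//; first over.
  exact: (measurableT_comp mf (mcons _)).
rewrite (ge0_integral_lebesgue_addr _
  (f := fun x => \int[lebesgue_cV k]_v f (cV_cons (x, v))))//; last first.
  by move=> x; exact: integral_ge0.
apply: (@measurable_fun_fubini_tonelli_F _ _ _ _ _ (lebesgue_cV k)
  (f \o @cV_cons R k)); last by move=> ?; exact: f0.
by apply: (measurableT_comp mf); exact: measurable_cV_cons.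
Qed.

(** A symmetric, rotation-invariant set of positive finite measure: this is what the double integral
    below asks of its test set. *)
Definition euclid_ball k : set 'cV[R]_k := [set x | ((x^T *m x) 0 0 <= 1)%R].
Arguments euclid_ball : clear implicits.

Let sqE k (x : 'cV[R]_k) : ((x^T *m x) 0 0 = \sum_i x i 0 ^+ 2)%R.
Proof. by rewrite mxE; apply: eq_bigr => i _; rewrite mxE expr2. Qed.

Let measurable_ball k : measurable (euclid_ball k).
Proof.
rewrite (_ : euclid_ball k =
    (fun x : 'cV[R]_k => \sum_i x i 0 ^+ 2)%R @^-1` `]-oo, 1%R]).
  rewrite -[X in measurable X]setTI; apply: measurable_sum => //.
  by move=> i; apply: measurable_funX; exact: measurable_cV_coord.
by apply/seteqP; split => x; rewrite /euclid_ball /= sqE in_itv.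
Qed.

Let ball_gt0 k : 0 < lebesgue_cV k (euclid_ball k).
Proof.
(* The cube of half-side [r] lies in the ball: the squares of the coordinates sum to at most
   [k * r], as [r <= 1]. The successor covers [k = 0]. *)
pose r : R := ((k.+1%:R)^-1)%R.
have r0 : (0 < r)%R by rewrite invr_gt0.
apply: (@lt_le_trans _ _ (lebesgue_cV k (box (fun=> `[(- r)%R, r]%classic)))).
  rewrite lebesgue_cV_box// (eq_bigr (fun=> (r + r)%R%:E)); last first.
    by move=> i _; rewrite lebesgue_measure_itv/= lte_fin gtrN// -EFinB opprK.
  by rewrite prodEFin lte_fin; apply: prodr_gt0 => i _; rewrite addr_gt0.
apply: le_measure; rewrite ?inE; [exact: measurable_box|exact: measurable_ball|].
move=> x /= xr; rewrite /euclid_ball /= sqE.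
apply: (@le_trans _ _ (\sum_(i < k) r)%R).
  apply: ler_sum => i _; have := xr i; rewrite /= in_itv/= -ler_norml => xi.
  rewrite -(real_normK (num_real _)) expr2 -[leRHS]mulr1 ler_pM// (le_trans xi)//.
  by rewrite invf_le1// ler1n.
rewrite sumr_const card_ord /r -[(_ *+ k)%R]mulr_natl ler_pdivrMr// mul1r.
by rewrite ler_nat.
Qed.

Let ball_lty k : lebesgue_cV k (euclid_ball k) < +oo.
Proof.
apply: (@le_lt_trans _ _ (lebesgue_cV k (box (fun=> `[(- 1)%R, 1%R]%classic)))).
  apply: le_measure; rewrite ?inE; [exact: measurable_ball|exact: measurable_box|].
  move=> x; rewrite /euclid_ball /= sqE => x1 i /=; rewrite in_itv/= -ler_norml.
  rewrite -(@ler_pXn2r _ 2)// ?nnegrE// expr1n real_normK ?num_real//.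
  apply: le_trans x1; rewrite (bigD1 i)//= lerDl.
  by apply: sumr_ge0 => j _; exact: sqr_ge0.
rewrite lebesgue_cV_box// (eq_bigr (fun=> (1 + 1)%R%:E)); last first.
  by move=> i _; rewrite lebesgue_measure_itv/= lte_fin gtrN// -EFinB opprK.
by rewrite prodEFin ltry.
Qed.

(* Evaluate [\int\int 1_B(Qx) g(y + Qx) dy dx], B the Euclidean ball, in both
   orders: translation invariance in y on the one hand and in x on the other
   hand yield [vol(B) \int g = vol(B) \int g(Qx) dx]. *)
Lemma ge0_integral_lebesgue_cV_rotation k (Q : 'M[R]_k) (g : 'cV[R]_k -> \bar R) :
  Q^T *m Q = 1%:M -> measurable_fun setT g -> (forall x, 0 <= g x) ->
  \int[lebesgue_cV k]_x g (Q *m x) = \int[lebesgue_cV k]_x g x.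
Proof.
move=> QQ mg g0; pose L := lebesgue_cV k : {sigma_finite_measure set 'cV[R]_k -> \bar R}.
have QQ' : (Q *m Q^T = 1%:M)%R by exact: mulmx1C.
pose f x := (\1_(euclid_ball k) x)%:E : \bar R.
have mf : measurable_fun setT f.
  by apply/measurable_EFinP; apply: measurable_indic; exact: measurable_ball.
have f0 x : 0 <= f x by rewrite lee_fin.
have fQ x : f (Q *m x)%R = f x.
  rewrite /f !indicE; congr ((nat_of_bool _)%:R)%:E; apply/idP/idP; rewrite !inE /euclid_ball/=;
  by rewrite trmx_mul -mulmxA (mulmxA Q^T) QQ mul1mx.
have fN x : f (- x)%R = f x.
  rewrite /f !indicE; congr ((nat_of_bool _)%:R)%:E; apply/idP/idP; rewrite !inE /euclid_ball/=;
  by rewrite mulmxN [((- x)^T)%R]linearN mulNmx opprK.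
have LfE : \int[L]_x f x = L (euclid_ball k).
  by rewrite integral_indic ?setIT//; exact: measurable_ball.
have mQ := measurable_mulmx Q.
have mgQ : measurable_fun setT (fun x : 'cV[R]_k => g (Q *m x)%R) by exact: measurableT_comp.
pose H (z : 'cV[R]_k * 'cV[R]_k) := f z.1 * g (z.2 + Q *m z.1)%R.
have mz1 : measurable_fun setT (fun z : 'cV[R]_k * 'cV[R]_k => z.1) by exact: measurable_fst.
have mz2 : measurable_fun setT (fun z : 'cV[R]_k * 'cV[R]_k => z.2) by exact: measurable_snd.
have mH : measurable_fun setT H.
  apply: emeasurable_funM; first exact: (measurableT_comp mf mz1).
  apply: (measurableT_comp mg); apply: measurable_addcV => //.
  exact: (measurableT_comp mQ mz1).
have H0 z : 0 <= H z by rewrite mule_ge0.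
(* Translating [y] by [Q x] detaches [g] from [x]. *)
have E1 : \int[L]_x \int[L]_y H (x, y) = (\int[L]_y g y) * L (euclid_ball k).
  rewrite -LfE -ge0_integralZl//; last by exact: integral_ge0.
  apply: eq_integral => x _; rewrite /H/= ge0_integralZl//; last first.
    by apply: (measurableT_comp mg); exact: measurable_addcV.
  by rewrite (ge0_integral_lebesgue_cV_addr _ mg g0) muleC.
have E2 : \int[L]_y \int[L]_x H (x, y) =
    (\int[L]_y g (Q *m y)%R) * L (euclid_ball k).
  (* [K] is [H] after translating [x] by [Q^T y], which turns [y + Q x] into [Q x]. *)
  pose K (z : 'cV[R]_k * 'cV[R]_k) := f (z.1 - Q^T *m z.2)%R * g (Q *m z.1)%R.
  have mK : measurable_fun setT K.
    apply: emeasurable_funM; last exact: (measurableT_comp mgQ mz1).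
    apply: (measurableT_comp mf); apply: measurable_addcV => //.
    rewrite (_ : (fun x => _) = (fun x => (- Q^T) *m x.2))%R; last first.
      by apply/funext => z; rewrite mulNmx.
    exact: (measurableT_comp (measurable_mulmx _) mz2).
  have K0 z : 0 <= K z by rewrite mule_ge0.
  transitivity (\int[L]_y \int[L]_x K (x, y)).
    apply: eq_integral => y _.
    rewrite -(@ge0_integral_lebesgue_cV_addr k (Q^T *m y)%R (fun x => K (x, y)))//.
      apply: eq_integral => x _; rewrite /H /K /= addrK mulmxDr mulmxA QQ' mul1mx.
      by rewrite [(y + _)%R]addrC.
    exact: (measurableT_comp mK (measurable_pair2 _)).
  rewrite -(fubini_tonelli K)// -LfE -ge0_integralZr//; last exact: integral_ge0.
  apply: eq_integral => x _; rewrite /K/= ge0_integralZr//; last first.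
    apply: (measurableT_comp mf); apply: measurable_addcV => //.
    rewrite (_ : (fun x => _) = (fun x => (- Q^T) *m x))%R; last first.
      by apply/funext => z; rewrite mulNmx.
    exact: measurable_mulmx.
  rewrite muleC; congr (_ * _).
  (* The remaining integral is over the indicator of a ball: by [fQ] and [fN] its argument may be
     taken to be [y - Q x], and a translation removes [x]. *)
  rewrite -(ge0_integral_lebesgue_cV_addr (- (Q *m x))%R mf f0).
  apply: eq_integral => y _; rewrite -(fQ (x - _)%R) mulmxBr mulmxA QQ' mul1mx.
  by rewrite -fN opprB.
apply/esym.
have := fubini_tonelli (m1 := L) (m2 := L) H mH H0; rewrite E1 E2.
move/(congr1 (fun z => z * ((fine (L (euclid_ball k)))^-1)%:E)).
have Bfin : L (euclid_ball k) \is a fin_num.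
  by rewrite ge0_fin_numE//; exact: ball_lty.
rewrite -!muleA -{1 3}(fineK Bfin) -!EFinM divff ?mule1//.
by rewrite gt_eqF// fine_gt0// ball_gt0 ball_lty.
Qed.

End rotation.

Section product_integrals.
Local Open Scope ereal_scope.

Lemma integrable_prod d1 d2 (T1 : measurableType d1) (T2 : measurableType d2)
    (R : realType) (m1 : probability T1 R) (m2 : probability T2 R)
    (f : T1 -> R) (g : T2 -> R) :
  m1.-integrable setT (EFin \o f) -> m2.-integrable setT (EFin \o g) ->
  (m1 \x m2).-integrable setT (fun z => (f z.1 * g z.2)%:E) /\
  \int[m1 \x m2]_z (f z.1 * g z.2)%:E =
    (\int[m1]_x (f x)%:E) * (\int[m2]_y (g y)%:E).
Proof.
move=> fi gi; have [mf fy] := integrableP _ _ _ fi.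
have [mg gy] := integrableP _ _ _ gi.
have mfg : measurable_fun setT (fun z : T1 * T2 => (f z.1 * g z.2)%:E).
  apply/measurable_EFinP; apply: measurable_funM.
    by apply: (measurableT_comp (proj1 (measurable_EFinP _ _) mf)); exact: measurable_fst.
  by apply: (measurableT_comp (proj1 (measurable_EFinP _ _) mg)); exact: measurable_snd.
have fgi : (m1 \x m2).-integrable setT (fun z => (f z.1 * g z.2)%:E).
  apply/integrable12ltyP => //.
  suff -> : \int[m1]_x \int[m2]_y `|(f x * g y)%:E| =
      (\int[m1]_x `|(f x)%:E|) * (\int[m2]_y `|(g y)%:E|).
    by rewrite lte_mul_pinfty// ?ge0_fin_numE//; exact: integral_ge0.
  rewrite -ge0_integralZr//; last 2 first.
    exact: measurableT_comp.
    exact: integral_ge0.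
  apply: eq_integral => x _; rewrite -ge0_integralZl//; last exact: measurableT_comp.
  by apply: eq_integral => y _; rewrite EFinM abseM.
split => //; rewrite -integral12_prod_meas1// /fubini_F/=.
rewrite -(fineK (integrable_fin_num measurableT gi)) -integralZr//.
apply: eq_integral => x _; rewrite fineK ?integrable_fin_num// -integralZl//.
Qed.

Lemma integrable_cV_prob_prod (R : realType)
    (P1 : probability (measurableTypeR R) R) k (u : 'I_k -> R -> R) :
  (forall i, P1.-integrable setT (EFin \o u i)) ->
  (cV_prob P1 k).-integrable setT (fun y => (\prod_i u i (y i 0))%:E) /\
  \int[cV_prob P1 k]_y (\prod_i u i (y i 0))%:E =
    \prod_i \int[P1]_x (u i x)%:E.
Proof.
elim: k u => [|k IH] u ui.
  under eq_fun do rewrite big_ord0.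
  by rewrite big_ord0 integral_cst//= diracT mule1; split => //;
    exact: (finite_measure_integrable_cst \d_(0%R : 'cV[R]_0)).
have [wi wE] := IH (fun i => u (lift ord0 i)) (fun i => ui (lift ord0 i)).
have [fi fE] := integrable_prod (ui ord0) wi.
have consE : (fun y : 'cV[R]_k.+1 => (\prod_i u i (y i 0))%:E) \o @cV_cons R k =
    (fun z => (u ord0 z.1 * \prod_i u (lift ord0 i) (z.2 i 0))%:E).
  apply/funext => z /=; rewrite big_ord_recl mxE unlift_none.
  congr (_ * _)%:E; apply: eq_bigr => i _.
  by rewrite mxE liftK.
have mprod : measurable_fun setT (fun y : 'cV[R]_k.+1 => (\prod_i u i (y i 0))%:E).
  apply/measurable_EFinP; apply: measurable_prod => i _.
  apply: (@measurableT_comp _ _ _ _ _ _ (u i) _ (cV_coord i)); last exact: measurable_cV_coord.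
  by apply/measurable_EFinP; exact: measurable_int (ui i).
split.
  by apply: (integrable_pushforward (measurable_funPT (cV_cons_mfun k)) mprod) => //=;
    rewrite preimage_setT consE.
rewrite integral_distribution//=; last by rewrite consE.
rewrite big_ord_recl -wE -fE; apply: eq_integral => z _.
by rewrite -[RHS](congr1 (@^~ z) consE).
Qed.

End product_integrals.

(** * The law with density [pi] and its description by i.i.d. variables *)

Section rotated_product.
Context {R : realType} (P1 : probability (measurableTypeR R) R) (p : R -> R).
Hypotheses (mp : measurable_fun setT p) (p0 : forall x, 0 <= p x).
Hypothesis P1p : has_density (@lebesgue_measure R) P1 p.
Context (k : nat) (c : 'I_k -> R) (Q : 'M[R]_k).
Hypotheses (c0 : forall i, 0 < c i) (Qu : Q \in unitmx) (Qo : Q^T = invmx Q).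

Definition shape : 'M[R]_k := diag_mx (\row_i c i) *m Q.

Lemma shapeE (x : 'cV[R]_k) i : (shape *m x) i 0 = c i * (Q *m x) i 0.
Proof. by rewrite -mulmxA mul_diag_mx !mxE. Qed.

Lemma shape_unit : shape \in unitmx.
Proof.
rewrite unitmx_mul Qu andbT unitmxE det_diag unitfE.
by apply/prodf_neq0 => i _; rewrite mxE gt_eqF.
Qed.

(** The law of [S^-1 y], with [S] the matrix [shape] and [y] having independent coordinates of law
    [P1]; its total mass is one by construction. *)
Definition rotated_product : probability 'cV[R]_k R :=
  distribution (cV_prob P1 k) (mulmx_mfun (invmx shape)).

Local Notation Pi := rotated_product.
Local Notation pi := (product_density p c Q).

Local Open Scope ereal_scope.

(** [S = diag(c) Q] is undone in two stages: the scaling turns the product of the [P1] into the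
    density [weight c], and [Q] preserves Lebesgue measure, so that the [c i] are the only Jacobian
    factors. *)
Lemma rotated_product_density : has_density (lebesgue_cV k) Pi pi.
Proof.
move=> A mA; have Q1 : (Q^T *m Q = 1%:M)%R by rewrite Qo mulVmx.
have mS : measurable (mulmx (invmx shape) @^-1` A).
  by rewrite -[X in measurable X]setTI; exact: measurable_mulmx.
rewrite /Pi /= /distribution /pushforward/= -[X in cV_prob _ _ X]setIT -integral_indic//.
rewrite (ge0_integral_cV_prob_density mp p0 P1p c0)//; last first.
  by apply/measurable_EFinP; exact: measurable_indic.
rewrite -(ge0_integral_lebesgue_cV_rotation Q1)//=; last 2 first.
- apply: emeasurable_funM; apply/measurable_EFinP; last exact: measurable_weight.
  apply: measurableT_comp; last exact: measurable_scale.
  exact: measurable_indic.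
- by move=> x; rewrite mule_ge0// lee_fin// weight_ge0.
rewrite [RHS]integral_mkcond; apply: eq_integral => x _.
rewrite epatch_indic muleC; congr (_ * _); congr _%:E.
rewrite !indicE; congr (nat_of_bool _)%:R; apply/idP/idP; rewrite !inE /=;
  suff -> : (invmx shape *m scale c (Q *m x) = x)%R by [].
all: rewrite (_ : scale c (Q *m x) = shape *m x)%R ?mulKmx ?shape_unit//.
all: by apply/colP => i; rewrite shapeE mxE.
Qed.

Lemma rotated_product_box (B : 'I_k -> set R) : (forall i, measurable (B i)) ->
  Pi (mulmx shape @^-1` box B) = \prod_i P1 (B i).
Proof.
move=> mB; rewrite -(cV_prob_box _ mB) /Pi /= /distribution /pushforward /=.
by congr (cV_prob P1 k _); apply/seteqP; split => y /=; rewrite mulKVmx ?shape_unit.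
Qed.

(** Both sides describe the law of [S X]: boxes in these coordinates are the joint events of the
    scaled variables, and a law is determined by its values on boxes. *)
Lemma has_density_iid d (T : measurableType d) (P : probability T R)
    (X : {mfun T >-> 'cV[R]_k}) :
  has_density (lebesgue_cV k) (distribution P X) pi <->
  iid_with_density P (fun i w => c i * (Q *m X w) i 0)%R p.
Proof.
have mSX : measurable_fun setT (mulmx shape \o X).
  by apply: measurableT_comp => //; exact: measurable_mulmx.
have mY i : measurable_fun setT (fun w => c i * (Q *m X w) i 0)%R.
  under eq_fun do rewrite -shapeE.
  exact: (measurableT_comp (measurable_cV_coord i) mSX).
have XE (A : set 'cV[R]_k) : mulmx shape @^-1` (mulmx (invmx shape) @^-1` A) = A.
  by apply/seteqP; split => y /=; rewrite mulKmx ?shape_unit.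
have boxE (B : 'I_k -> set R) : X @^-1` (mulmx shape @^-1` box B) =
    \bigcap_i ((fun w => c i * (Q *m X w) i 0)%R @^-1` B i).
  apply/seteqP; split => w /=.
    by move=> wB i _ /=; rewrite -shapeE; exact: wB.
  by move=> wB i; rewrite shapeE; exact: (wB i).
split=> [XPi|[_ dY iY] A mA].
  have PB (B : 'I_k -> set R) : (forall i, measurable (B i)) ->
      P (\bigcap_i ((fun w => c i * (Q *m X w) i 0)%R @^-1` B i)) =
      \prod_i P1 (B i).
    move=> mB; rewrite -boxE -rotated_product_box//.
    have mS : measurable (mulmx shape @^-1` box B).
      by rewrite -[X in measurable X]setTI; apply: measurable_mulmx => //; exact: measurable_box.
    by rewrite rotated_product_density// -XPi.
  have P1T : P1 setT = 1 by exact: probability_setT.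
  have PJ (J : {set 'I_k}) (B : 'I_k -> set R) : (forall i, measurable (B i)) ->
      P (\bigcap_(i in [set` J]) ((fun w => c i * (Q *m X w) i 0)%R @^-1` B i)) =
      \prod_(i in J) P1 (B i).
    (* Indices outside [J] get the whole line, of mass one. *)
    move=> mB; pose B' i := if i \in J then B i else setT.
    rewrite [RHS]big_mkcond/= (eq_bigr (fun i => P1 (B' i))); last first.
      by move=> i _; rewrite /B'; case: ifP.
    rewrite -PB; last by move=> i; rewrite /B'; case: ifP.
    congr (P _); apply/seteqP; split => w /= wB i.
      by move=> _; rewrite /B' /=; case: ifPn => // iJ; exact: wB.
    by move=> iJ; have := wB i I; rewrite /B' /= iJ.
  have P1i i B : measurable B -> P ((fun w => c i * (Q *m X w) i 0)%R @^-1` B) = P1 B.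
    (* The marginals are the case of a singleton [J]. *)
    move=> mB; have := PJ [set i]%SET (fun=> B) (fun=> mB).
    rewrite big_set1 => <-; congr (P _); apply/seteqP; split => w /=.
      by move=> wB j /=; rewrite inE => /eqP ->.
    by move=> /(_ i) /=; apply; rewrite inE.
  split => //; first by move=> i B mB; rewrite P1i// P1p.
  by move=> J B mB; rewrite PJ//; apply: eq_bigr => i _; rewrite P1i.
pose Y : {mfun T >-> 'cV[R]_k} :=
  HB.pack (mulmx shape \o X) (isMeasurableFun.Build _ _ _ _ _ mSX).
have YE B : measurable B -> distribution P Y B = cV_prob P1 k B.
  apply: box_probability_unique => {}B mB; rewrite cV_prob_box//.
  rewrite [LHS](_ : _ = P (X @^-1` (mulmx shape @^-1` box B)))// boxE.
  have := iY [set: 'I_k]%SET B mB.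
  rewrite (_ : [set` [set: 'I_k]%SET] = setT); last first.
    by apply/seteqP; split => i //= _; rewrite inE.
  move=> ->; rewrite big_mkcond/=; apply: eq_bigr => i _.
  by rewrite finset.in_setT (P1p (mB i)); exact: (dY i _ (mB i)).
rewrite -rotated_product_density// /Pi /= /distribution /pushforward /=.
have mS : measurable (mulmx (invmx shape) @^-1` A).
  by rewrite -[X in measurable X]setTI; exact: measurable_mulmx.
rewrite -YE// /distribution /pushforward/=; congr (P _).
by rewrite -[LHS]/(X @^-1` A) -{1}(XE A).
Qed.

Lemma rotated_product_integral (f : 'cV[R]_k -> R) : measurable_fun setT f ->
  (cV_prob P1 k).-integrable setT (EFin \o (f \o mulmx (invmx shape))) ->
  Pi.-integrable setT (EFin \o f) /\
  \int[Pi]_x (f x)%:E = \int[cV_prob P1 k]_y (f (invmx shape *m y)%R)%:E.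
Proof.
move=> mf fi; split.
  by apply: (integrable_pushforward (measurable_funPT (mulmx_mfun (invmx shape)))) => //;
    exact/measurable_EFinP.
by rewrite integral_distribution//; exact/measurable_EFinP.
Qed.

End rotated_product.

(** * The Poincare inequality for the closure of an operator *)

Section L2.
Context d (T : measurableType d) (R : realType) (P : probability T R).
Implicit Types f g u v : T -> R.
Local Notation L2 := (Lfun P 2%:E).
Local Notation "''Ex' f" := (\int[P]_x f x) (at level 10, f at level 9).

Definition norm2 f : R := fine 'N[P]_2%:E[(EFin \o f)]%E.

Lemma Lfun2_measurable f : f \in L2 -> measurable_fun setT f.
Proof. by rewrite inE => /andP[]; rewrite inE. Qed.

Lemma norm2E f : f \in L2 -> 'N[P]_2%:E[(EFin \o f)]%E = (norm2 f)%:E.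
Proof.
move=> /[1!inE] /andP[_ /[1!inE]/= Nf]; rewrite fineK//.
by rewrite ge0_fin_numE// Lnorm_ge0.
Qed.

Lemma Lfun2_int f : f \in L2 -> P.-integrable setT (EFin \o f).
Proof.
by move=> fL; apply/Lfun1_integrable/Lfun_subset12 => //; exact: fin_num_measure.
Qed.

Lemma Lfun2M_int f g : f \in L2 -> g \in L2 ->
  P.-integrable setT (fun x => (f x * g x)%:E).
Proof. by move=> fL gL; have /Lfun1_integrable := Lfun2_mul_Lfun1 fL gL. Qed.

Lemma integrable_sqr_Lfun2 f : measurable_fun setT f ->
  P.-integrable setT (fun x => (f x ^+ 2)%:E) -> f \in L2.
Proof.
move=> mf /integrableP[_ fi]; rewrite inE; apply/andP; split; first by rewrite inE.
rewrite inE /= /finite_norm unlock /Lnorm poweR_lty//.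
apply: le_lt_trans fi; rewrite le_eqVlt; apply/orP; left; apply/eqP.
by apply: eq_integral => x _; rewrite /= powR_mulrn//= normrX.
Qed.

Lemma bounded_Lfun2 f M : measurable_fun setT f -> (forall x, `|f x| <= M) ->
  f \in L2.
Proof.
move=> mf fM; apply: integrable_sqr_Lfun2 => //.
apply: (@le_integrable _ _ _ P setT measurableT _ (cst ((M ^+ 2)%:E))).
- by apply/measurable_EFinP; exact: measurable_funX.
- move=> x _ /=; rewrite lee_fin !ger0_norm ?sqr_ge0//.
  rewrite -(real_normK (num_real (f x))) lerXn2r ?nnegrE//.
  exact: le_trans (fM x).
- exact: finite_measure_integrable_cst.
Qed.

Lemma Lfun2_cst r : cst r \in L2. Proof. exact: Lfun_cst. Qed.

Lemma Lfun2_sum I (s : seq I) (a : I -> R) (h : I -> T -> R) :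
  (forall i, h i \in L2) -> (fun x => \sum_(i <- s) a i * h i x) \in L2.
Proof.
move=> hL; elim: s => [|i s IH].
  by under eq_fun do rewrite big_nil; exact: Lfun2_cst.
under eq_fun do rewrite big_cons.
have aL : (fun x => a i * h i x) \in L2.
  by under eq_fun do rewrite mulrC; apply: (Lfun_scale (a i)); [rewrite ler1n|exact: hL].
rewrite -[X in X \in _]/((fun x => a i * h i x) \+ (fun x => \sum_(j <- s) a j * h j x)).
by rewrite rpredD ?aL ?IH ?lee1n.
Qed.

Lemma Rintegral_le_norm2 f g : f \in L2 -> g \in L2 ->
  `|'Ex (fun x => f x * g x)| <= norm2 f * norm2 g.
Proof.
move=> fL gL; have mf := Lfun2_measurable fL; have mg := Lfun2_measurable gL.
apply: (le_trans (le_normr_Rintegral measurableT (Lfun2M_int fL gL))).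
rewrite -lee_fin EFinM -!norm2E// fineK; last first.
  apply: integrable_fin_num => //.
  exact: (integrable_norm (Lfun2M_int fL gL)).
have := hoelder P mf mg (ltr0n R 2) (ltr0n R 2).
rewrite Lnorm1 => H; apply: le_trans (H _); last by rewrite [RHS]splitr !div1r.
exact: lexx.
Qed.

Lemma varianceR f : f \in L2 ->
  'V_P[f]%E = ('Ex (fun x => f x ^+ 2) - ('Ex f) ^+ 2)%:E.
Proof.
move=> fL; rewrite varianceE// EFinB unlock; congr (_ - _)%E.
  by rewrite fineK// integrable_fin_num//; exact: Lfun2_integrable_sqr.
by rewrite EFin_expe fineK// integrable_fin_num//; exact: Lfun2_int.
Qed.

Lemma expectationMR f g : f \in L2 -> g \in L2 ->
  'E_P[f \* g]%E = ('Ex (fun x => f x * g x))%:E.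
Proof.
by move=> fL gL; rewrite unlock fineK// integrable_fin_num//; exact: Lfun2M_int.
Qed.

Let norm2_cvg0 (phi : nat -> T -> R) f : (forall n, phi n \in L2) -> f \in L2 ->
  ('N[P]_2%:E[(fun x => (phi n x - f x)%:E)] @[n --> \oo] --> 0)%E ->
  norm2 (phi n \- f) @[n --> \oo] --> 0.
Proof.
move=> phiL fL /fine_cvgP[_]; apply: cvg_trans; apply: near_eq_cvg.
exact: nearW.
Qed.

(** The inner product is jointly continuous in L2: expand bilinearly around the limits and bound the
    three error terms by Cauchy-Schwarz. *)
Lemma Rintegral_cvg (phi psi : nat -> T -> R) f g :
  (forall n, phi n \in L2) -> f \in L2 -> (forall n, psi n \in L2) -> g \in L2 ->
  norm2 (phi n \- f) @[n --> \oo] --> 0 ->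
  norm2 (psi n \- g) @[n --> \oo] --> 0 ->
  'Ex (fun x => phi n x * psi n x) @[n --> \oo] --> 'Ex (fun x => f x * g x).
Proof.
move=> phiL fL psiL gL phif psig.
have dphi n : phi n \- f \in L2.
  by rewrite rpredB ?phiL ?fL ?lee1n.
have dpsi n : psi n \- g \in L2.
  by rewrite rpredB ?psiL ?gL ?lee1n.
have int2 u v : u \in L2 -> v \in L2 -> P.-integrable setT (EFin \o (fun x => u x * v x)).
  exact: Lfun2M_int.
have E n : 'Ex (fun x => phi n x * psi n x) = 'Ex (fun x => f x * g x) +
    ('Ex (fun x => (phi n \- f) x * g x) + ('Ex (fun x => f x * (psi n \- g) x) +
     'Ex (fun x => (phi n \- f) x * (psi n \- g) x))).
  have i1 := int2 _ _ fL gL; have i2 := int2 _ _ (dphi n) gL.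
  have i3 := int2 _ _ fL (dpsi n); have i4 := int2 _ _ (dphi n) (dpsi n).
  have i34 := integrableD measurableT i3 i4.
  rewrite -(RintegralD measurableT i3 i4) -(RintegralD measurableT i2 i34).
  rewrite -RintegralD//; last exact: (integrableD measurableT i2 i34).
  by apply: eq_Rintegral => x _ /=; ring.
rewrite (funext E) -[X in _ @ _ --> X]addr0; apply: cvgD; first exact: cvg_cst.
apply/norm_cvg0P.
pose B n := norm2 (phi n \- f) * norm2 g + (norm2 f * norm2 (psi n \- g) +
  norm2 (phi n \- f) * norm2 (psi n \- g)).
apply: (@squeeze_cvgr _ _ _ _ (cst 0) B).
- apply: nearW => n /=; rewrite normr_ge0/= /B.
  apply: (le_trans (ler_normD _ _)); apply: lerD; first exact: (Rintegral_le_norm2 (dphi n) gL).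
  by apply: (le_trans (ler_normD _ _)); apply: lerD;
    [exact: (Rintegral_le_norm2 fL (dpsi n))|exact: (Rintegral_le_norm2 (dphi n) (dpsi n))].
- exact: cvg_cst.
- rewrite /B (_ : 0 = 0 * norm2 g + (norm2 f * 0 + 0 * 0)); last by rewrite !(mul0r, mulr0, addr0).
  apply: cvgD; first exact: cvgMl.
  by apply: cvgD; [exact: cvgMr|exact: cvgM].
Qed.

(** Variance and energy are continuous under L2 convergence of [phi n] and [L (phi n)], so the
    inequality extends from test functions to the closure. Conversely, a test function lies in the
    domain through a constant sequence. *)
Lemma poincare_closure (test : set (T -> R)) (L : (T -> R) -> (T -> R)) (r : R) :
  (forall phi, test phi -> phi \in L2 /\ L phi \in L2) ->
  poincare P (L2_generator P test L) r <->
  forall phi, test phi -> 'Ex (fun x => phi x ^+ 2) - ('Ex phi) ^+ 2 <=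
    - r^-1 * 'Ex (fun x => phi x * L phi x).
Proof.
move=> testL; split => [H phi tphi|H f g [fL gL [phi tphi [phif psig]]]].
  have [pL LpL] := testL _ tphi.
  have := H phi (L phi); rewrite varianceR// expectationMR// -EFinM lee_fin; apply.
  split => //; exists (fun=> phi) => //.
  have N0 h : ('N[P]_2%:E[(fun x => (h x - h x)%:E)] @[n --> \oo] --> 0)%E.
    rewrite (_ : 'N[P]_2%:E[_]%E = 0%E); first exact: cvg_cst.
    by rewrite -(Lnorm0 P (p := 2%:E))//; apply: eq_Lnorm => x; rewrite subrr.
  by split; exact: N0.
rewrite varianceR// expectationMR// -EFinM lee_fin.
have pL n := (testL _ (tphi n)).1; have LpL n := (testL _ (tphi n)).2.
have c1 := norm2_cvg0 pL fL phif; have c2 := norm2_cvg0 LpL gL psig.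
(* A mean is an inner product with the constant 1, so its convergence is a case of
   [Rintegral_cvg]. *)
have cone : norm2 ((cst 1 : T -> R) \- cst 1) @[n --> \oo] --> 0.
  rewrite (_ : norm2 _ = 0); first exact: cvg_cst.
  rewrite /norm2 (_ : _ \o _ = cst 0%E) ?Lnorm0//.
  by apply/funext => x /=; rewrite subrr.
have l1 := Rintegral_cvg pL fL LpL gL c1 c2.
have l2 := Rintegral_cvg pL fL pL fL c1 c1.
have e1 h : 'Ex (fun x => h x * cst 1 x) = 'Ex h.
  by apply: eq_Rintegral => x _; rewrite /= mulr1.
have l3 : 'Ex (phi n) @[n --> \oo] --> 'Ex f.
  rewrite -(e1 f) (_ : (fun n => _) = (fun n => 'Ex (fun x => phi n x * cst 1 x))).
    exact: (Rintegral_cvg pL fL (fun=> Lfun2_cst 1) (Lfun2_cst 1) c1 cone).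
  by apply/funext => n; rewrite e1.
have -> : 'Ex (fun x => f x ^+ 2) = 'Ex (fun x => f x * f x).
  by apply: eq_Rintegral => x _; rewrite expr2.
rewrite expr2.
have lB : 'Ex (fun x => phi n x * phi n x) - 'Ex (phi n) * 'Ex (phi n)
    @[n --> \oo] --> 'Ex (fun x => f x * f x) - 'Ex f * 'Ex f.
  exact: cvgB l2 (cvgM l3 l3).
have lM : - r^-1 * 'Ex (fun x => phi n x * L (phi n) x) @[n --> \oo] -->
    - r^-1 * 'Ex (fun x => f x * g x).
  exact: cvgM (cvg_cst _) l1.
rewrite -(cvg_lim _ lB)// -(cvg_lim _ lM)//.
apply: ler_lim; [by apply/cvg_ex; eexists; exact: lB|by apply/cvg_ex; eexists; exact: lM|].
apply: nearW => n /=; have := H _ (tphi n); rewrite expr2.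
by under eq_Rintegral do rewrite expr2.
Qed.

End L2.

(** * Twice continuously differentiable functions *)

Section derivatives.
Context {R : realType}.

Section line.
Variables V W : normedModType R.

(** A directional derivative sees only the restriction to one line; this replaces the chain rule for
    affine changes of coordinates. *)
Lemma derive_line (f : W -> R) (g : V -> R) (x v : V) (y w : W) :
  (forall h : R, g (h *: v + x) = f (h *: w + y)) -> 'D_v g x = 'D_w f y.
Proof.
move=> gf; have gx : g x = f y by have := gf 0; rewrite !scale0r !add0r.
rewrite /derive; set F := fun h => _; set G := fun h => _.
by have -> : F = G by apply/funext => h; rewrite /F /G /= gf gx.
Qed.

Lemma derivable_line (f : W -> R) (g : V -> R) (x v : V) (y w : W) :
  (forall h : R, g (h *: v + x) = f (h *: w + y)) -> derivable f y w ->
  derivable g x v.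
Proof.
move=> gf; have gx : g x = f y by have := gf 0; rewrite !scale0r !add0r.
rewrite /derivable; set F := fun h => _; set G := fun h => _.
by have -> : F = G by apply/funext => h; rewrite /F /G /= gf gx.
Qed.

(** [L] is the linear part of the affine map [l]. Lines go to lines, so [derive_line] applies to
    first and second derivatives alike. *)
Lemma C2_comp_affine (f : W -> R) (l : V -> W) (L : V -> W) :
  (forall x, differentiable l x) ->
  (forall (h : R) v x, l (h *: v + x) = h *: L v + l x) ->
  C2 f -> (forall v, 'D_v (f \o l) = 'D_(L v) f \o l) /\ C2 (f \o l).
Proof.
move=> dl lL [df dDf cDDf].
have D (g : W -> R) v : 'D_v (g \o l) = 'D_(L v) g \o l.
  by apply/funext => x; apply: derive_line => h; rewrite /= lL.
split=> //; split=> [x|v x|v w].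
- exact: differentiable_comp.
- by rewrite D; exact: differentiable_comp.
- rewrite D D => x; apply: continuous_comp; last exact: cDDf.
  exact: differentiable_continuous.
Qed.

End line.

Section algebra.
Variable V : normedModType R.
Implicit Types f g : V -> R.

Lemma C2_cst (r : R) : C2 (cst r : V -> R).
Proof.
have D0 (a : R) v : 'D_v (cst a : V -> R) = cst 0.
  by apply/funext => x; exact: derive_cst.
split=> [x|v x|v w]; first exact: differentiable_cst.
  by rewrite D0; exact: differentiable_cst.
by rewrite (D0 r v) (D0 0 w); exact: cst_continuous.
Qed.

Lemma C2_deriveM f g : C2 f -> C2 g ->
  forall v, 'D_v (f \* g) = (f \* 'D_v g) \+ (g \* 'D_v f).
Proof.
move=> [df _ _] [dg _ _] v; apply/funext => x.
by rewrite deriveM//; exact: diff_derivable.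
Qed.

Lemma C2M f g : C2 f -> C2 g -> C2 (f \* g).
Proof.
move=> Cf Cg; have D := C2_deriveM Cf Cg.
have [df dDf cDDf] := Cf; have [dg dDg cDDg] := Cg.
have cf x : {for x, continuous f} by exact: differentiable_continuous.
have cg x : {for x, continuous g} by exact: differentiable_continuous.
have cDf v x : {for x, continuous ('D_v f)} by exact: differentiable_continuous.
have cDg v x : {for x, continuous ('D_v g)} by exact: differentiable_continuous.
split=> [x|v x|v w]; first exact: differentiableM.
  by rewrite (D v); apply: differentiableD; exact: differentiableM.
rewrite (D v) (_ : 'D_w _ = ((f \* 'D_w ('D_v g)) \+ ('D_v g \* 'D_w f)) \+
    ((g \* 'D_w ('D_v f)) \+ ('D_v f \* 'D_w g))).
  move=> x; apply: continuousD.
    apply: continuousD; first exact: continuousM (cf x) (cDDg v w x).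
    exact: continuousM (cDg v x) (cDf w x).
  apply: continuousD; first exact: continuousM (cg x) (cDDf v w x).
  exact: continuousM (cDf v x) (cDg w x).
apply/funext => x; rewrite deriveD//; last 2 first.
- by apply: derivableM; exact: diff_derivable.
- by apply: derivableM; exact: diff_derivable.
by congr (_ + _); rewrite deriveM//; exact: diff_derivable.
Qed.

Lemma C2_prod (I : Type) (s : seq I) (F : I -> V -> R) :
  (forall i, C2 (F i)) -> C2 (fun x => \prod_(i <- s) F i x).
Proof.
move=> CF; elim: s => [|i s IH].
  by rewrite (_ : (fun x => _) = cst 1); [exact: C2_cst|
    apply/funext => x; rewrite big_nil].
rewrite (_ : (fun x => _) = F i \* (fun x => \prod_(j <- s) F j x)).
  exact: C2M (CF i) IH.
by apply/funext => x; rewrite big_cons.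
Qed.

End algebra.

(** On R the derivative along [v] is [v] times the ordinary one, so two classical derivatives
    suffice. *)
Lemma C2_R (f f1 f2 : R -> R) : (forall x : R, is_derive x (1 : R) f (f1 x)) ->
  (forall x : R, is_derive x (1 : R) f1 (f2 x)) -> continuous f2 -> C2 f.
Proof.
move=> d1 d2 c2.
have D (g h : R -> R) : (forall x : R, is_derive x (1 : R) g (h x)) ->
    (forall x, differentiable g x) /\ forall v, 'D_v g = (fun x => v * h x).
  move=> gh; have dg x : differentiable g x.
    by apply/derivable1_diffP; have [] := gh x.
  split=> // v; apply/funext => x.
  by rewrite deriveE// deriv1E ?derive1E ?derive_val//; apply/derivable1_diffP.
have [df Df] := D _ _ d1; have [df1 Df1] := D _ _ d2.
have Dv v (g : R -> R) : (forall x, differentiable g x) ->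
    forall x, differentiable (fun x => v * g x) x.
  by move=> dg x; exact: differentiableZ.
split => // [v x|v w]; rewrite Df; first exact: Dv.
have DZ : (fun x => v * f1 x) = v *: f1 by [].
rewrite (_ : 'D_w _ = (fun x => v * (w * f2 x))).
  by move=> x; do 2 apply: cvgMr; exact: c2.
apply/funext => x; rewrite DZ deriveZ ?Df1 //; last exact: diff_derivable.
by have /funeqP/(_ x) -> := Df1 w.
Qed.

End derivatives.

(** * A compactly supported bump of class C2 *)

Section bump.
Context {R : realType}.

Definition ppow n (u : R) : R := Num.max 0 u ^+ n.

Lemma ppow_continuous n : continuous (ppow n).
Proof.
have -> : ppow n = (fun y : R => y ^+ n) \o (fun u : R => Num.max 0 u) by [].
move=> u; apply: continuous_comp; last exact: exprn_continuous.
by apply: continuous_max; [exact: cst_continuous|exact: cvg_id].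
Qed.

(** Only the point 0 is delicate; there an exponent of at least 2 makes the difference quotient tend
    to 0. *)
Lemma is_derive_ppow n (u : R) :
  is_derive u (1 : R) (ppow n.+2) (n.+2%:R * ppow n.+1 u).
Proof.
have [u0|u0|u0] := ltgtP 0 u; last rewrite -u0.
- have E : {near u, (fun y => y ^+ n.+2) =1 ppow n.+2}.
    by near=> y; rewrite /ppow max_r// ltW//; near: y; exact: lt_nbhsr.
  apply: (near_eq_is_derive E); rewrite /ppow max_r ?(ltW u0)//.
  apply: DeriveDef; first exact: exprn_derivable.
  by rewrite exp_derive /GRing.scale/= mulr1.
- have E : {near u, cst 0 =1 ppow n.+2}.
    by near=> y; rewrite /ppow max_l ?expr0n// ltW//; near: y; exact: lt_nbhsl.
  apply: (near_eq_is_derive E); rewrite /ppow max_l ?(ltW u0)// expr0n mulr0.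
  exact: is_derive_cst.
- have P0 m : ppow m.+1 0 = 0 by rewrite /ppow maxxx expr0n.
  rewrite P0 mulr0.
  have L : (fun h : R => h^-1 *: ((ppow n.+2 \o shift 0) (h *: (1 : R)) -
      ppow n.+2 0)) @ 0^' --> (0 : R).
    (* At 0 the difference quotient of [ppow n.+2] equals [ppow n.+1 h] for [h] of either sign. *)
    apply: (@cvg_trans _ (ppow n.+1 h @[h --> 0^'])).
      apply: near_eq_cvg; near=> h.
      have h0 : h != 0 by near: h; exact: nbhs_dnbhs_neq.
      rewrite /= P0 subr0 addr0 /GRing.scale/= mulr1 /ppow.
      have [hp|hn] := leP 0 h; first by rewrite [in RHS]exprS mulKf.
      by rewrite !expr0n mulr0.
    have H : ppow n.+1 h @[h --> 0^'] --> ppow n.+1 0.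
      by apply: cvg_within_filter; exact: ppow_continuous.
    by rewrite P0 in H.
  by apply: DeriveDef; [apply/cvg_ex; exists 0|exact: cvg_lim L].
Unshelve. all: by end_near. Qed.

(** The positive part of [1 - t^2], cubed: 3 is the least integer exponent for which the second
    derivative is continuous at [t = 1] and [t = -1]. *)
Definition bump (t : R) : R := ppow 3 (1 - t ^+ 2).

Lemma bump_C2 : C2 bump.
Proof.
have dsq (t : R) : is_derive t (1 : R) (fun t : R => t ^+ 2) (2 * t).
  apply: DeriveDef; first exact: exprn_derivable.
  by rewrite exp_derive /GRing.scale/= mulr1 expr1.
have du (t : R) : is_derive t (1 : R) (fun t : R => 1 - t ^+ 2) (- (2 * t)).
  have := is_deriveB (is_derive_cst (1 : R) t (1 : R)) (dsq t).
  by move=> H; apply: (is_derive_eq H); rewrite sub0r.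
have dp n (t : R) := @is_derive1_comp R (ppow n.+2) (fun t => 1 - t ^+ 2) t _ _
  (is_derive_ppow n _) (du t).
have dl (t : R) : is_derive t (1 : R) (fun t : R => - (6 * t)) (- 6).
  have := is_deriveM (is_derive_cst (- 6 : R) t (1 : R)) (is_derive_id t (1 : R)).
  rewrite (_ : cst _ * _ = (fun t => - (6 * t))) => [H|]; last first.
    by apply/funext => x /=; rewrite mulNr.
  by apply: (is_derive_eq H); rewrite /GRing.scale/= mulr1 mulr0 addr0.
apply: (@C2_R _ _ (fun t => - (6 * t) * ppow 2 (1 - t ^+ 2))
   (fun t => - 6 * ppow 2 (1 - t ^+ 2) + 24 * (t * t) * ppow 1 (1 - t ^+ 2))).
- by move=> t; apply: (is_derive_eq (dp 1%N t)); ring.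
- move=> t; apply: (is_derive_eq (is_deriveM (dl t) (dp 0%N t))).
  by rewrite /GRing.scale/=; ring.
- have cu : continuous (fun t : R => 1 - t ^+ 2).
    by move=> t; apply: differentiable_continuous; apply/derivable1_diffP; have [] := du t.
  have cp n (t : R) : {for t, continuous (fun t : R => ppow n (1 - t ^+ 2))}.
    apply: (@continuous_comp _ _ _ (fun t : R => 1 - t ^+ 2) (ppow n)); first exact: cu.
    exact: ppow_continuous.
  move=> t; apply: cvgD; apply: cvgM; try exact: cp; first exact: cvg_cst.
  apply: cvgM; first exact: cvg_cst.
  by apply: cvgM; exact: cvg_id.
Qed.

Lemma bump0 : bump 0 = 1.
Proof. by rewrite /bump /ppow expr0n subr0 max_r// expr1n. Qed.

Lemma bump_ge0 t : 0 <= bump t.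
Proof. by rewrite /bump /ppow exprn_ge0// le_max lexx. Qed.

Lemma bump_le1 t : bump t <= 1.
Proof.
rewrite /bump /ppow exprn_ile1// ?le_max ?lexx// ge_max ler01/=.
by rewrite gerBl sqr_ge0.
Qed.

Lemma bump_support t : bump t != 0 -> `|t| <= 1.
Proof.
apply: contraNT; rewrite -ltNge => t1.
rewrite /bump /ppow max_l ?expr0n// subr_le0 -(real_normK (num_real t)).
by rewrite exprn_ege1// ltW.
Qed.

End bump.

(** * Measurability and compactness in R^k *)

Section cV_topology.
Context {R : realType} (k : nat).
Local Notation V := 'cV[R]_k.

(** The sigma-algebra is generated by coordinates rather than by open sets, so measurability comes
    from a limit: [f] is evaluated after rounding each coordinate down to a multiple of [1 / n.+1].
    Each of the countably many rounded vectors is attained on a box. *)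
Lemma continuous_measurable_cV (f : V -> R) : continuous f ->
  measurable_fun [set: V] f.
Proof.
move=> cf; pose r (n : nat) (x : V) : V :=
  \col_i ((Num.floor (n.+1%:R * x i 0))%:~R / n.+1%:R).
apply: (@measurable_fun_cvg _ _ _ setT (fun n => f \o r n)) => [n _ B mB|x _].
  rewrite setTI.
  pose cell (z : 'cV[int]_k) := box (fun i =>
    [set t : R | Num.floor (n.+1%:R * t) = z i 0]).
  rewrite (_ : _ @^-1` _ = \bigcup_z (if f (map_mx (fun m => m%:~R / n.+1%:R) z) \in B
      then cell z else set0)).
    apply: countable_bigcupT_measurable => [|z]; first exact: countableP.
    case: ifP => // _; apply: measurable_box => i.
    rewrite (_ : [set _ | _] =
        `[(z i 0)%:~R / n.+1%:R, (z i 0 + 1)%:~R / n.+1%:R[%classic) //.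
    apply/seteqP; split => t /=; rewrite in_itv/= ler_pdivrMr// ltr_pdivlMr// [t * _]mulrC.
      by move=> <-; exact: floor_itv.
    exact: floor_def.
  apply/seteqP; split => x /=.
    move=> Bx; exists (\col_i Num.floor (n.+1%:R * x i 0)) => //=.
    rewrite (_ : map_mx _ _ = r n x); last by apply/colP => i; rewrite !mxE.
    by rewrite mem_set// => i /=; rewrite mxE.
  move=> [z _]; case: ifPn => // /set_mem Bz zx.
  rewrite (_ : r n x = map_mx (fun m => m%:~R / n.+1%:R) z)//.
  by apply/colP => i; rewrite !mxE (zx i).
apply: continuous_cvg; first exact: cf.
apply/cvg_ballP => e e0; near=> n.
split => // i j; rewrite mxE (ord1 j) -ball_normE /ball_/=.
have n0 : 0 < n.+1%:R :> R by [].
have /andP[fl fu] := floor_itv (n.+1%:R * x i 0).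
rewrite -(ltr_pM2l n0) -{1}(ger0_norm (ltW n0)) -normrM mulrBr.
rewrite [n.+1%:R * (_ / _)]mulrCA divff ?gt_eqF// mulr1.
apply: (@le_lt_trans _ _ 1).
  rewrite ler_norml; rewrite intrD in fu; lra.
have : n.+1%:R^-1 < e by near: n; exact: (near_infty_natSinv_lt (PosNum e0)).
by rewrite -div1r ltr_pdivrMr// mulrC.
Unshelve. all: by end_near. Qed.

(** Transported by transposition from the compactness of products of segments in row vectors. *)
Lemma cube_compact (M : R) : compact [set v : V | forall i, `|v i 0| <= M].
Proof.
pose A := [set v : 'rV[R]_k | forall i, `[- M, M]%classic (v ord0 i)].
have cA : compact A.
  by apply: (@rV_compact R k (fun=> `[- M, M]%classic)) => _; exact: segment_compact.
rewrite (_ : [set v | _] = trmx @` A); last first.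
  apply/seteqP; split => v /=.
    move=> vM; exists v^T; last by rewrite trmxK.
    by move=> i; rewrite mxE /= in_itv/= -ler_norml.
  move=> [u uM <-] i; rewrite mxE; have := uM i.
  by rewrite /= in_itv/= -ler_norml.
apply: continuous_compact cA; apply: continuous_subspaceT => u.
move=> B [P Pn PB]; exists (fun i j => P j i) => [i j|v Pv].
  by have := Pn j i; rewrite mxE.
by apply: PB => i j; rewrite mxE; exact: Pv.
Qed.

Lemma support_compact (f : V -> R) (M : R) :
  (forall x, f x != 0 -> forall i, `|x i 0| <= M) ->
  compact (closure [set x | f x != 0]).
Proof.
move=> fM; have cM := @cube_compact M.
apply: (subclosed_compact (@closed_closure _ _) cM).
rewrite closureE; apply: smallest_sub; last exact: fM.
by apply: compact_closed cM; exact: norm_hausdorff.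
Qed.

End cV_topology.

Section compact_support.
Context {R : realType}.

Lemma compactR (A : set R) (M : R) : closed A -> (forall x, A x -> `|x| <= M) ->
  compact A.
Proof.
move=> cA AM; apply: (subclosed_compact cA (segment_compact (a := - M) (b := M))).
by move=> x /AM /=; rewrite in_itv/= ler_norml.
Qed.

Variable V : normedModType R.

(** [K] is a parameter so that a function and its derivatives can share one compact set. *)
Definition supported (K : set V) (f : V -> R) := forall x, ~ K x -> f x = 0.

Lemma closure_supported (f : V -> R) : supported (closure [set x | f x != 0]) f.
Proof.
by move=> x; apply: contra_notP => /eqP fx0; apply: subset_closure.
Qed.

Lemma derive_supported (K : set V) (f : V -> R) v : closed K ->
  supported K f -> supported K ('D_v f).
Proof.
move=> cK fK x xK; rewrite (@near_eq_derive _ _ _ _ (cst 0)) ?derive_cst//.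
have oK : open (~` K) by exact: closed_openC.
by near=> y; apply: fK; near: y; exact: open_nbhs_nbhs.
Unshelve. all: by end_near. Qed.

Lemma supported_bounded (K : set V) (f : V -> R) : compact K -> continuous f ->
  supported K f -> exists M, forall x, `|f x| <= M.
Proof.
move=> cK cf fK.
have cfK : compact (f @` K).
  by apply: continuous_compact cK; exact: continuous_subspaceT.
have [M [_ HM]] := compact_bounded cfK.
exists `|M + 1| => x; have [Kx|nKx] := pselect (K x); last by rewrite fK// normr0.
apply: HM; last by exists x.
by apply: lt_le_trans (ler_norm _); rewrite ltrDl.
Qed.

End compact_support.

(** * Moments of the one-dimensional score *)

Section score_moments.
Context {R : realType} (pi1 : R -> R) (P1 : probability (measurableTypeR R) R).
Hypothesis pi1_gt0 : forall x, 0 < pi1 x.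
Hypothesis P1_pi1 : has_density (@lebesgue_measure R) P1 pi1.
Hypothesis dlog : forall x, derivable (fun y => ln (pi1 y)) x 1.
Hypothesis lips : lipschitz (score1 pi1).
Local Notation mu := (@lebesgue_measure R).
Local Notation s1 := (score1 pi1).
Local Notation l := (fun x => ln (pi1 x)).

Lemma score1_lip : exists2 K : R, 1 <= K &
  forall x y, `|s1 x - s1 y| <= K * `|x - y|.
Proof.
have [M [_ HM]] := lips; exists (Num.max 1 (M + 1)); first by rewrite le_max lexx.
move=> x y; apply: (HM _ _ (x, y)) => //=.
by rewrite lt_max ltrDl ltr01 orbT.
Qed.

Lemma score1_continuous : continuous s1.
Proof.
have [K K1 HK] := score1_lip; have K0 : 0 < K by exact: lt_le_trans K1.
move=> x; apply/cvgrPdist_lt => e e0; near=> y.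
apply: (le_lt_trans (HK _ _)); rewrite -ltr_pdivlMl//.
near: y; apply: cvgr_dist_lt; [exact: cvg_id|by rewrite mulr_gt0// invr_gt0].
Unshelve. all: by end_near. Qed.

Lemma measurable_score1 : measurable_fun setT s1.
Proof. by apply: continuous_measurable_fun; exact: score1_continuous. Qed.

Let is_derive_log (x : R) : is_derive x (1 : R) l (s1 x).
Proof. by apply: DeriveDef; [exact: dlog|rewrite /score1 derive1E]. Qed.

Let log_continuous : continuous l.
Proof.
by move=> x; apply: differentiable_continuous; apply/derivable1_diffP; exact: dlog.
Qed.

Let pi1E x : pi1 x = expR (l x).
Proof. by rewrite lnK// posrE. Qed.

Lemma pi1_continuous : continuous pi1.
Proof.
rewrite (_ : pi1 = expR \o l); last by apply/funext => x /=; rewrite -pi1E.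
move=> x.
by apply: continuous_comp; [exact: log_continuous|exact: continuous_expR].
Qed.

Lemma measurable_pi1 : measurable_fun setT pi1.
Proof. by apply: continuous_measurable_fun; exact: pi1_continuous. Qed.

Let log_MVT a b : a <= b -> exists2 c, c \in `[a, b] & l b - l a = s1 c * (b - a).
Proof.
move=> ab; apply: (@MVT_segment R l s1 a b ab) => [x _|]; first exact: is_derive_log.
exact: continuous_subspaceT.
Qed.

(** By the mean value theorem the increment of the log-density is [s1 c * h] with [c] between [x]
    and [x + h]; replacing [s1 c] by [s1 x] costs at most [K * h^2]. *)
Lemma pi1_shift_ge K : 1 <= K -> (forall x y, `|s1 x - s1 y| <= K * `|x - y|) ->
  forall x h, pi1 x * expR (h * s1 x) <= expR (K * h ^+ 2) * pi1 (x + h).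
Proof.
move=> K1 HK x h; have K0 : 0 < K by exact: lt_le_trans K1.
rewrite (pi1E x) (pi1E (x + h)) -!expRD ler_expR.
suff : h * s1 x - K * h ^+ 2 <= l (x + h) - l x by lra.
have step c : `|c - x| <= `|h| -> h * s1 x - K * h ^+ 2 <= s1 c * h.
  move=> cx; have : `|(s1 c - s1 x) * h| <= K * h ^+ 2.
    rewrite normrM -(real_normK (num_real h)) expr2 mulrA ler_wpM2r//.
    by apply: le_trans (HK _ _) _; rewrite ler_wpM2l// ltW.
  by rewrite ler_norml => /andP[+ _]; rewrite mulrBl; lra.
have [h0|h0] := leP 0 h.
  have [c] : exists2 c, c \in `[x, x + h] & l (x + h) - l x = s1 c * (x + h - x).
    by apply: log_MVT; rewrite lerDl.
  rewrite in_itv/= => /andP[c1 c2] ->; rewrite addrAC subrr add0r; apply: step.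
  by rewrite !ger0_norm ?subr_ge0//; lra.
have [c] : exists2 c, c \in `[x + h, x] & l x - l (x + h) = s1 c * (x - (x + h)).
  by apply: log_MVT; rewrite gerDl ltW.
rewrite in_itv/= => /andP[c1 c2] E.
have -> : l (x + h) - l x = s1 c * h by rewrite -opprB E; ring.
by apply: step; rewrite (ltr0_norm h0) ler_norml; lra.
Qed.

Local Open Scope ereal_scope.

Lemma expR_score1_integral K : (1 <= K)%R ->
  (forall x y, `|s1 x - s1 y| <= K * `|x - y|)%R ->
  forall h, \int[P1]_x (expR (h * s1 x))%:E <= (expR (K * h ^+ 2))%:E.
Proof.
move=> K1 HK h.
have mph : measurable_fun setT (fun x : R => pi1 (x + h)%R).
  by apply: (measurableT_comp measurable_pi1); exact: measurable_funD.
have mexp : measurable_fun setT (fun x : R => expR (h * s1 x)).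
  apply: (measurableT_comp (@measurable_expR R)).
  by apply: measurable_funM => //; exact: measurable_score1.
rewrite (@ge0_integral_density _ _ _ mu P1 pi1 measurable_pi1 (fun x => ltW (pi1_gt0 x)) P1_pi1).
- apply: (@le_trans _ _ (\int[mu]_x ((expR (K * h ^+ 2))%:E * (pi1 (x + h))%:E))).
    apply: ge0_le_integral => //.
    + by move=> x _; rewrite -EFinM lee_fin mulr_ge0// ?expR_ge0// ltW.
    + by apply: emeasurable_funM; apply/measurable_EFinP => //; exact: measurable_pi1.
    + by apply: emeasurable_funM => //; exact/measurable_EFinP.
    + by move=> x _; rewrite -!EFinM lee_fin mulrC; exact: pi1_shift_ge.
  rewrite ge0_integralZl; [|by []|exact/measurable_EFinP|
    by move=> x _; rewrite lee_fin ltW|by rewrite lee_fin expR_ge0].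
  rewrite (ge0_integral_lebesgue_addr h (f := fun x => (pi1 x)%:E)); last 2 first.
  + by apply/measurable_EFinP; exact: measurable_pi1.
  + by move=> x; rewrite lee_fin ltW.
  by rewrite -P1_pi1// probability_setT mule1.
- exact/measurable_EFinP.
- by move=> x; rewrite lee_fin expR_ge0.
Qed.

Lemma expR_score1_integrable h :
  P1.-integrable setT (fun x => (expR (h * s1 x))%:E).
Proof.
have [K K1 HK] := score1_lip; apply/integrableP; split.
  apply/measurable_EFinP; apply: (measurableT_comp (@measurable_expR R)).
  by apply: measurable_funM => //; exact: measurable_score1.
under eq_integral do rewrite abse_EFin ger0_norm ?expR_ge0//.
by apply: (le_lt_trans (expR_score1_integral K1 HK h)); rewrite ltry.
Qed.

(** The square of the score is dominated by four times the sum of its exponentials at [h = 1] and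
    [h = -1]. *)
Lemma score1_Lfun2 : s1 \in Lfun P1 2%:E.
Proof.
apply: integrable_sqr_Lfun2; first exact: measurable_score1.
have i1 := expR_score1_integrable 1; have i2 := expR_score1_integrable (- 1).
have i3 := integrableZl measurableT 4 (integrableD measurableT i1 i2).
apply: (le_integrable measurableT _ _ i3).
  by apply/measurable_EFinP; apply: measurable_funX; exact: measurable_score1.
move=> x _; rewrite -EFinD -EFinM !abse_EFin lee_fin.
rewrite !ger0_norm ?sqr_ge0 ?mulr_ge0 ?addr_ge0 ?expR_ge0//.
(* This is [t / 2 <= expR (t / 2)], squared. *)
have H (t : R) : (0 <= t)%R -> (t ^+ 2 <= 4 * expR t)%R.
  move=> t0; have -> : t = (t / 2 + t / 2)%R by lra.
  have := expR_ge1Dx (t / 2); rewrite expRD.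
  have := expR_ge0 (t / 2); nra.
have e1 := expR_ge0 (s1 x); have e2 := expR_ge0 (- s1 x).
rewrite mul1r mulN1r; have [s0|s0] := leP 0%R (s1 x).
  by have := H _ s0; lra.
have := H (- s1 x)%R; rewrite sqrrN oppr_ge0 ltW// => /(_ isT); lra.
Qed.

(** For every real [h], [1 + h * m] is at most the exponential moment, hence at most
    [expR (K * h^2)]. The deviation from 1 is linear on the left and quadratic on the right, so a
    slope [m != 0] fails at a small [h] of the sign of [m]. *)
Lemma score1_mean : (\int[P1]_x s1 x = 0)%R.
Proof.
have [K K1 HK] := score1_lip; have K0 : (0 < K)%R by exact: lt_le_trans K1.
set m : R := (\int[P1]_x s1 x)%R.
have is1 := Lfun2_int score1_Lfun2.
have i0 : P1.-integrable setT (EFin \o cst 1%R) by exact: finite_measure_integrable_cst.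
have hm h : (1 + h * m <= expR (K * h ^+ 2))%R.
  rewrite -lee_fin; apply: le_trans (expR_score1_integral K1 HK h).
  have ihs : P1.-integrable setT (EFin \o (fun x => h * s1 x)%R).
    by have := integrableZl measurableT h is1; apply: eq_integrable.
  have iD : P1.-integrable setT (fun x => (1 + h * s1 x)%:E).
    by have := integrableD measurableT i0 ihs; apply: eq_integrable.
  rewrite -(fineK (integrable_fin_num measurableT (expR_score1_integrable h))) lee_fin.
  have -> : (1 + h * m = \int[P1]_x (1 + h * s1 x))%R.
    rewrite (RintegralD measurableT i0 ihs) (RintegralZl _ measurableT is1).
    have -> : (\int[P1]_x cst 1 x = 1 :> R)%R.
      by rewrite Rintegral_cst//= (_ : P1 setT = 1%E) ?mulr1//; exact: probability_setT.
    by [].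
  apply: (le_Rintegral measurableT iD (expR_score1_integrable h)) => x _.
  exact: expR_ge1Dx.
have [//|m0] := eqVneq m 0%R.
(* With [h = e * m] this choice gives [y = K * h^2] satisfying [4 * y <= e * m^2] and [y <= 1/16].
   The moment bound then reads [1 + 4 * y <= expR y], against [expR y <= 1 + 2 * y]. *)
pose e : R := ((4 * K * (1 + m ^+ 2))^-1)%R.
have m2 : (0 < m ^+ 2)%R by rewrite exprn_even_gt0.
have D0 : (0 < 4 * K * (1 + m ^+ 2))%R by rewrite !mulr_gt0// addr_gt0.
have e0 : (0 < e)%R by rewrite invr_gt0.
have eE : (e * (4 * K * (1 + m ^+ 2)) = 1)%R by rewrite /e mulVf// gt_eqF.
have := hm (e * m)%R; set y := (K * (e * m) ^+ 2)%R.
have yE : (4 * y * (1 + m ^+ 2) = e * m ^+ 2)%R.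
  by rewrite /y -[RHS]mulr1 -[X in _ = (_ * X)%R]eE; ring.
have y0 : (0 < y)%R by rewrite mulr_gt0// exprn_even_gt0// mulf_neq0// gt_eqF.
have ye : (4 * y <= e * m ^+ 2)%R by rewrite -yE; nra.
have e4 : (e * m ^+ 2 <= 4^-1)%R.
  have K1' : (m ^+ 2 <= K * (1 + m ^+ 2))%R by nra.
  have : (4 * (e * m ^+ 2) <= e * (4 * K * (1 + m ^+ 2)))%R by nra.
  rewrite eE; lra.
have yexp := expR_ge1Dx (- y).
have ee : (expR y * expR (- y) = 1)%R by rewrite -expRD subrr expR0.
have ey := expR_gt0 y.
have y4 : (y <= 16^-1)%R by lra.
(* [expR y * (1 - y) <= 1] bounds [expR y] from above for small [y]. *)
have := ler_wpM2l (ltW ey) yexp; rewrite ee.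
move=> H1 H2; exfalso.
have : (expR y <= 1 + 2 * y)%R by nra.
nra.
Qed.

(** A vanishing score would make the density constant, and an interval of length [2 / pi1 0] would
    have mass 2. *)
Lemma score1_neq0 : exists x, s1 x != 0%R.
Proof.
apply/not_existsP => s0; have {}s0 x : s1 x = 0%R.
  by apply/eqP; apply: contrapT => /negP; exact: s0.
have pic x : pi1 x = pi1 0%R.
  rewrite (pi1E x) (pi1E 0%R); congr expR; have [x0|x0] := leP 0%R x.
    by have [c _] := log_MVT x0; rewrite s0 mul0r => /eqP; rewrite subr_eq0 => /eqP.
  by have [c _] := log_MVT (ltW x0); rewrite s0 mul0r => /eqP; rewrite subr_eq0 => /eqP.
have a0 := pi1_gt0 0%R.
have : P1 `[0%R, (2 / pi1 0)%R]%classic <= 1 by exact: probability_le1.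
rewrite P1_pi1//; under eq_integral do rewrite pic.
have b0 : (0 < 2 / pi1 0)%R by rewrite divr_gt0.
rewrite integral_cst//= lebesgue_measure_itv/= lte_fin b0 -EFinB -EFinM lee_fin.
rewrite subr0 mulrCA divff ?gt_eqF// mulr1; lra.
Qed.

(** The integrand against Lebesgue measure is continuous and positive at some point, hence at least
    half that value on a whole interval. *)
Lemma sigma2_gt0 : (0 < \int[P1]_x s1 x ^+ 2)%R.
Proof.
have [x0 sx0] := score1_neq0.
pose g x : R := (s1 x ^+ 2 * pi1 x)%R.
have gx0 : (0 < g x0)%R by rewrite mulr_gt0// exprn_even_gt0.
have b0 : (0 < g x0 / 2)%R by rewrite divr_gt0.
have cg : {for x0, continuous g}.
  apply: (@continuousM _ _ (fun x => s1 x ^+ 2)%R pi1).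
    by apply: (@continuous_comp _ _ _ s1 (fun y : R => y ^+ 2)%R);
      [exact: score1_continuous|exact: exprn_continuous].
  exact: pi1_continuous.
have : \forall x \near x0, (g x0 / 2 < g x)%R.
  apply: (cvgr_gt _ cg); rewrite ltr_pdivrMr// mulr_natr mulr2n ltrDl.
  exact: gx0.
move=> /nbhs_ballP[e /= e0 He].
pose I := `[(x0 - e / 2)%R, (x0 + e / 2)%R]%classic : set R.
have mI : measurable (I : set (measurableTypeR R)) by exact: measurable_itv.
have gI x : I x -> (g x0 / 2 <= g x)%R.
  rewrite /I /= in_itv/= => /andP[x1 x2]; apply/ltW/He.
  rewrite -ball_normE /ball_/= ltr_norml; lra.
have g_ge0 x : (0 <= g x)%R by rewrite mulr_ge0 ?sqr_ge0// ltW.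
have mg : measurable_fun setT g.
  apply: measurable_funM; last exact: measurable_pi1.
  by apply: measurable_funX; exact: measurable_score1.
rewrite -lte_fin /Rintegral fineK; last first.
  by apply: integrable_fin_num => //; exact: Lfun2_integrable_sqr score1_Lfun2.
rewrite (@ge0_integral_density _ _ _ mu P1 pi1 measurable_pi1 (fun x => ltW (pi1_gt0 x)) P1_pi1).
- apply: (@lt_le_trans _ _ (\int[mu]_(x in I) (g x0 / 2)%:E)).
    rewrite integral_cst//= lebesgue_measure_itv/= lte_fin ifT; last lra.
    rewrite -EFinB -EFinM lte_fin mulr_gt0//; lra.
  apply: (@le_trans _ _ (\int[mu]_(x in I) (g x)%:E)).
    apply: ge0_le_integral => //.
    + by move=> x _; rewrite lee_fin ltW.
    + by apply/measurable_EFinP; exact: measurable_funTS.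
  have -> : \int[mu]_x ((s1 x ^+ 2)%:E * (pi1 x)%:E) = \int[mu]_x (g x)%:E by [].
  apply: ge0_subset_integral => //; first exact/measurable_EFinP.
  by move=> x _; rewrite lee_fin.
- by apply/measurable_EFinP; apply: measurable_funX; exact: measurable_score1.
- by move=> x; rewrite lee_fin sqr_ge0.
Qed.


End score_moments.

(** * Tensorization of the variance *)

Section bounded_measurable.
Context {R : realType}.

(** A class stable under products and partial integration and integrable for every probability, so
    that Fubini needs no further integrability conditions. *)
Definition bmfun d (T : measurableType d) (f : T -> R) :=
  measurable_fun setT f /\ exists M, forall x, `|f x| <= M.

Lemma bmfun_comp d1 d2 (T1 : measurableType d1) (T2 : measurableType d2)
    (f : T2 -> R) (g : T1 -> T2) :
  bmfun f -> measurable_fun setT g -> bmfun (f \o g).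
Proof.
move=> [mf [M fM]] mg; split; first exact: measurableT_comp.
by exists M => x; exact: fM.
Qed.

Section one_space.
Context d (T : measurableType d) (P : probability T R).
Implicit Types f g : T -> R.
Local Notation "''Ex' f" := (\int[P]_x f x) (at level 10, f at level 9).

Lemma bmfun_cst r : bmfun (cst r : T -> R).
Proof. by split; [exact: measurable_cst|exists `|r|]. Qed.

Lemma bmfunD f g : bmfun f -> bmfun g -> bmfun (fun x => f x + g x).
Proof.
move=> [mf [M fM]] [mg [N gN]]; split; first exact: measurable_funD.
by exists (M + N) => x; rewrite (le_trans (ler_normD _ _))// lerD.
Qed.

Lemma bmfunM f g : bmfun f -> bmfun g -> bmfun (fun x => f x * g x).
Proof.
move=> [mf [M fM]] [mg [N gN]]; split; first exact: measurable_funM.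
by exists (M * N) => x; rewrite normrM ler_pM.
Qed.

Lemma bmfunZ r f : bmfun f -> bmfun (fun x => r * f x).
Proof. by move=> bf; apply: bmfunM => //; exact: bmfun_cst. Qed.

Lemma bmfunB f g : bmfun f -> bmfun g -> bmfun (fun x => f x - g x).
Proof.
move=> bf bg; under eq_fun do rewrite -[- g _]mulN1r.
by apply: bmfunD => //; exact: bmfunZ.
Qed.

Lemma bmfun_sqr f : bmfun f -> bmfun (fun x => f x ^+ 2).
Proof. by move=> bf; under eq_fun do rewrite expr2; exact: bmfunM. Qed.

Lemma bmfun_Lfun2 f : bmfun f -> f \in Lfun P 2%:E.
Proof. by move=> [mf [M fM]]; exact: bounded_Lfun2 fM. Qed.

Lemma bmfun_int f : bmfun f -> P.-integrable setT (EFin \o f).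
Proof. by move=> bf; apply: Lfun2_int; exact: bmfun_Lfun2. Qed.

Lemma Rintegral_cstP r : 'Ex (fun=> r) = r.
Proof.
rewrite /Rintegral integral_cst//= (_ : P setT = 1%E) ?mule1//.
exact: probability_setT.
Qed.

Lemma sqr_Rintegral_le f : bmfun f -> ('Ex f) ^+ 2 <= 'Ex (fun x => f x ^+ 2).
Proof.
move=> bf; rewrite -subr_ge0 -lee_fin -(varianceR (bmfun_Lfun2 bf)).
exact: variance_ge0.
Qed.

Lemma Rintegral_center f : bmfun f ->
  'Ex (fun x => (f x - 'Ex f) ^+ 2) = 'Ex (fun x => f x ^+ 2) - ('Ex f) ^+ 2.
Proof.
move=> bf; set c := 'Ex f.
have i1 := bmfun_int (bmfun_sqr bf).
have i2 := bmfun_int (bmfunB (bmfunZ (- 2 * c) bf) (bmfun_cst (- c ^+ 2))).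
have i3 := bmfun_int (bmfunZ (- 2 * c) bf).
have -> : 'Ex (fun x => (f x - c) ^+ 2) =
    'Ex (fun x => f x ^+ 2 + (- 2 * c * f x - (- c ^+ 2))).
  by apply: eq_Rintegral => x _; ring.
rewrite (RintegralD measurableT i1 i2).
rewrite (RintegralB measurableT i3 (bmfun_int (bmfun_cst _))).
rewrite (RintegralZl _ measurableT (bmfun_int bf)) -/c Rintegral_cstP; ring.
Qed.

End one_space.
Arguments bmfun_cst {d T} r.

Lemma Rintegral_sum d (T : measurableType d) (P : probability T R) k
    (h : 'I_k -> T -> R) : (forall i, bmfun (h i)) ->
  bmfun (fun x => \sum_i h i x) /\
  \int[P]_x (\sum_i h i x) = \sum_i \int[P]_x h i x.
Proof.
elim: k h => [|k IH] h bh.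
  under eq_fun do rewrite big_ord0.
  by rewrite big_ord0 Rintegral_cstP; split => //; exact: bmfun_cst.
have [b1 e1] := IH _ (fun i => bh (lift ord0 i)).
under eq_fun do rewrite big_ord_recl.
rewrite big_ord_recl -e1; split; first exact: bmfunD.
by rewrite RintegralD//; exact: bmfun_int.
Qed.

Section two_spaces.
Context d1 d2 (T1 : measurableType d1) (T2 : measurableType d2).
Context (m1 : probability T1 R) (m2 : probability T2 R).
Variable F : T1 * T2 -> R.
Hypothesis bF : bmfun F.

Lemma bmfun_pair1 x : bmfun (fun y => F (x, y)).
Proof. by apply: (bmfun_comp bF); exact: measurable_pair1. Qed.

Lemma bmfun_pair2 y : bmfun (fun x => F (x, y)).
Proof. by apply: (bmfun_comp bF); exact: measurable_pair2. Qed.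

Let iF : (m1 \x m2)%E.-integrable setT (EFin \o F).
Proof. exact: (bmfun_int (m1 \x m2)%E bF). Qed.

Let norm_Rintegral_le d (T : measurableType d) (m : probability T R) (f : T -> R) M :
  bmfun f -> (forall x, `|f x| <= M) -> `|\int[m]_x f x| <= M.
Proof.
move=> bf fM; apply: (le_trans (le_normr_Rintegral measurableT (bmfun_int m bf))).
rewrite -[leRHS](Rintegral_cstP m M).
have H := le_Rintegral measurableT
  (integrable_norm (bmfun_int m bf)) (bmfun_int m (bmfun_cst M)).
by apply: H => x _; exact: fM.
Qed.

Lemma bmfun_Rintegral1 : bmfun (fun x => \int[m2]_y F (x, y)).
Proof.
have [mF [M FM]] := bF; split.
  exact: (measurableT_comp (@fine_measurable R _ measurableT) (measurable_fubini_F iF)).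
exists M => x; apply: norm_Rintegral_le => [|y]; first exact: bmfun_pair1.
exact: FM.
Qed.

Lemma bmfun_Rintegral2 : bmfun (fun y => \int[m1]_x F (x, y)).
Proof.
have [mF [M FM]] := bF; split.
  exact: (measurableT_comp (@fine_measurable R _ measurableT) (measurable_fubini_G iF)).
exists M => x; apply: norm_Rintegral_le => [|y]; first exact: bmfun_pair2.
exact: FM.
Qed.

Lemma Rintegral_prod1 :
  \int[(m1 \x m2)%E]_z F z = \int[m1]_x \int[m2]_y F (x, y).
Proof.
rewrite /Rintegral -integral12_prod_meas1//; congr fine; apply: eq_integral => x _.
by rewrite fineK// integrable_fin_num//; exact: (bmfun_int m2 (bmfun_pair1 x)).
Qed.

Lemma Rintegral_prod2 :
  \int[(m1 \x m2)%E]_z F z = \int[m2]_y \int[m1]_x F (x, y).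
Proof.
rewrite /Rintegral -integral21_prod_meas1//; congr fine; apply: eq_integral => x _.
by rewrite fineK// integrable_fin_num//; exact: (bmfun_int m1 (bmfun_pair2 x)).
Qed.

End two_spaces.

(** Convexity of the variance: centre [F] in [x] for each [y], then apply Jensen's inequality to the
    square of the [y]-average. *)
Lemma variance_mean_le d1 d2 (T1 : measurableType d1) (T2 : measurableType d2)
    (m1 : probability T1 R) (m2 : probability T2 R) (F : T1 * T2 -> R) :
  bmfun F ->
  \int[m1]_x (\int[m2]_y F (x, y)) ^+ 2 - (\int[(m1 \x m2)%E]_z F z) ^+ 2 <=
  \int[m2]_y (\int[m1]_x F (x, y) ^+ 2 - (\int[m1]_x F (x, y)) ^+ 2).
Proof.
move=> bF; have ba := bmfun_Rintegral1 m1 m2 bF; have bb := bmfun_Rintegral2 m1 m2 bF.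
pose D z := F z - \int[m1]_x F (x, z.2).
have bD : bmfun D.
  by apply: bmfunB => //; exact: (bmfun_comp bb measurable_snd).
have bD2 := bmfun_sqr bD.
rewrite (Rintegral_prod1 m1 m2 bF) -(Rintegral_center m1 ba).
rewrite -(Rintegral_prod1 m1 m2 bF) (Rintegral_prod2 m1 m2 bF).
apply: (@le_trans _ _ (\int[m1]_x \int[m2]_y D (x, y) ^+ 2)).
  apply: le_Rintegral => //.
  - by apply: bmfun_int; apply: bmfun_sqr; apply: bmfunB => //; exact: bmfun_cst.
  - by apply: bmfun_int; exact: (bmfun_Rintegral1 m1 m2 bD2).
  move=> x _; apply: le_trans (sqr_Rintegral_le m2 (bmfun_pair1 bD x)).
  rewrite /D /= RintegralB//; first exact: (bmfun_int m2 (bmfun_pair1 bF x)).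
  exact: (bmfun_int m2 bb).
rewrite -(Rintegral_prod1 m1 m2 bD2) (Rintegral_prod2 m1 m2 bD2).
rewrite le_eqVlt; apply/orP; left; apply/eqP; apply: eq_Rintegral => y _.
by rewrite -(Rintegral_center m1 (bmfun_pair2 bF y)).
Qed.

End bounded_measurable.

Section tensorization.
Context {R : realType} (P1 : probability (measurableTypeR R) R).

Definition setc k (y : 'cV[R]_k) (i : 'I_k) (t : R) : 'cV[R]_k :=
  \col_j (if j == i then t else y j 0).

Lemma Rintegral_cV_prob k (f : 'cV[R]_k.+1 -> R) : bmfun f ->
  \int[cV_prob P1 k.+1]_y f y =
  \int[(P1 \x cV_prob P1 k)%E]_z f (cV_cons z).
Proof.
move=> bf; rewrite /Rintegral; congr fine.
rewrite integral_distribution//; first by apply/measurable_EFinP; case: bf.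
apply: bmfun_int; apply: (bmfun_comp bf).
exact: measurable_funPT (cV_cons_mfun k).
Qed.

(* Efron-Stein, combined with an upper bound [h i] for the [i]-th partial
   variance which need only hold on average along the [i]-th coordinate. *)
Lemma variance_tensorization k (f : 'cV[R]_k -> R) (h : 'I_k -> 'cV[R]_k -> R) :
  bmfun f -> (forall i, bmfun (h i)) ->
  (forall i y, \int[P1]_t f (setc y i t) ^+ 2 - (\int[P1]_t f (setc y i t)) ^+ 2 <=
    \int[P1]_t h i (setc y i t)) ->
  \int[cV_prob P1 k]_y f y ^+ 2 - (\int[cV_prob P1 k]_y f y) ^+ 2 <=
    \sum_i \int[cV_prob P1 k]_y h i y.
Proof.
elim: k f h => [|k IH] f h bf bh fh.
  rewrite big_ord0 (_ : (fun y => f y ^+ 2) = fun=> f 0 ^+ 2); last first.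
    by apply/funext => y; congr (f _ ^+ 2); apply/colP => -[].
  rewrite (_ : (fun y => f y) = fun=> f 0); last first.
    by apply/funext => y; congr f; apply/colP => -[].
  by rewrite !Rintegral_cstP subrr.
have mc := measurable_funPT (@cV_cons_mfun R k).
have bfc : bmfun (fun z : measurableTypeR R * 'cV[R]_k => f (cV_cons z)).
  exact: (bmfun_comp bf mc).
have bfc2 := bmfun_sqr bfc.
have bhc i : bmfun (fun z : measurableTypeR R * 'cV[R]_k => h i (cV_cons z)).
  exact: (bmfun_comp (bh i) mc).
rewrite !Rintegral_cV_prob//; last exact: bmfun_sqr.
(* [B] splits the variance into that of the mean over the tail, handled by [variance_mean_le], and
   the average of the variance in the tail, handled by the induction hypothesis. *)
set B := \int[P1]_x (\int[cV_prob P1 k]_v f (cV_cons (x, v))) ^+ 2.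
rewrite (_ : forall a c, a - c = (B - c) + (a - B)); last by move=> a c; ring.
rewrite big_ord_recl; apply: lerD.
  apply: (le_trans (variance_mean_le P1 (cV_prob P1 k) bfc)).
  rewrite (Rintegral_cV_prob (bh ord0)) (Rintegral_prod2 _ _ (bhc ord0)).
  apply: le_Rintegral => //.
  - apply: bmfun_int; apply: bmfunB; first exact: (bmfun_Rintegral2 P1 (cV_prob P1 k) bfc2).
    exact: (bmfun_sqr (bmfun_Rintegral2 P1 (cV_prob P1 k) bfc)).
  - by apply: bmfun_int; exact: (bmfun_Rintegral2 P1 (cV_prob P1 k) (bhc ord0)).
  (* The entry 0 is a placeholder, overwritten by [setc]. *)
  move=> v _; have := fh ord0 (cV_cons (0, v)).
  have -> : setc (cV_cons (0, v)) ord0 = fun t => cV_cons (t, v).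
    apply/funext => t; apply/colP => j; rewrite !mxE.
    case: unliftP => [i ->|->]; last by rewrite eqxx.
    by rewrite eq_sym (negbTE (neq_lift _ _)).
  exact.
have bf1 := bmfun_Rintegral1 P1 (cV_prob P1 k) bfc.
rewrite (Rintegral_prod1 _ _ bfc2) /B -RintegralB//; last 2 first.
- exact: (bmfun_int P1 (bmfun_Rintegral1 P1 (cV_prob P1 k) bfc2)).
- exact: (bmfun_int P1 (bmfun_sqr bf1)).
under [leRHS]eq_bigr => i _ do rewrite (Rintegral_cV_prob (bh _)) (Rintegral_prod1 _ _ (bhc _)).
have bhi i := bmfun_Rintegral1 P1 (cV_prob P1 k) (bhc (lift ord0 i)).
have [bs <-] := Rintegral_sum P1 bhi.
apply: le_Rintegral => //.
- apply: bmfun_int; apply: bmfunB; last exact: (bmfun_sqr bf1).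
  exact: (bmfun_Rintegral1 P1 (cV_prob P1 k) bfc2).
- exact: bmfun_int.
move=> x _; apply: (IH _ (fun i v => h (lift ord0 i) (cV_cons (x, v)))).
- exact: bmfun_pair1 bfc x.
- by move=> i; exact: bmfun_pair1 (bhc (lift ord0 i)) x.
move=> i v; have := fh (lift ord0 i) (cV_cons (x, v)).
have -> : setc (cV_cons (x, v)) (lift ord0 i) = fun t => cV_cons (x, setc v i t).
  apply/funext => t; apply/colP => j; rewrite !mxE; case: unliftP => [j' ->|->].
    by rewrite (inj_eq (@lift_inj _ ord0)) mxE.
  by rewrite (negbTE (neq_lift _ _)).
exact.
Qed.

End tensorization.

(** * The rotated product density and its generators *)

Section directional.
Context {R : realType} (k : nat).
Local Notation V := 'cV[R]_k.

Lemma cV_sum_delta (v : V) : v = \sum_i v i 0 *: delta_mx i 0.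
Proof.
rewrite [LHS]matrix_sum_delta; apply: eq_bigr => i _.
by rewrite big_ord1.
Qed.

Lemma derive_grad (f : V -> R) (x v : V) : differentiable f x ->
  'D_v f x = \sum_i v i 0 * grad f x i 0.
Proof.
move=> df; rewrite deriveE// {1}(cV_sum_delta v) linear_sum.
by apply: eq_bigr => i _; rewrite linearZ/= -deriveE// mxE.
Qed.

Lemma derive_hessian (f : V -> R) (x v : V) : C2 f ->
  'D_v ('D_v f) x = \sum_i \sum_j v i 0 * v j 0 * hessian f x i j.
Proof.
move=> [df dDf _].
have E : 'D_v f = \sum_j v j 0 *: 'D_(delta_mx j 0) f.
  apply/funext => y; rewrite derive_grad// fct_sumE; apply: eq_bigr => j _.
  by rewrite mxE.
rewrite derive_grad//; apply: eq_bigr => i _.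
rewrite mxE {1}E derive_sum; last first.
  by move=> j; apply: derivableZ; apply: diff_derivable; exact: dDf.
rewrite mulr_sumr; apply: eq_bigr => j _.
rewrite deriveZ; last by apply: diff_derivable; exact: dDf.
by rewrite mxE /GRing.scale/= mulrA.
Qed.

Definition lform (S : 'M[R]_k) i (x : V) : R := (S *m x) i 0.

Lemma lformP (S : 'M[R]_k) i (h : R) v x :
  lform S i (h *: v + x) = h *: lform S i v + lform S i x.
Proof. by rewrite /lform mulmxDr -scalemxAr !mxE. Qed.

Lemma differentiable_lform (S : 'M[R]_k) i x : differentiable (lform S i) x.
Proof.
rewrite (_ : lform S i = \sum_j (fun x : V => S i j *: x j 0)).
  by apply: differentiable_sum => j; apply: differentiableZ; exact: differentiable_coord.
by apply/funext => y; rewrite fct_sumE /lform mxE.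
Qed.

Lemma continuous_lform (S : 'M[R]_k) i : continuous (lform S i).
Proof. by move=> x; apply: differentiable_continuous; exact: differentiable_lform. Qed.

End directional.

Section shaped_operator.
Context {R : realType} (pi1 : R -> R) (k : nat) (c : 'I_k -> R) (Q : 'M[R]_k).
Hypothesis pi1_gt0 : forall x, 0 < pi1 x.
Hypothesis dlog : forall x, derivable (fun y => ln (pi1 y)) x 1.
Hypotheses (c0 : forall i, 0 < c i) (Qu : Q \in unitmx) (Qo : Q^T = invmx Q).
Local Notation V := 'cV[R]_k.
Local Notation s1 := (score1 pi1).
Local Notation S := (shape c Q).
Local Notation pi := (product_density pi1 c Q).

Let Q1 : Q *m Q^T = 1%:M. Proof. by rewrite Qo mulmxV. Qed.

(** The [l]-th column of [S^-1]: differentiating along it is differentiating in [y_l], where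
    [y = S x]. *)
Definition axis (l : 'I_k) : V := (c l)^-1 *: (row l Q)^T.

Lemma axisE l i : axis l i 0 = (c l)^-1 * Q l i.
Proof. by rewrite !mxE. Qed.

Lemma shape_axis l : S *m axis l = delta_mx l 0.
Proof.
apply/colP => j; rewrite shapeE /axis -scalemxAr mxE.
have -> : (Q *m (row l Q)^T) j 0 = (Q *m Q^T) j l.
  by rewrite !mxE; apply: eq_bigr => i _; rewrite !mxE.
rewrite Q1 !mxE andbT; case: eqVneq => [->|]; last by rewrite !mulr0.
by rewrite mulr1 divff// gt_eqF.
Qed.

Lemma lform_axis l m : lform S m (axis l) = (m == l)%:R.
Proof. by rewrite /lform shape_axis mxE andbT. Qed.

Lemma derive_log_coord j (x v : V) :
  derivable (fun x => ln (pi1 (lform S j x))) x v /\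
  'D_v (fun x => ln (pi1 (lform S j x))) x = lform S j v * s1 (lform S j x).
Proof.
have H (h : R) : ln (pi1 (lform S j (h *: v + x))) =
    ln (pi1 (h *: lform S j v + lform S j x)) by rewrite lformP.
have dl : differentiable (fun y => ln (pi1 y)) (lform S j x).
  by apply/derivable1_diffP; exact: dlog.
pose g (x : V) := ln (pi1 (lform S j x)).
split.
  apply: (@derivable_line _ _ _ (fun y : R => ln (pi1 y)) g x v _ _ H).
  exact: diff_derivable.
rewrite (@derive_line _ _ _ (fun y : R => ln (pi1 y)) g x v _ _ H).
by rewrite deriveE// deriv1E//; exact: dlog.
Qed.

Lemma log_product_density (x : V) :
  ln (pi x) = \sum_j (ln (c j) + ln (pi1 (lform S j x))).
Proof.
rewrite /product_density.
under eq_bigr do rewrite -shapeE -/(lform S _ x).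
have : forall (s : seq 'I_k), ln (\prod_(j <- s) (c j * pi1 (lform S j x))) =
    \sum_(j <- s) (ln (c j) + ln (pi1 (lform S j x))).
  elim=> [|j s IH]; first by rewrite !big_nil ln1.
  rewrite !big_cons lnM ?posrE ?mulr_gt0//; last first.
    by apply: prodr_gt0 => i _; rewrite mulr_gt0.
  by rewrite IH lnM ?posrE.
exact.
Qed.

Lemma scoreE (x : V) a : score pi x a 0 = \sum_j S j a * s1 (lform S j x).
Proof.
rewrite mxE (_ : (fun x => ln (pi x)) =
    \sum_j (cst (ln (c j)) + (fun x => ln (pi1 (lform S j x)))) :> (V -> R)); last first.
  by apply/funext => y; rewrite fct_sumE log_product_density.
have d j (v : V) := derive_log_coord j x v.
rewrite derive_sum; last first.
  by move=> j; apply: derivableD; [exact: derivable_cst|exact: (d j _).1].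
apply: eq_bigr => j _; rewrite deriveD; [|exact: derivable_cst|exact: (d j _).1].
rewrite derive_cst add0r (d j _).2; congr (_ * _).
rewrite /lform -colE mxE.
by [].
Qed.

Definition axis_op (l : 'I_k) (f : V -> R) (x : V) : R :=
  'D_(axis l) ('D_(axis l) f) x + s1 (lform S l x) * 'D_(axis l) f x.

(** [Q^T diag(D) Q] is the sum over [l] of [D_l] times the outer product of the [l]-th row of [Q]
    with itself, and that row is [c_l] times [axis l]: this is the source of the weight
    [D_l c_l^2]. *)
Lemma diff_opE (Sigma : 'M[R]_k) (D : 'rV[R]_k) (f : V -> R) (x : V) : C2 f ->
  let L := Q^T *m diag_mx D *m Q in
  diff_op pi Sigma L f x =
  \sum_l k%:R * D 0 l * c l ^+ 2 / mxdot L Sigma * axis_op l f x.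
Proof.
move=> Cf L; rewrite /diff_op; set M := mxdot L Sigma.
have LE i j : L i j = \sum_l D 0 l * (Q l i * Q l j).
  rewrite /L mxE; apply: eq_bigr => l _; rewrite mul_mx_diag !mxE; ring.
have QE l i : Q l i = c l * axis l i 0.
  by rewrite axisE mulrA divff ?mul1r// gt_eqF.
have h : mxdot (M^-1 *: L) (hessian f x) =
    \sum_l D 0 l * c l ^+ 2 / M * 'D_(axis l) ('D_(axis l) f) x.
  under [RHS]eq_bigr do rewrite derive_hessian// mulr_sumr.
  rewrite exchange_big; apply: eq_bigr => i _.
  under [RHS]eq_bigr do rewrite mulr_sumr.
  rewrite exchange_big; apply: eq_bigr => j _.
  rewrite mxE LE mulr_sumr mulr_suml; apply: eq_bigr => l _.
  rewrite !QE; ring.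
have g : ((score pi x)^T *m (M^-1 *: L) *m grad f x) 0 0 =
    \sum_l D 0 l * c l ^+ 2 / M * (s1 (lform S l x) * 'D_(axis l) f x).
  have [df _ _] := Cf.
  (* The score is [S^T] applied to the vector of the [s1 y_j]; pairing it with a row of [Q] leaves a
     single term by orthonormality, so the drift does not mix coordinates. *)
  have sc l : \sum_i score pi x i 0 * Q l i = c l * s1 (lform S l x).
    under eq_bigr do rewrite scoreE mulr_suml.
    rewrite exchange_big/= (bigD1 l)//= [X in _ + X]big1 ?addr0.
      rewrite (eq_bigr (fun i => c l * s1 (lform S l x) * (Q l i * Q l i))); last first.
        by move=> i _; rewrite /S mul_diag_mx !mxE; ring.
      rewrite -mulr_sumr (_ : \sum_i _ = (Q *m Q^T) l l); last first.
        by rewrite mxE; apply: eq_bigr => i _; rewrite mxE.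
      by rewrite Q1 mxE eqxx mulr1.
    move=> j jl.
    rewrite (eq_bigr (fun i => c j * s1 (lform S j x) * (Q j i * Q l i))); last first.
      by move=> i _; rewrite /S mul_diag_mx !mxE; ring.
    rewrite -mulr_sumr (_ : \sum_i _ = (Q *m Q^T) j l); last first.
      by rewrite mxE; apply: eq_bigr => i _; rewrite mxE.
    by rewrite Q1 mxE (negbTE jl) mulr0.
  rewrite mxE; under eq_bigr do rewrite mxE mulr_suml.
  transitivity (\sum_l \sum_j \sum_i
      score pi x i 0 * Q l i * (M^-1 * D 0 l * Q l j) * grad f x j 0).
    rewrite [RHS]exchange_big; apply: eq_bigr => j _.
    rewrite [RHS]exchange_big; apply: eq_bigr => i _.
    rewrite [(_ *: L) i j]mxE [(_^T) 0 i]mxE LE mulr_sumr mulr_sumr mulr_suml.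
    by apply: eq_bigr => l _; ring.
  apply: eq_bigr => l _; rewrite derive_grad// !mulr_sumr; apply: eq_bigr => j _.
  rewrite -mulr_suml -mulr_suml sc QE; ring.
rewrite h g -big_split mulr_sumr; apply: eq_bigr => l _.
by rewrite /axis_op/=; ring.
Qed.

End shaped_operator.

(** * Moments under the rotated product and the covariance of the score *)

Section rotated_product_moments.
Context {R : realType} (P1 : probability (measurableTypeR R) R).
Context (k : nat) (c : 'I_k -> R) (Q : 'M[R]_k).
Hypotheses (c0 : forall i, 0 < c i) (Qu : Q \in unitmx).
Local Notation S := (shape c Q).
Local Notation Pi := (rotated_product P1 c Q).
Local Notation "''E1' f" := (\int[P1]_x f x) (at level 10, f at level 9).
Local Notation "''Ek' f" := (\int[Pi]_x f x) (at level 10, f at level 9).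

Lemma rotated_product_prod (u : 'I_k -> R -> R) :
  (forall m, P1.-integrable setT (EFin \o u m)) ->
  Pi.-integrable setT (EFin \o (fun x => \prod_m u m (lform S m x))) /\
  'Ek (fun x => \prod_m u m (lform S m x)) = \prod_m 'E1 (u m).
Proof.
move=> ui; have [pi pE] := integrable_cV_prob_prod ui.
have Sy y m : lform S m (invmx S *m y) = y m 0.
  by rewrite /lform mulKVmx//; exact: shape_unit.
have mu m : measurable_fun setT (u m).
  by apply/measurable_EFinP; exact: measurable_int (ui m).
have ml m : measurable_fun setT (lform S m).
  exact: (measurableT_comp (measurable_cV_coord m) (measurable_mulmx S)).
have mF : measurable_fun setT (fun x => \prod_m u m (lform S m x)).
  by apply: measurable_prod => m _; exact: (measurableT_comp (mu m) (ml m)).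
have E : (fun x => \prod_m u m (lform S m x)) \o mulmx (invmx S) =
    (fun y : 'cV[R]_k => \prod_m u m (y m 0)).
  by apply/funext => y; apply: eq_bigr => m _; rewrite Sy.
have iE : (cV_prob P1 k).-integrable setT
    (EFin \o ((fun x => \prod_m u m (lform S m x)) \o mulmx (invmx S))).
  by rewrite E.
have [Fi FE] := rotated_product_integral mF iE.
split=> //; rewrite /Rintegral FE.
have -> : (\int[cV_prob P1 k]_y (\prod_m u m (lform S m (invmx S *m y)))%:E =
    \int[cV_prob P1 k]_y (\prod_m u m (y m 0))%:E)%E.
  by apply: eq_integral => y _; rewrite -(congr1 (@^~ y) E).
rewrite pE (eq_bigr (fun m => ('E1 (u m))%:E)) ?prodEFin//.
move=> m _; rewrite /Rintegral fineK//.
by apply: integrable_fin_num => //; exact: ui.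
Qed.

Let int1 : P1.-integrable setT (EFin \o (fun=> 1 : R)).
Proof. exact: finite_measure_integrable_cst. Qed.

Lemma rotated_product_coord (u : R -> R) l : P1.-integrable setT (EFin \o u) ->
  Pi.-integrable setT (EFin \o (fun x => u (lform S l x))) /\
  'Ek (fun x => u (lform S l x)) = 'E1 u.
Proof.
move=> iu; pose w m : R -> R := if m == l then u else fun=> 1.
have [|wi wE] := @rotated_product_prod w.
  by move=> m; rewrite /w; case: eqP.
have W x : \prod_m w m (lform S m x) = u (lform S l x).
  rewrite (bigD1 l)//= /w eqxx big1 ?mulr1// => m ml.
  by rewrite (negbTE ml).
have F : (fun x => \prod_m w m (lform S m x)) = (fun x => u (lform S l x)).
  by apply/funext => x; rewrite W.
rewrite F in wi wE; split=> //; rewrite wE (bigD1 l)//= /w eqxx big1 ?mulr1// => m ml.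
by rewrite (negbTE ml) Rintegral_cstP.
Qed.

Lemma rotated_product_coord2 (u v : R -> R) l m : l != m ->
  P1.-integrable setT (EFin \o u) -> P1.-integrable setT (EFin \o v) ->
  'Ek (fun x => u (lform S l x) * v (lform S m x)) = 'E1 u * 'E1 v.
Proof.
move=> lm iu iv.
pose w n : R -> R := if n == l then u else if n == m then v else fun=> 1.
have [|wi wE] := @rotated_product_prod w.
  by move=> n; rewrite /w; case: eqP => // _; case: eqP.
have W x : \prod_n w n (lform S n x) = u (lform S l x) * v (lform S m x).
  rewrite (bigD1 l)//= (bigD1 m)/= 1?eq_sym// /w !eqxx eq_sym (negbTE lm).
  by rewrite big1 ?mulr1// => n /andP[/negbTE -> /negbTE ->].
under eq_Rintegral do rewrite -W.
rewrite wE (bigD1 l)//= (bigD1 m)/= 1?eq_sym// /w !eqxx eq_sym (negbTE lm).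
rewrite big1 ?mulr1// => n /andP[/negbTE -> /negbTE ->].
by rewrite Rintegral_cstP.
Qed.

End rotated_product_moments.

Section score_covariance.
Context {R : realType} (pi1 : R -> R) (P1 : probability (measurableTypeR R) R).
Hypothesis pi1_gt0 : forall x, 0 < pi1 x.
Hypothesis P1_pi1 : has_density (@lebesgue_measure R) P1 pi1.
Hypothesis dlog : forall x, derivable (fun y => ln (pi1 y)) x 1.
Hypothesis lips : lipschitz (score1 pi1).
Context (k : nat) (c : 'I_k -> R) (Q : 'M[R]_k).
Hypotheses (c0 : forall i, 0 < c i) (Qu : Q \in unitmx) (Qo : Q^T = invmx Q).
Local Notation s1 := (score1 pi1).
Local Notation S := (shape c Q).
Local Notation Pi := (rotated_product P1 c Q).
Local Notation pi := (product_density pi1 c Q).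
Local Notation "''E1' f" := (\int[P1]_x f x) (at level 10, f at level 9).
Local Notation "''Ek' f" := (\int[Pi]_x f x) (at level 10, f at level 9).

Let s1L := score1_Lfun2 pi1_gt0 P1_pi1 dlog lips.
Let s1i := Lfun2_int s1L.
Let s1i2 := Lfun2_integrable_sqr s1L.

Definition score_variance : R := 'E1 (fun x => s1 x ^+ 2).

Lemma score_coord_Lfun2 l : (fun x => s1 (lform S l x)) \in Lfun Pi 2%:E.
Proof.
apply: integrable_sqr_Lfun2.
  apply: (measurableT_comp (measurable_score1 lips)).
  exact: (measurableT_comp (measurable_cV_coord l) (measurable_mulmx S)).
exact: (rotated_product_coord c0 Qu l s1i2).1.
Qed.

Lemma score_Lfun2 a : (fun x => score pi x a 0) \in Lfun Pi 2%:E.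
Proof.
under eq_fun do rewrite (scoreE Q pi1_gt0 dlog c0).
apply: Lfun2_sum => j; exact: score_coord_Lfun2.
Qed.

(** The variables [s1 y_j] are centered, uncorrelated and of common variance, so the covariance of
    [S^T] applied to them is that variance times [S^T S]. *)
Lemma score_covariance :
  covariance_mx Pi (score pi) =
  score_variance *: (Q^T *m diag_mx (\row_i c i ^+ 2) *m Q).
Proof.
have sm j : 'Ek (fun x => s1 (lform S j x)) = 0.
  by rewrite (rotated_product_coord c0 Qu j s1i).2 (score1_mean pi1_gt0 P1_pi1 dlog lips).
have iL j := Lfun2_int (score_coord_Lfun2 j).
have iLL j l := Lfun2M_int (score_coord_Lfun2 j) (score_coord_Lfun2 l).
have isum (I : Type) (s : seq I) (f : I -> 'cV[R]_k -> R) :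
    (forall i, Pi.-integrable setT (EFin \o f i)) ->
    Pi.-integrable setT (EFin \o (fun x => \sum_(i <- s) f i x)) /\
    'Ek (fun x => \sum_(i <- s) f i x) = \sum_(i <- s) 'Ek (f i).
  move=> fi; elim: s => [|i s [IH1 IH2]].
    under eq_fun do rewrite big_nil.
    by rewrite big_nil Rintegral_cstP; split => //; exact: finite_measure_integrable_cst.
  under eq_fun do rewrite big_cons.
  rewrite big_cons -IH2 (RintegralD measurableT (fi i) IH1); split => //.
  exact: (integrableD measurableT (fi i) IH1).
have iZ r (f : 'cV[R]_k -> R) : Pi.-integrable setT (EFin \o f) ->
    Pi.-integrable setT (EFin \o (fun x => r * f x)).
  by move=> fi; have := integrableZl measurableT r fi; apply: eq_integrable.
have mean0 a : 'Ek (fun x => score pi x a 0) = 0.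
  under eq_Rintegral do rewrite (scoreE Q pi1_gt0 dlog c0).
  rewrite (isum _ _ _ (fun j => iZ (S j a) _ (iL j))).2 big1// => j _.
  by rewrite (RintegralZl _ measurableT (iL j)) sm mulr0.
have scov j l : 'Ek (fun x => s1 (lform S j x) * s1 (lform S l x)) =
    (j == l)%:R * score_variance.
  case: eqVneq => [->|jl]; last first.
    rewrite (rotated_product_coord2 c0 Qu jl s1i s1i).
    by rewrite (score1_mean pi1_gt0 P1_pi1 dlog lips) !mul0r.
  have H := (rotated_product_coord c0 Qu l s1i2).2.
  by rewrite mul1r /score_variance -[RHS]H; apply: eq_Rintegral => x _; rewrite expr2.
apply/matrixP => a b; rewrite mxE.
have -> : covariance Pi (fun x => score pi x a 0) (fun x => score pi x b 0) =
    'E_Pi[(fun x => score pi x a 0%R) \* (fun x => score pi x b 0%R)]%E.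
  rewrite unlock; congr expectation; apply/funext => x /=.
  have E0 d : fine 'E_Pi[fun x => score pi x d 0%R]%E = 0 by rewrite unlock; exact: mean0.
  by rewrite !E0 -[LHS]/((score pi x a 0 - 0) * (score pi x b 0 - 0)) !subr0.
rewrite (expectationMR (score_Lfun2 a) (score_Lfun2 b))/=.
have XY x : score pi x a 0 * score pi x b 0 =
    \sum_j \sum_l S j a * S l b * (s1 (lform S j x) * s1 (lform S l x)).
  rewrite !(scoreE Q pi1_gt0 dlog c0) mulr_suml; apply: eq_bigr => j _.
  by rewrite mulr_sumr; apply: eq_bigr => l _; ring.
under eq_Rintegral do rewrite XY.
have iS j := isum _ (index_enum 'I_k) _ (fun l => iZ (S j a * S l b) _ (iLL j l)).
rewrite (isum _ _ _ (fun j => (iS j).1)).2.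
transitivity (\sum_j S j a * S j b * score_variance).
  apply: eq_bigr => j _; rewrite (iS j).2 (bigD1 j)//= [X in _ + X]big1 ?addr0.
    by rewrite (RintegralZl _ measurableT (iLL j j)) scov eqxx mul1r.
  move=> l lj; rewrite (RintegralZl _ measurableT (iLL j l)) scov eq_sym.
  by rewrite (negbTE lj) mul0r mulr0.
rewrite !mxE mulr_sumr; apply: eq_bigr => j _.
by rewrite mul_mx_diag /S mul_diag_mx !mxE; ring.
Qed.

End score_covariance.

(** * Test functions and their one-dimensional slices *)

Section test_functions.
Context {R : realType} (pi1 : R -> R) (k : nat) (c : 'I_k -> R) (Q : 'M[R]_k).
Hypothesis lips : lipschitz (score1 pi1).
Hypotheses (c0 : forall i, 0 < c i) (Qu : Q \in unitmx) (Qo : Q^T = invmx Q).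
Local Notation V := 'cV[R]_k.
Local Notation s1 := (score1 pi1).
Local Notation S := (shape c Q).

Lemma C2_continuous (U : normedModType R) (f : U -> R) : C2 f -> continuous f.
Proof. by move=> [df _ _] x; exact: differentiable_continuous. Qed.

Lemma C2_derive_continuous (U : normedModType R) (f : U -> R) v :
  C2 f -> continuous ('D_v f).
Proof. by move=> [_ df _] x; exact: differentiable_continuous. Qed.

Lemma diff_op1E (f : R -> R) :
  diff_op1 pi1 f = (fun x => 'D_1 ('D_1 f) x + s1 x * 'D_1 f x).
Proof.
have E (g : R -> R) : derive1 g = 'D_1 g by apply/funext => x; rewrite derive1E.
by apply/funext => x; rewrite /diff_op1 /derive1n /= !E.
Qed.

(** Stated for a general normed space so as to serve both [diff_op1] on R and [axis_op] on R^k. *)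
Let supported_op (U : normedModType R) (f : U -> R) (s : U -> R) (v : U) :
  C2_compact f -> continuous s ->
  exists M, forall x, `|'D_v ('D_v f) x + s x * 'D_v f x| <= M.
Proof.
move=> [Cf cK] cs; have [_ _ cDD] := Cf.
have cl : closed (closure [set x | f x != 0]) by exact: closed_closure.
have f0 := @closure_supported _ _ f.
have d0 := derive_supported v cl f0; have dd0 := derive_supported v cl d0.
apply: (supported_bounded cK) => [x|x nK]; last by rewrite d0// dd0// mulr0 addr0.
apply: cvgD; first exact: cDD.
by apply: cvgM; [exact: cs|exact: C2_derive_continuous].
Qed.

Lemma test1_bmfun (f : R -> R) : C2_compact f ->
  bmfun (f : measurableTypeR R -> R) /\
  bmfun (diff_op1 pi1 f : measurableTypeR R -> R).
Proof.
move=> Cf; have [C2f cK] := Cf; have [_ _ cDD] := C2f.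
split; split.
- by apply: continuous_measurable_fun; exact: C2_continuous.
- exact: (supported_bounded cK (C2_continuous C2f) (@closure_supported _ _ f)).
- rewrite diff_op1E; apply: continuous_measurable_fun => x; apply: cvgD; first exact: cDD.
  by apply: cvgM; [exact: (score1_continuous lips)|exact: C2_derive_continuous].
- have [M HM] := supported_op (1 : R) Cf (score1_continuous lips).
  by rewrite diff_op1E; exists M => x; exact: HM.
Qed.

Let score_lform_continuous l : continuous (fun x : V => s1 (lform S l x)).
Proof.
move=> x; apply: (@continuous_comp _ _ _ (lform S l) s1); first exact: continuous_lform.
exact: (score1_continuous lips).
Qed.

Lemma testk_bmfun (f : V -> R) : C2_compact f ->
  bmfun f /\ forall l, bmfun (axis_op pi1 c Q l f).
Proof.
move=> Cf; have [C2f cK] := Cf; have [_ _ cDD] := C2f.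
split=> [|l]; split.
- by apply: continuous_measurable_cV; exact: C2_continuous.
- exact: (supported_bounded cK (C2_continuous C2f) (@closure_supported _ _ f)).
- apply: continuous_measurable_cV.
  have -> : axis_op pi1 c Q l f = 'D_(axis c Q l) ('D_(axis c Q l) f) \+
      ((fun x => s1 (lform S l x)) \* 'D_(axis c Q l) f) by [].
  move=> x; apply: continuousD; first exact: (cDD (axis c Q l) (axis c Q l) x).
  apply: continuousM; first exact: score_lform_continuous.
  exact: C2_derive_continuous.
- have [M HM] := supported_op (axis c Q l) Cf (@score_lform_continuous l).
  by exists M => x; exact: HM.
Qed.

Lemma slice_test (f : V -> R) (a b : V) : b != 0 -> C2_compact f ->
  C2_compact (fun t : R => f (t *: b + a)) /\
  forall t, 'D_1 (fun t : R => f (t *: b + a)) t = 'D_b f (t *: b + a) /\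
    'D_1 ('D_1 (fun t : R => f (t *: b + a))) t = 'D_b ('D_b f) (t *: b + a).
Proof.
move=> b0 [Cf cK]; pose g (t : R) : V := t *: b + a.
have dg t : differentiable g t.
  by apply: differentiableD; [exact: differentiableZl|exact: differentiable_cst].
have gL (h : R) (v x : R) : g (h *: v + x) = h *: (v *: b) + g x.
  by rewrite /g scalerDl scalerA addrA.
have [D1 C1] := C2_comp_affine dg gL Cf.
have D1E : 'D_1 (f \o g) = 'D_b f \o g by rewrite D1 scale1r.
split; last first.
  move=> t; split; first exact: (congr1 (@^~ t) D1E).
  rewrite -[LHS]/('D_1 ('D_1 (f \o g)) t) D1E.
  by apply: derive_line => h; rewrite /= gL scale1r.
split => //.
have [M [_ HM]] := compact_bounded cK.
have cg : continuous g by move=> t; exact: differentiable_continuous.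
have cpre : closed (g @^-1` closure [set x | f x != 0]).
  by apply: closed_comp => [t _|]; [exact: cg|exact: closed_closure].
apply: (@compactR _ _ ((`|M + 1| + `|a|) / `|b|)); first exact: closed_closure.
move=> t Ht; have {}Ht : closure [set x | f x != 0] (g t).
  suff : closure [set x | f (g x) != 0] `<=` g @^-1` closure [set x | f x != 0].
    by move/(_ t); exact.
  rewrite [X in X `<=` _]closureE; apply: smallest_sub => // x fx.
  exact: subset_closure.
rewrite ler_pdivlMr ?normr_gt0// -normrZ.
have -> : t *: b = g t - a by rewrite /g addrK.
rewrite (le_trans (ler_normB _ _))// lerD2r; apply: HM => //.
by apply: lt_le_trans (ler_norm _); rewrite ltrDl.
Qed.

(** Varying [y_l] alone moves [x] along [axis l]; this makes the one-dimensional Poincare inequality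
    applicable on every slice. *)
Lemma axis_slice (f : V -> R) (y : V) l : C2_compact f ->
  C2_compact (fun t => f (invmx S *m setc y l t)) /\
  forall t, axis_op pi1 c Q l f (invmx S *m setc y l t) =
    diff_op1 pi1 (fun t => f (invmx S *m setc y l t)) t.
Proof.
move=> Cf; have Su := shape_unit c0 Qu; pose a := invmx S *m setc y l 0.
have E t : invmx S *m setc y l t = t *: axis c Q l + a.
  rewrite -[t *: _](mulKmx Su) -mulmxDr -scalemxAr (shape_axis c0 Qu Qo).
  congr (_ *m _); apply/colP => j; rewrite !mxE andbT.
  by case: eqP => _; rewrite ?mulr1 ?mulr0 ?addr0 ?add0r.
have b0 : axis c Q l != 0.
  apply/eqP => ax0; have := shape_axis c0 Qu Qo l; rewrite ax0 mulmx0.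
  move=> /colP/(_ l); rewrite !mxE eqxx/= => /eqP; rewrite eq_sym.
  by rewrite oner_eq0.
rewrite (_ : (fun t => f (invmx S *m setc y l t)) =
    (fun t => f (t *: axis c Q l + a))); last by apply/funext => t; rewrite E.
have [C1 D1] := slice_test a b0 Cf; split => // t.
rewrite diff_op1E (D1 t).1 (D1 t).2 /axis_op -E; congr (_ + s1 _ * _).
by rewrite /lform mulKVmx// mxE eqxx.
Qed.

End test_functions.

(** * Lower bound for the gap by tensorization *)

Section spectral_gap_lower_bound.
Context {R : realType} (pi1 : R -> R) (P1 : probability (measurableTypeR R) R).
Hypothesis lips : lipschitz (score1 pi1).
Context (k : nat) (c : 'I_k -> R) (Q : 'M[R]_k).
Hypotheses (c0 : forall i, 0 < c i) (Qu : Q \in unitmx) (Qo : Q^T = invmx Q).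
Local Notation s1 := (score1 pi1).
Local Notation S := (shape c Q).
Local Notation Pi := (rotated_product P1 c Q).
Local Notation "''E1' f" := (\int[P1]_x f x) (at level 10, f at level 9).
Local Notation "''Ek' f" := (\int[Pi]_x f x) (at level 10, f at level 9).

Definition weighted_op (w : 'I_k -> R) (f : 'cV[R]_k -> R) (x : 'cV[R]_k) : R :=
  \sum_l w l * axis_op pi1 c Q l f x.

Lemma weighted_op_bmfun w f : C2_compact f -> bmfun (weighted_op w f).
Proof.
move=> /(testk_bmfun c Q lips)[_ bl].
exact: (Rintegral_sum Pi (fun l => bmfunZ (w l) (bl l))).1.
Qed.

Lemma Rintegral_rotated (f : 'cV[R]_k -> R) : bmfun f ->
  bmfun (fun y => f (invmx S *m y)) /\
  'Ek f = \int[cV_prob P1 k]_y f (invmx S *m y).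
Proof.
move=> bf; have bfS : bmfun (fun y => f (invmx S *m y)).
  exact: (bmfun_comp bf (measurable_mulmx (invmx S))).
split=> //; rewrite /Rintegral.
by rewrite (rotated_product_integral bf.1 (bmfun_int (cV_prob P1 k) bfS)).2.
Qed.

Lemma poincare1_test lambda : 0 < lambda ->
  poincare P1 (generator1 P1 pi1) lambda <->
  forall f : R -> R, C2_compact f -> 'E1 (fun x => f x ^+ 2) - ('E1 f) ^+ 2 <=
    - lambda^-1 * 'E1 (fun x => f x * diff_op1 pi1 f x).
Proof.
move=> l0; apply: poincare_closure => f Cf.
have [bf bLf] := test1_bmfun lips Cf.
by split; exact: bmfun_Lfun2.
Qed.

(** On each slice the partial variance is at most [lambda^-1] times the energy, hence at most
    [w l / rho] times it; summed over [l] these bounds form the weighted energy. *)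
Lemma weighted_poincare lambda (w : 'I_k -> R) rho :
  0 < lambda -> poincare P1 (generator1 P1 pi1) lambda ->
  0 < rho -> (forall l, rho <= lambda * w l) ->
  forall f, C2_compact f -> 'Ek (fun x => f x ^+ 2) - ('Ek f) ^+ 2 <=
    - rho^-1 * 'Ek (fun x => f x * weighted_op w f x).
Proof.
move=> l0 /(poincare1_test l0) H1 r0 rw f Cf.
have [bf bl] := testk_bmfun c Q lips Cf.
(* It bounds the partial variance only after integration over [y_l], which is all that
   [variance_tensorization] asks for. *)
pose h l x := - rho^-1 * (w l * (f x * axis_op pi1 c Q l f x)).
have bh l : bmfun (h l) by do 2 apply: bmfunZ; apply: bmfunM; [exact: bf|exact: bl].
have [bfS EfS] := Rintegral_rotated bf.
have [_ EfS2] := Rintegral_rotated (bmfun_sqr bf).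
pose hS l y := h l (invmx S *m y).
have bhS l : bmfun (hS l) := (Rintegral_rotated (bh l)).1.
rewrite EfS EfS2.
have VT := variance_tensorization (P1 := P1) bfS bhS.
apply: (le_trans (VT _)).
  move=> l y; have [Cs sE] := axis_slice pi1 c0 Qu Qo y l Cf.
  have := H1 _ Cs; set v := (X in X <= _); set q := (X in _ <= _ * X) => vq.
  have v0 : 0 <= v.
    by rewrite subr_ge0; apply: sqr_Rintegral_le; exact: (test1_bmfun lips Cs).1.
  have -> : 'E1 (fun t => hS l (setc y l t)) = - rho^-1 * (w l * q).
    have bq := bmfunM (test1_bmfun lips Cs).1 (test1_bmfun lips Cs).2.
    rewrite /hS /h -(RintegralZl _ measurableT (bmfun_int P1 bq)).
    rewrite -(RintegralZl _ measurableT (bmfun_int P1 (bmfunZ (w l) bq))).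
    by apply: eq_Rintegral => t _; rewrite sE.
  apply: (le_trans vq); rewrite !mulNr lerN2 mulrA -subr_ge0 -mulrBl.
  (* The sign, read off from the one-dimensional inequality and the nonnegative variance, is what
     allows [lambda^-1] to be replaced by the larger [w l / rho]. *)
  have q0 : q <= 0.
    have := le_trans v0 vq; rewrite mulNr oppr_ge0 pmulr_rle0// invr_gt0//.
  rewrite mulr_le0// subr_le0 -(ler_pM2l r0) mulrA divff ?gt_eqF// mul1r.
  by rewrite mulrC ler_pdivrMl.
rewrite le_eqVlt; apply/orP; left; apply/eqP.
under eq_bigr => l _ do rewrite /hS -(Rintegral_rotated (bh l)).2.
have bfl l := bmfunM bf (bl l).
have [_ E] := Rintegral_sum Pi (fun l => bmfunZ (w l) (bfl l)).
have -> : 'Ek (fun x => f x * weighted_op w f x) =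
    'Ek (fun x => \sum_l w l * (f x * axis_op pi1 c Q l f x)).
  apply: eq_Rintegral => x _; rewrite /weighted_op mulr_sumr.
  by apply: eq_bigr => l _; ring.
rewrite E mulr_sumr; apply: eq_bigr => l _.
by rewrite /h (RintegralZl _ measurableT (bmfun_int Pi (bmfunZ (w l) (bfl l)))).
Qed.

End spectral_gap_lower_bound.

(** * Upper bound for the gap: products of a function with cutoffs *)

Section product_functions.
Context {R : realType} (pi1 : R -> R) (k : nat) (c : 'I_k -> R) (Q : 'M[R]_k).
Hypotheses (c0 : forall i, 0 < c i) (Qu : Q \in unitmx) (Qo : Q^T = invmx Q).
Local Notation V := 'cV[R]_k.
Local Notation s1 := (score1 pi1).
Local Notation S := (shape c Q).

Definition tensor (u : 'I_k -> R -> R) (x : V) : R := \prod_m u m (lform S m x).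

Definition upd (u : 'I_k -> R -> R) l (v : R -> R) m : R -> R :=
  if m == l then v else u m.

Lemma tensor_upd u l v x :
  tensor (upd u l v) x = \prod_(m | m != l) u m (lform S m x) * v (lform S l x).
Proof.
rewrite /tensor (bigD1 l)//= /upd eqxx mulrC; congr (_ * _).
by apply: eq_bigr => m /negbTE ->.
Qed.

Lemma tensorE u l x :
  tensor u x = \prod_(m | m != l) u m (lform S m x) * u l (lform S l x).
Proof. by rewrite /tensor (bigD1 l)//= mulrC. Qed.

(** Along [axis l] only the [l]-th coordinate of [S x] moves, at unit speed, so the other factors
    are constants. *)
Lemma derive_tensor u l : (forall x, differentiable (u l) x) ->
  'D_(axis c Q l) (tensor u) = tensor (upd u l ('D_1 (u l))).
Proof.
move=> du; apply/funext => x; rewrite tensor_upd.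
set r := \prod_(m | _) _.
transitivity ('D_1 (r *: u l) (lform S l x)).
  apply: derive_line => h; rewrite (tensorE u l) lformP.
  rewrite (lform_axis c0 Qu Qo) eqxx; congr (_ * _).
  apply: eq_bigr => m ml; rewrite lformP (lform_axis c0 Qu Qo) (negbTE ml).
  by rewrite scaler0 add0r.
by rewrite deriveZ//; exact: diff_derivable.
Qed.

Lemma axis_op_tensor u l x : C2 (u l) ->
  axis_op pi1 c Q l (tensor u) x = tensor (upd u l (diff_op1 pi1 (u l))) x.
Proof.
move=> [du dDu _]; rewrite /axis_op {1}(derive_tensor du).
have dD1 y : differentiable (upd u l ('D_1 (u l)) l) y by rewrite /upd eqxx; exact: dDu.
rewrite (congr1 (@^~ x) (derive_tensor dD1)) (congr1 (@^~ x) (derive_tensor du))/=.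
rewrite !tensor_upd /upd eqxx diff_op1E.
rewrite (eq_bigr (fun m => u m (lform S m x))); last by move=> m /negbTE ->.
ring.
Qed.

Lemma tensor_C2_compact u : (forall m, C2_compact (u m)) -> C2_compact (tensor u).
Proof.
move=> Cu; split.
  apply: C2_prod => m; have [Cum _] := Cu m.
  exact: (C2_comp_affine (@differentiable_lform _ _ S m) (lformP S m) Cum).2.
have HM m : exists M, forall t, u m t != 0 -> `|t| <= M.
  have [_ /compact_bounded[M [_ HM]]] := Cu m.
  exists `|M + 1| => t ut; apply: HM; last exact: subset_closure.
  by apply: lt_le_trans (ler_norm _); rewrite ltrDl.
have [M {}HM] := choice HM.
have M0 (x : V) : tensor u x != 0 -> forall m, `|lform S m x| <= M m.
  move=> ux m; apply: HM; apply: contraNneq ux => u0.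
  by rewrite /tensor (bigD1 m)//= u0 mul0r.
(* The coordinates of [S x] are bounded by the supports of the factors, and [S^-1] carries the
   bounds back to [x]; summing over all rows makes the bound uniform in [i]. *)
apply: (@support_compact _ _ _ (\sum_i \sum_j `|invmx S i j| * `|M j|)) => x ux i.
have -> : x i 0 = \sum_j invmx S i j * lform S j x.
  by rewrite -{1}(mulKmx (shape_unit c0 Qu) x) mxE.
apply: (le_trans (ler_norm_sum _ _ _)).
rewrite [leRHS](bigD1 i)//= -[leLHS]addr0; apply: lerD.
  apply: ler_sum => j _; rewrite normrM ler_wpM2l// (le_trans (M0 x ux j))//.
  exact: ler_norm.
by apply: sumr_ge0 => j _; apply: sumr_ge0 => l _; rewrite mulr_ge0.
Qed.

End product_functions.

Section cutoff.
Context {R : realType} (pi1 : R -> R) (P1 : probability (measurableTypeR R) R).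
Hypothesis lips : lipschitz (score1 pi1).
Hypothesis s1L : score1 pi1 \in Lfun P1 2%:E.
Local Notation s1 := (score1 pi1).
Local Notation "''E1' f" := (\int[P1]_x f x) (at level 10, f at level 9).

Definition cutoff n (t : R) : R := bump (n.+1%:R^-1 * t).

Let dscale n (t : R) : differentiable (fun t : R => n.+1%:R^-1 * t) t.
Proof. exact: differentiableZ. Qed.

Let scaleL n (h v x : R) :
  n.+1%:R^-1 * (h *: v + x) = h *: (n.+1%:R^-1 * v) + n.+1%:R^-1 * x.
Proof. by rewrite /GRing.scale/=; ring. Qed.

Lemma derive_cutoff n v : 'D_v (cutoff n) = 'D_(n.+1%:R^-1 * v) bump \o (fun t => n.+1%:R^-1 * t).
Proof. exact: (C2_comp_affine (@dscale n) (@scaleL n) bump_C2).1. Qed.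

Lemma cutoff_test n : C2_compact (cutoff n).
Proof.
split; first exact: (C2_comp_affine (@dscale n) (@scaleL n) bump_C2).2.
apply: (@compactR _ _ n.+1%:R); first exact: closed_closure.
suff : closure [set x | cutoff n x != 0] `<=` [set t | `|t| <= n.+1%:R] by [].
have -> : [set t : R | `|t| <= n.+1%:R] = `[- n.+1%:R, n.+1%:R]%classic.
  by apply/seteqP; split => t /=; rewrite in_itv/= ler_norml.
rewrite closureE; apply: smallest_sub; first exact: itv_closed.
move=> t /= /bump_support; rewrite in_itv/= -ler_norml normrM ger0_norm//.
by rewrite ler_pdivrMl// mulr1.
Qed.

Lemma cutoff_norm_le1 n t : `|cutoff n t| <= 1.
Proof. by rewrite ger0_norm ?bump_le1// bump_ge0. Qed.

Lemma cutoff_cvg t : cutoff n t @[n --> \oo] --> (1 : R).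
Proof.
have H : n.+1%:R^-1 * t @[n --> \oo] --> (0 * t : R).
  by apply: cvgMl; exact: cvg_harmonic.
rewrite mul0r in H.
have cb : {for (0 : R), continuous (bump : R -> R)} by exact: (C2_continuous bump_C2).
by rewrite -bump0; exact: (cvg_comp _ _ H cb).
Qed.

Lemma bounded_cvg (h : nat -> measurableTypeR R -> R) (M l : R) :
  (forall n, measurable_fun setT (h n)) -> (forall n x, `|h n x| <= M) ->
  (forall x, h n x @[n --> \oo] --> l) -> 'E1 (h n) @[n --> \oo] --> l.
Proof.
move=> mh hM hl.
have H := @dominated_cvg _ _ _ P1 setT measurableT (fun n x => (h n x)%:E)
  (cst l%:E) (cst M%:E).
apply: fine_cvg.
have -> : l%:E = (\int[P1]_x cst l%:E x)%E.
  rewrite integral_cst//= (_ : P1 setT = 1%E) ?mule1//; exact: probability_setT.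
apply: H => //.
- by move=> n; exact/measurable_EFinP.
- by move=> x _; apply: cvg_EFin; [exact: nearW|exact: hl].
- exact: finite_measure_integrable_cst.
- by move=> n x _ /=; rewrite lee_fin.
Qed.

(** With [N = 1 / n.+1], the second derivative carries [N^2 <= N] and the drift term carries [N];
    [C] is the sum of bounds on the first two derivatives of [bump]. *)
Lemma cutoff_op_le : exists C, forall n t,
  `|diff_op1 pi1 (cutoff n) t| <= n.+1%:R^-1 * (C * (1 + `|s1 t|)).
Proof.
(* The bump is the cutoff at scale 1. *)
have [C2b cK] : C2_compact (bump : R -> R).
  have := cutoff_test 0; rewrite (_ : cutoff 0 = bump)//.
  by apply/funext => t; rewrite /cutoff invr1 mul1r.
have cl : closed (closure [set x : R | bump x != 0]) by exact: closed_closure.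
have b0 := @closure_supported _ _ (bump : R -> R).
have d0 := derive_supported (1 : R) cl b0; have dd0 := derive_supported (1 : R) cl d0.
have [db dDb cDD] := C2b.
have [B1 HB1] := supported_bounded cK (C2_derive_continuous (v := (1 : R)) C2b) d0.
have [B2 HB2] := supported_bounded cK (cDD 1 1) dd0.
have DZ (g : R -> R) (a t : R) : differentiable g t -> 'D_a g t = a * 'D_1 g t.
  move=> dg; rewrite !deriveE// -[a in LHS]mulr1 -[a * 1]/(a *: (1 : R)).
  by rewrite linearZ.
exists (B1 + B2) => n t; rewrite diff_op1E.
set N : R := n.+1%:R^-1; have N0 : 0 < N by rewrite invr_gt0.
have N1 : N <= 1 by rewrite invf_le1// ler1n.
have D1 : 'D_1 (cutoff n) = fun t => N * 'D_1 bump (N * t).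
  by rewrite derive_cutoff; apply/funext => y /=; rewrite mulr1 DZ.
have D2 : 'D_1 ('D_1 (cutoff n)) t = N * N * 'D_1 ('D_1 bump) (N * t).
  rewrite derive_cutoff.
  transitivity ('D_N ('D_(N * 1) bump) (N * t)).
    by apply: derive_line => h /=; rewrite scaleL mulr1.
  rewrite mulr1 DZ; last exact: dDb.
  have -> : 'D_N bump = N *: 'D_1 bump by apply/funext => y; rewrite DZ.
  by rewrite deriveZ ?mulrA//; exact: diff_derivable.
rewrite D2 (congr1 (@^~ t) D1) (le_trans (ler_normD _ _))// !normrM !(ger0_norm (ltW N0)).
have key a b s : 0 <= a -> a <= B2 -> 0 <= b -> b <= B1 -> 0 <= s ->
    N * N * a + s * (N * b) <= N * ((B1 + B2) * (1 + s)).
  move=> a0 aB b0' bB s0.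
  have -> : N * N * a + s * (N * b) = N * (N * a + s * b) by ring.
  rewrite ler_wpM2l ?(ltW N0)//.
  have h1 : N * a <= B2 by apply: le_trans aB; rewrite -[leRHS]mul1r ler_wpM2r.
  have h2 : s * b <= s * B1 by rewrite ler_wpM2l.
  have h3 : 0 <= s * B2 by rewrite mulr_ge0// (le_trans a0).
  have h4 : 0 <= B1 by exact: le_trans bB.
  apply: (le_trans (lerD h1 h2)).
  have -> : (B1 + B2) * (1 + s) = (B2 + s * B1) + (B1 + s * B2) by ring.
  by rewrite lerDl addr_ge0.
by apply: key => //.
Qed.

(** The first two limits are dominated convergence; the third integral is at most [n.+1%:R^-1] times
    a constant, finite since a square integrable score is integrable. *)
Lemma cutoff_integrals :
  [/\ 'E1 (cutoff n) @[n --> \oo] --> (1 : R),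
      'E1 (fun x => cutoff n x ^+ 2) @[n --> \oo] --> (1 : R) &
      'E1 (fun x => cutoff n x * diff_op1 pi1 (cutoff n) x) @[n --> \oo] --> (0 : R)].
Proof.
have bc n := (test1_bmfun lips (cutoff_test n)).1.
have bLc n := (test1_bmfun lips (cutoff_test n)).2.
split.
- apply: (@bounded_cvg _ 1) => [n|n x|x]; first exact: (bc n).1.
    exact: cutoff_norm_le1.
  exact: cutoff_cvg.
- apply: (@bounded_cvg _ 1) => [n|n x|x]; first exact: (bmfun_sqr (bc n)).1.
    by rewrite normrX expr_le1// cutoff_norm_le1.
  rewrite -(mul1r (1 : R)); under eq_fun do rewrite expr2.
  by apply: cvgM; exact: cutoff_cvg.
have [C HC] := cutoff_op_le; pose K := 'E1 (fun x => C * (1 + `|s1 x|)).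
have iK : P1.-integrable setT (EFin \o (fun x => C * (1 + `|s1 x|))).
  have i1 : P1.-integrable setT (EFin \o cst (1 : R)) by exact: finite_measure_integrable_cst.
  have := integrableZl measurableT C (integrableD measurableT i1 (integrable_norm (Lfun2_int s1L))).
  exact: eq_integrable.
apply/norm_cvg0P; apply: (@squeeze_cvgr _ _ _ _ (cst 0) (fun n => n.+1%:R^-1 * K)).
- apply: nearW => n /=; rewrite normr_ge0/=.
  have bcL := bmfunM (bc n) (bLc n).
  apply: (le_trans (le_normr_Rintegral measurableT (bmfun_int P1 bcL))).
  rewrite -(RintegralZl _ measurableT iK).
  apply: (le_Rintegral measurableT (integrable_norm (bmfun_int P1 bcL))).
    have := integrableZl measurableT (n.+1%:R^-1) iK; exact: eq_integrable.
  move=> x _ /=; rewrite normrM -[leRHS]mul1r ler_pM//; first exact: cutoff_norm_le1.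
- exact: cvg_cst.
- have H : n.+1%:R^-1 * K @[n --> \oo] --> (0 * K : R).
    by apply: cvgMl; exact: cvg_harmonic.
  by rewrite mul0r in H.
Qed.

End cutoff.

Section spectral_gap_value.
Context {R : realType} (pi1 : R -> R) (P1 : probability (measurableTypeR R) R).
Hypothesis lips : lipschitz (score1 pi1).
Hypothesis s1L : score1 pi1 \in Lfun P1 2%:E.
Context (k : nat) (c : 'I_k -> R) (Q : 'M[R]_k).
Hypotheses (c0 : forall i, 0 < c i) (Qu : Q \in unitmx) (Qo : Q^T = invmx Q).
Local Notation S := (shape c Q).
Local Notation Pi := (rotated_product P1 c Q).
Local Notation "''E1' f" := (\int[P1]_x f x) (at level 10, f at level 9).
Local Notation "''Ek' f" := (\int[Pi]_x f x) (at level 10, f at level 9).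

Let cvg_prodR (I : Type) (s : seq I) (a : nat -> I -> R) (b : I -> R) :
  (forall i, a n i @[n --> \oo] --> b i) ->
  \prod_(i <- s) a n i @[n --> \oo] --> \prod_(i <- s) b i.
Proof.
move=> ab; elim: s => [|i s IH].
  by rewrite big_nil; under eq_fun do rewrite big_nil; exact: cvg_cst.
by rewrite big_cons; under eq_fun do rewrite big_cons; exact: cvgM.
Qed.

Let cvg_sumR (I : Type) (s : seq I) (a : nat -> I -> R) (b : I -> R) :
  (forall i, a n i @[n --> \oo] --> b i) ->
  \sum_(i <- s) a n i @[n --> \oo] --> \sum_(i <- s) b i.
Proof.
move=> ab; elim: s => [|i s IH].
  by rewrite big_nil; under eq_fun do rewrite big_nil; exact: cvg_cst.
by rewrite big_cons; under eq_fun do rewrite big_cons; exact: cvgD.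
Qed.

Lemma tensor_integral (u : 'I_k -> measurableTypeR R -> R) :
  (forall m, bmfun (u m)) -> 'Ek (tensor c Q u) = \prod_m 'E1 (u m).
Proof.
move=> bu; have ui m : P1.-integrable setT (EFin \o u m) by exact: bmfun_int.
exact: (rotated_product_prod c0 Qu ui).2.
Qed.

(* Test the inequality with [f (y i)] times cutoffs in the other coordinates
   [y = S x], and let the cutoffs tend to 1. *)
Lemma weighted_poincare_tensor (w : 'I_k -> R) r i (f : R -> R) :
  (forall g, C2_compact g -> 'Ek (fun x => g x ^+ 2) - ('Ek g) ^+ 2 <=
    - r^-1 * 'Ek (fun x => g x * weighted_op pi1 c Q w g x)) ->
  C2_compact f -> 'E1 (fun x => f x ^+ 2) - ('E1 f) ^+ 2 <=
    - r^-1 * (w i * 'E1 (fun x => f x * diff_op1 pi1 f x)).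
Proof.
move=> H Cf.
pose u n m : R -> R := if m == i then f else cutoff n.
have Cu n m : C2_compact (u n m).
  by rewrite /u; case: eqP => // _; exact: cutoff_test.
pose F n := tensor c Q (u n).
have CF n : C2_compact (F n) by exact: tensor_C2_compact.
have bu n m : bmfun (u n m : measurableTypeR R -> R) := (test1_bmfun lips (Cu n m)).1.
have bLu n m : bmfun (diff_op1 pi1 (u n m) : measurableTypeR R -> R) :=
  (test1_bmfun lips (Cu n m)).2.
have [c1 c2 c3] := cutoff_integrals lips s1L.
pose a n m := 'E1 (fun x => u n m x ^+ 2).
pose b n m := 'E1 (u n m).
(* Factors of the energy in direction [l]: the operator acts on the [l]-th factor only, the others
   contribute their squares. *)
pose d n l m := if m == l then 'E1 (fun x => u n l x * diff_op1 pi1 (u n l) x) else a n m.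
have sqE n : 'Ek (fun x => F n x ^+ 2) = \prod_m a n m.
  rewrite -tensor_integral; last by move=> m; exact: bmfun_sqr.
  by apply: eq_Rintegral => x _; rewrite /F /tensor -prodrXl.
have meanE n : 'Ek (F n) = \prod_m b n m by rewrite tensor_integral.
have opE n : 'Ek (fun x => F n x * weighted_op pi1 c Q w (F n) x) =
    \sum_l w l * \prod_m d n l m.
  have bF := (testk_bmfun c Q lips (CF n)).1.
  have bop l := bmfunM bF ((testk_bmfun c Q lips (CF n)).2 l).
  have [_ E] := Rintegral_sum Pi (fun l => bmfunZ (w l) (bop l)).
  transitivity ('Ek (fun x => \sum_l w l * (F n x * axis_op pi1 c Q l (F n) x))).
    apply: eq_Rintegral => x _; rewrite mulr_sumr; apply: eq_bigr => l _; ring.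
  rewrite E; apply: eq_bigr => l _.
  rewrite (RintegralZl _ measurableT (bmfun_int Pi (bop l))); congr (_ * _).
  pose v m : R -> R := if m == l then (fun t => u n l t * diff_op1 pi1 (u n l) t)
    else (fun t => u n m t ^+ 2).
  have bv m : bmfun (v m : measurableTypeR R -> R).
    rewrite /v; case: eqP => [_|_]; last exact: bmfun_sqr.
    exact: bmfunM (bu n l) (bLu n l).
  rewrite (eq_bigr (fun m => 'E1 (v m))); last by move=> m _; rewrite /d /v; case: eqP.
  rewrite -tensor_integral//; apply: eq_Rintegral => x _.
  have [C2u _] := Cu n l.
  rewrite /F (axis_op_tensor _ c0 Qu Qo _ C2u) /tensor -big_split/=.
  apply: eq_bigr => m _; rewrite /upd /v; case: eqP => [->//|_].
  by rewrite expr2.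
pose A m := if m == i then 'E1 (fun x => f x ^+ 2) else 1.
pose B m := if m == i then 'E1 f else 1.
(* In the limit every direction [l != i] contains the vanishing energy of a cutoff, so only [l = i]
   survives. *)
pose D l m := if m == l then (if l == i then 'E1 (fun x => f x * diff_op1 pi1 f x) else 0)
  else A m.
have lA m : a n m @[n --> \oo] --> A m.
  by rewrite /a /A /u; case: eqP => _; [exact: cvg_cst|exact: c2].
have lB m : b n m @[n --> \oo] --> B m.
  by rewrite /b /B /u; case: eqP => _; [exact: cvg_cst|exact: c1].
have lD l m : d n l m @[n --> \oo] --> D l m.
  rewrite /d /D; case: eqP => _; last exact: lA.
  by rewrite /u; case: eqP => _; [exact: cvg_cst|exact: c3].
have prod1 (X : 'I_k -> R) : (forall m, m != i -> X m = 1) -> \prod_m X m = X i.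
  by move=> X1; rewrite (bigD1 i)//= big1 ?mulr1.
have EA : \prod_m A m = 'E1 (fun x => f x ^+ 2).
  by rewrite prod1 /A ?eqxx// => m /negbTE ->.
have EB : \prod_m B m = 'E1 f by rewrite prod1 /B ?eqxx// => m /negbTE ->.
have ED : \sum_l w l * \prod_m D l m = w i * 'E1 (fun x => f x * diff_op1 pi1 f x).
  rewrite (bigD1 i)//= [X in _ + X]big1 ?addr0; last first.
    by move=> l li; rewrite (bigD1 l)//= /D eqxx (negbTE li) mul0r mulr0.
  by rewrite prod1 /D ?eqxx// => m mi; rewrite (negbTE mi) /A (negbTE mi).
have lL : \prod_m a n m - (\prod_m b n m) * (\prod_m b n m) @[n --> \oo] -->
    'E1 (fun x => f x ^+ 2) - 'E1 f * 'E1 f.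
  rewrite -EA -EB; apply: cvgB; first exact: cvg_prodR.
  by apply: cvgM; exact: cvg_prodR.
have lR : - r^-1 * (\sum_l w l * \prod_m d n l m) @[n --> \oo] -->
    - r^-1 * (w i * 'E1 (fun x => f x * diff_op1 pi1 f x)).
  rewrite -ED; apply: cvgM; first exact: cvg_cst.
  apply: cvg_sumR => l; apply: cvgM; first exact: cvg_cst.
  by apply: cvg_prodR => m; exact: lD.
rewrite [('E1 f) ^+ 2]expr2 -(cvg_lim _ lL)// -(cvg_lim _ lR)//.
apply: ler_lim; [by apply/cvg_ex; eexists; exact: lL|by apply/cvg_ex; eexists; exact: lR|].
by apply: nearW => n; rewrite -sqE -meanE -opE -expr2; exact: H.
Qed.

Hypothesis pi1_gt0 : forall x, 0 < pi1 x.
Hypothesis dlog : forall x, derivable (fun y => ln (pi1 y)) x 1.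

(** [i] is an index of least weight, supplied by the caller so that the value of the gap is explicit
    in it. *)
Lemma generator_gap lambda (sigma2 : R) (D : 'rV[R]_k) i :
  spectral_gap P1 (generator1 P1 pi1) lambda -> 0 < sigma2 ->
  covariance_mx Pi (score (product_density pi1 c Q)) =
    sigma2 *: (Q^T *m diag_mx (\row_i c i ^+ 2) *m Q) ->
  (forall l, 0 < D 0 l) -> (forall l, D 0 i * c i ^+ 2 <= D 0 l * c l ^+ 2) ->
  spectral_gap Pi (generator Pi (product_density pi1 c Q) (Q^T *m diag_mx D *m Q))
    (lambda * (k%:R * (D 0 i * c i ^+ 2) / (sigma2 * \sum_l D 0 l * c l ^+ 2))).
Proof.
move=> [l0 Pl maxl] s0 SE D0 Di.
have Q1 : Q *m Q^T = 1%:M by rewrite Qo mulmxV.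
set L := Q^T *m diag_mx D *m Q; set Sg := covariance_mx _ _ in SE *.
(* The normalisation is the trace of a product of two matrices that [Q] diagonalises
   simultaneously. *)
have ME : mxdot L Sg = sigma2 * \sum_l D 0 l * c l ^+ 2.
  have -> : mxdot L Sg = \tr (L *m Sg).
    rewrite /mxdot /mxtrace exchange_big; apply: eq_bigr => j _.
    by rewrite mxE.
  rewrite SE -scalemxAr mxtraceZ; congr (_ * _).
  rewrite /L !mulmxA -[_ *m Q *m Q^T]mulmxA Q1 mulmx1.
  rewrite mxtrace_mulC !mulmxA Q1 mul1mx mulmx_diag mxtrace_diag.
  by apply: eq_bigr => l _; rewrite !mxE.
have T0 : 0 < \sum_l D 0 l * c l ^+ 2.
  rewrite (bigD1 i)//= ltr_pwDl// ?mulr_gt0 ?exprn_gt0//.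
  by apply: sumr_ge0 => l _; rewrite mulr_ge0 ?exprn_ge0 ?ltW.
set M := sigma2 * _ in ME *; have M0 : 0 < M by rewrite mulr_gt0.
pose w l := k%:R * (D 0 l * c l ^+ 2) / M.
have k0 : 0 < k%:R :> R by rewrite ltr0n (leq_ltn_trans _ (ltn_ord i)).
have w0 l : 0 < w l by rewrite /w divr_gt0// !mulr_gt0// exprn_gt0.
have opE f : C2_compact f ->
    diff_op (product_density pi1 c Q) Sg L f = weighted_op pi1 c Q w f.
  move=> [Cf _]; apply/funext => x.
  rewrite (diff_opE pi1_gt0 dlog c0 Qu Qo)// -/L ME.
  by apply: eq_bigr => l _; rewrite /w !mulrA.
have genP r : poincare Pi (generator Pi (product_density pi1 c Q) L) r <->
    forall f, C2_compact f -> 'Ek (fun x => f x ^+ 2) - ('Ek f) ^+ 2 <=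
    - r^-1 * 'Ek (fun x => f x * weighted_op pi1 c Q w f x).
  rewrite /generator -/Sg poincare_closure; last first.
    move=> f Cf; rewrite opE//; split; apply: bmfun_Lfun2.
      exact: (testk_bmfun c Q lips Cf).1.
    exact: (weighted_op_bmfun P1 lips c Q w Cf).
  split=> H f Cf; first by have := H f Cf; rewrite opE.
  by rewrite opE//; exact: H.
split.
- by rewrite mulr_gt0// w0.
- apply/genP; apply: (weighted_poincare lips c0 Qu Qo l0 Pl) => [|l].
    by rewrite mulr_gt0// w0.
  by rewrite ler_pM2l// ler_pM2r ?invr_gt0// ler_pM2l.
(* If [r] is a Poincare constant here, testing on the [i]-th coordinate shows that [r / w i] is one
   for [G_1]; maximality of [lambda] concludes. *)
move=> r r0 /genP Hr; rewrite -/(w i) -ler_pdivrMr//; apply: maxl; first by rewrite divr_gt0.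
apply/(poincare1_test P1 lips); first by rewrite divr_gt0.
move=> f Cf; apply: (le_trans (weighted_poincare_tensor i Hr Cf)).
rewrite le_eqVlt; apply/orP; left; apply/eqP.
by rewrite invf_div; field; rewrite gt_eqF.
Qed.

End spectral_gap_value.

(** * Matrices conjugate to a diagonal matrix *)

Section conjugated_diagonal.
Context {R : realType} (k : nat) (Q : 'M[R]_k).
Hypothesis (Q_unit : Q \in unitmx) (Q_orth : Q^T = invmx Q).
Local Notation conj d := (Q^T *m diag_mx d *m Q).

Let QQt : Q *m Q^T = 1%:M. Proof. by rewrite Q_orth mulmxV. Qed.
Let QtQ : Q^T *m Q = 1%:M. Proof. by rewrite Q_orth mulVmx. Qed.

Lemma conj_diagM (a b : 'rV[R]_k) :
  conj a *m conj b = conj (\row_i (a 0 i * b 0 i)).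
Proof.
rewrite !mulmxA -[_ *m Q *m Q^T]mulmxA QQt mulmx1.
by rewrite -[_ *m diag_mx a *m _]mulmxA mulmx_diag.
Qed.

Lemma conj_diag1 : conj (\row_i 1) = 1%:M.
Proof.
rewrite (_ : diag_mx _ = 1%:M) ?mulmx1//.
by apply/matrixP => i j; rewrite !mxE.
Qed.

Lemma conj_diag_inv (a : 'rV[R]_k) : (forall i, a 0 i != 0) ->
  conj a \in unitmx /\ invmx (conj a) = conj (\row_i (a 0 i)^-1).
Proof.
move=> a0; have E : conj a *m conj (\row_i (a 0 i)^-1) = 1%:M.
  rewrite conj_diagM -conj_diag1; congr (_ *m diag_mx _ *m _).
  by apply/rowP => i; rewrite !mxE divff.
have [au _] := mulmx1_unit E; split=> //.
by rewrite -[RHS](mulKmx au) E mulmx1.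
Qed.

Lemma conj_diag_quad (a : 'rV[R]_k) (v : 'cV[R]_k) :
  (v^T *m conj a *m v) 0 0 = \sum_i a 0 i * (Q *m v) i 0 ^+ 2.
Proof.
have -> : v^T *m conj a *m v = (Q *m v)^T *m diag_mx a *m (Q *m v).
  by rewrite trmx_mul !mulmxA.
rewrite mxE; apply: eq_bigr => i _.
by rewrite mul_mx_diag !mxE; ring.
Qed.

Lemma spd_conj_diag (a : 'rV[R]_k) : spd (conj a) <-> forall i, 0 < a 0 i.
Proof.
split=> [[_ pos] i|a0].
  (* The [i]-th row of [Q], as a column, isolates the entry [a 0 i] of the quadratic form. *)
  have := pos (Q^T *m delta_mx i 0); rewrite conj_diag_quad mulmxA QQt mul1mx.
  rewrite (bigD1 i)//= big1 => [|j ji]; last by rewrite !mxE (negbTE ji) expr0n mulr0.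
  rewrite !mxE !eqxx expr1n mulr1 addr0; apply.
  apply/eqP => /(congr1 (mulmx Q)); rewrite mulmxA QQt mul1mx mulmx0.
  move=> /colP/(_ i); rewrite !mxE eqxx/= => /eqP.
  by rewrite oner_eq0.
split=> [|v v0]; first by rewrite !trmx_mul trmxK tr_diag_mx mulmxA.
rewrite conj_diag_quad.
have t0 i : 0 <= a 0 i * (Q *m v) i 0 ^+ 2 by rewrite mulr_ge0 ?sqr_ge0// ltW.
rewrite lt_neqAle sumr_ge0// andbT eq_sym; apply: contraNneq v0 => S0.
rewrite -(mulKmx Q_unit v); apply/eqP.
rewrite (_ : Q *m v = 0) ?mulmx0//; apply/colP => i; rewrite [RHS]mxE.
have /eqP : a 0 i * (Q *m v) i 0 ^+ 2 = 0.
  exact: (psumr_eq0P (fun i _ => t0 i) S0).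
by rewrite mulf_eq0 (gt_eqF (a0 i)) /= sqrf_eq0 => /eqP.
Qed.

(** Eigenvectors are row vectors here. The rows of [Q] are eigenvectors; conversely, if [v] is one,
    any nonzero entry of [v *m Q^T] identifies its eigenvalue as the corresponding entry of [a]. *)
Lemma min_eigenvalue_conj_diag (a : 'rV[R]_k) i :
  (forall j, a 0 i <= a 0 j) -> min_eigenvalue (conj a) (a 0 i).
Proof.
move=> ai; split=> [|b /eigenvalueP[v vE v0]].
  apply/eigenvalueP; exists (delta_mx 0 i *m Q).
    rewrite !mulmxA -[_ *m Q *m Q^T]mulmxA QQt mulmx1 scalemxAl; congr (_ *m _).
    apply/rowP => j; rewrite mul_mx_diag !mxE.
    by rewrite eqxx /=; case: (eqVneq j i) => [->|_]; rewrite ?mulr0 ?mul0r ?mulr1 ?mul1r.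
  apply/eqP => /(congr1 (mulmxr Q^T))/=; rewrite -mulmxA QQt mulmx1 mul0mx.
  by move=> /rowP/(_ i); rewrite !mxE !eqxx/= => /eqP; rewrite oner_eq0.
pose u := v *m Q^T.
have uE : u *m diag_mx a = b *: u.
  rewrite /u scalemxAl -vE -!mulmxA QQt mulmx1.
  by rewrite !mulmxA.
have /rV0Pn[j uj] : u != 0.
  by apply: contraNneq v0 => u0; rewrite -[v]mulmx1 -QtQ mulmxA -/u u0 mul0mx.
have /rowP/(_ j) := uE; rewrite mul_mx_diag [LHS]mxE [RHS]mxE mulrC.
move=> /(mulIf uj) <-.
exact: ai.
Qed.

End conjugated_diagonal.

(** * The optimal shape and the ratio of the gaps *)

Theorem theorem2p8 (R : realType)
    (pi1 : R -> R) (P1 : probability (measurableTypeR R) R)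
    (lambda_star : R)
    (k : nat) (c : 'I_k -> R) (Q : 'M[R]_k)
    (pi1_gt0 : forall x, 0 < pi1 x)
    (P1_pi1 : has_density (@lebesgue_measure R) P1 pi1)
    (log_pi1_derivable : forall x, derivable (fun y => ln (pi1 y)) x 1)
    (score1_lipschitz : lipschitz (score1 pi1))
    (gap1 : spectral_gap P1 (generator1 P1 pi1) lambda_star)
    (k_gt0 : (0 < k)%N)
    (c_gt0 : forall i, 0 < c i)
    (Q_unit : Q \in unitmx) (Q_orth : Q^T = invmx Q) :
  let pi := product_density pi1 c Q in
  let sigma2 := fine 'E_P1[fun x => score1 pi1 x ^+ 2] in
  (forall (d : measure_display) (T : measurableType d) (P : probability T R)
      (X : {mfun T >-> 'cV[R]_k}),
    has_density (lebesgue_cV k) (distribution P X) pi <->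
    iid_with_density P (fun i w => c i * (Q *m X w) i 0) pi1) /\
  exists Pi : probability 'cV[R]_k R,
    has_density (lebesgue_cV k) Pi pi /\
    let Sigma := covariance_mx Pi (score pi) in
    let Lambda_opt := invmx Sigma in
    [/\ score1 pi1 \in Lfun P1 2%:E /\
          (forall i, (fun x => score pi x i 0) \in Lfun Pi 2%:E),
        Sigma = sigma2 *: (Q^T *m diag_mx (\row_i c i ^+ 2) *m Q),
        Sigma \in unitmx,
        spd Lambda_opt /\
          (exists D : 'rV[R]_k, Lambda_opt = Q^T *m diag_mx D *m Q)
      & exists gap_opt : R,
        [/\ spectral_gap Pi (generator Pi pi Lambda_opt) gap_opt,
            (forall D : 'rV[R]_k, spd (Q^T *m diag_mx D *m Q) ->
              exists2 gap : R,
                spectral_gap Pi (generator Pi pi (Q^T *m diag_mx D *m Q)) gap &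
                gap <= gap_opt)
          & exists gap_I lambda1 : R,
            [/\ spectral_gap Pi (generator Pi pi 1%:M) gap_I,
                min_eigenvalue Sigma lambda1 &
                gap_opt / gap_I = \tr Sigma / (k%:R * lambda1)]]].
Proof.
move=> pi sigma2.
have pi1_ge0 x : 0 <= pi1 x by rewrite ltW.
have mpi1 := measurable_pi1 pi1_gt0 log_pi1_derivable.
have s1L := score1_Lfun2 pi1_gt0 P1_pi1 log_pi1_derivable score1_lipschitz.
have [l0 Pl maxl] := gap1.
split; first by move=> d T P X; exact: (has_density_iid mpi1 pi1_ge0 P1_pi1 c_gt0 Q_unit Q_orth).
exists (rotated_product P1 c Q); split.
  exact: (rotated_product_density mpi1 pi1_ge0 P1_pi1 c_gt0 Q_unit Q_orth).
set Pi := rotated_product P1 c Q.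
have s2E : sigma2 = \int[P1]_x score1 pi1 x ^+ 2 by rewrite /sigma2 unlock.
have s20 : 0 < sigma2 by rewrite s2E; exact: sigma2_gt0.
have SE : covariance_mx Pi (score pi) =
    sigma2 *: (Q^T *m diag_mx (\row_i c i ^+ 2) *m Q).
  by rewrite s2E; exact: score_covariance.
move=> Sigma Lambda_opt.
pose a : 'rV[R]_k := \row_i (sigma2 * c i ^+ 2).
have a0 i : 0 < a 0 i by rewrite mxE mulr_gt0// exprn_gt0.
have SaE : Sigma = Q^T *m diag_mx a *m Q.
  rewrite /Sigma SE scalemxAl scalemxAr; congr (_ *m _ *m _).
  by apply/matrixP => i j; rewrite !mxE mulrnAr.
have [Su LE] := conj_diag_inv Q_unit Q_orth (fun i => lt0r_neq0 (a0 i)).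
pose b : 'rV[R]_k := \row_i (a 0 i)^-1.
have b0 i : 0 < b 0 i by rewrite mxE invr_gt0.
have LbE : Lambda_opt = Q^T *m diag_mx b *m Q by rewrite /Lambda_opt SaE LE.
pose i0 := Ordinal k_gt0.
have argmin (f : 'I_k -> R) : exists i, forall j, f i <= f j.
  by case: (@arg_minP _ _ _ i0 xpredT f) => // i _ H; exists i => j; exact: H.
have gapE D i := @generator_gap R pi1 P1 score1_lipschitz s1L k c Q c_gt0 Q_unit
  Q_orth pi1_gt0 log_pi1_derivable lambda_star sigma2 D i gap1 s20 SE.
have k0 : 0 < k%:R :> R by rewrite ltr0n.
(* The inverse of Sigma equalises the weights; normalised, each is [1 / sigma2], so any index, here
   [i0], attains the least one. *)
have bc i : b 0 i * c i ^+ 2 = sigma2^-1.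
  by rewrite !mxE invfM -mulrA mulVf ?mulr1// gt_eqF// exprn_gt0.
have gap_opt : spectral_gap Pi (generator Pi pi Lambda_opt) (lambda_star / sigma2).
  rewrite LbE (_ : lambda_star / sigma2 = lambda_star * (k%:R * (b 0 i0 * c i0 ^+ 2) /
      (sigma2 * \sum_l b 0 l * c l ^+ 2))).
    by apply: gapE => // l; rewrite !bc.
  rewrite (eq_bigr (fun=> sigma2^-1)); last by move=> i _; rewrite bc.
  rewrite sumr_const card_ord bc -[sigma2^-1 *+ k]mulr_natl; field.
  by rewrite !gt_eqF.
split.
- split => // i; exact: score_Lfun2.
- exact: SE.
- by rewrite SaE.
- split; last by exists b.
  by rewrite LbE; exact/(spd_conj_diag Q_unit Q_orth).
exists (lambda_star / sigma2); split => //.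
  move=> D /(spd_conj_diag Q_unit Q_orth) D0.
  have [i Di] := argmin (fun i => D 0 i * c i ^+ 2).
  exists (lambda_star * (k%:R * (D 0 i * c i ^+ 2) / (sigma2 * \sum_l D 0 l * c l ^+ 2))).
    exact: gapE.
  set m := D 0 i * _; set t := \sum_l _.
  have t0 : 0 < t.
    rewrite /t (bigD1 i)//= ltr_pwDl ?mulr_gt0 ?exprn_gt0//.
    by apply: sumr_ge0 => l _; rewrite mulr_ge0 ?exprn_ge0 ?ltW.
  (* After cancellation the claim is [k * m <= t]: the least of the [D_l c_l^2] is at most their
     average. *)
  rewrite ler_pM2l// invfM mulrA -[leRHS]mul1r mulrAC ler_pM2r ?invr_gt0//.
  rewrite ler_pdivrMr// mul1r /t -[in k%:R](card_ord k) mulr_natl -sumr_const.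
  by apply: ler_sum => l _; exact: Di.
(* The identity is the case [D = 1]: the index of the smallest [c i] gives both the least weight and
   the minimal eigenvalue [sigma2 * c i ^+ 2], which is why the ratio involves that eigenvalue. *)
have [i ci] := argmin (fun i => c i ^+ 2).
exists (lambda_star * (k%:R * c i ^+ 2 / (sigma2 * \sum_l c l ^+ 2))), (a 0 i).
have gapI := gapE (\row_i 1) i.
split.
- rewrite -(conj_diag1 Q_unit Q_orth).
  have -> : lambda_star * (k%:R * c i ^+ 2 / (sigma2 * \sum_l c l ^+ 2)) =
      lambda_star * (k%:R * ((\row_i 1 : 'rV[R]_k) 0 i * c i ^+ 2) /
      (sigma2 * \sum_l (\row_i 1 : 'rV[R]_k) 0 l * c l ^+ 2)).
    by rewrite mxE mul1r; under [in RHS]eq_bigr do rewrite mxE mul1r.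
  by apply: gapI => l; rewrite !mxE ?mul1r.
- rewrite SaE; apply: min_eigenvalue_conj_diag => // j.
  by rewrite !mxE ler_pM2l.
have t0 : 0 < \sum_l c l ^+ 2.
  rewrite (bigD1 i)//= ltr_pwDl ?exprn_gt0//.
  by apply: sumr_ge0 => l _; rewrite exprn_ge0 ?ltW.
have -> : \tr Sigma = sigma2 * \sum_l c l ^+ 2.
  rewrite SaE mxtrace_mulC mulmxA Q_orth mulmxV// mul1mx mxtrace_diag mulr_sumr.
  by apply: eq_bigr => l _; rewrite mxE.
have ci0 := c_gt0 i; rewrite mxE; field.
by rewrite !gt_eqF.
Qed.
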